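(* Let $M^3$ be a real-analytic $3$-manifold endowed with a real-analytic unimodular CR-structure $\Psi$. Suppose that $(X_1,\Upsilon_1)$ and $(X_2,\Upsilon_2)$ are two unimodular complex surfaces such that there exist real-analytic embeddings $\phi_i:M\to X_i$ ($i=1,2$) satisfying $$\phi_1^*(\Upsilon_1)=\phi_2^*(\Upsilon_2)=\Psi.$$ Then there exist open sets $U_i\subset X_i$, with $U_i$ containing $\phi_i(M)$, and a unimodular biholomorphism $\Phi:(U_1,\Upsilon_1)\to(U_2,\Upsilon_2)$ such that $\phi_2=\Phi\circ\phi_1$. Moreover, $(\Phi,U_1,U_2)$ is locally unique in the sense that, if $(\tilde\Phi,\tilde U_1,\tilde U_2)$ is another triple with these properties, then there exists an open subset $V_1\subset U_1\cap\tilde U_1$ containing $\phi_1(M)$ such that $\tilde\Phi=\Phi$ on $V_1$.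
   Context: A unimodular complex surface is a pair $(X,\Upsilon)$ where $X$ is a complex manifold of complex dimension $2$ and $\Upsilon$ is a nowhere-vanishing holomorphic $2$-form on $X$. A unimodular biholomorphism $\Phi:(U_1,\Upsilon_1)\to(U_2,\Upsilon_2)$ is a biholomorphism $\Phi:U_1\to U_2$ with $\Phi^*\Upsilon_2=\Upsilon_1$. A unimodular CR-structure on a $3$-manifold $M$ is a closed, complex-valued $2$-form $\Psi$ on $M$ whose real and imaginary parts are linearly independent at each point of $M$ (no nondegeneracy is assumed). *)

(* Defs.v *)
From HB Require Import structures.
From mathcomp Require Import all_boot all_order all_algebra.
From mathcomp Require Import all_classical all_reals all_analysis.
From mathcomp Require Import complex.
Set Implicit Arguments.
Unset Strict Implicit.
Unset Printing Implicit Defensive.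
Import Order.TTheory GRing.Theory Num.Theory.
Import numFieldNormedType.Exports.
Local Open Scope classical_set_scope.
Local Open Scope ring_scope.

Section Analytic.
Variables (K : numFieldType) (n : nat).

(* Sum of the terms c_m h^m over the multi-indices m in [0, N[^n. *)
Definition psum (c : {ffun 'I_n -> nat} -> K) (h : 'rV[K]_n) (N : nat) : K :=
  \sum_(m : {ffun 'I_n -> 'I_N})
     c [ffun i => m i : nat] * \prod_(i < n) h 0 i ^+ m i.

(* Near a, f is the sum of an absolutely convergent power series in x - a.
   For K = R this is real-analyticity, for K = R[i] holomorphy. *)
Definition analytic_at (f : 'rV[K]_n -> K) (a : 'rV[K]_n) : Prop :=
  exists c : {ffun 'I_n -> nat} -> K,
    \forall x \near a,
      (exists B : K, forall N : nat,
         psum (fun m => `|c m|) (map_mx Num.norm (x - a)) N <= B)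
      /\ psum c (x - a) @ \oo --> f x.

End Analytic.

Section Charts.
Variables (K : numFieldType) (n : nat).

(* Only the restriction of cmap to cdom is meaningful. *)
Record chart (T : Type) := Chart { cdom : set T ; cmap :> T -> 'rV[K]_n }.

(* Inverse of c; p is a junk value outside of the image of c. *)
Definition chart_inv (T : choiceType) (c : chart T) (p : T) (z : 'rV[K]_n) : T :=
  xget p [set q | cdom c q /\ c q = z].

Definition restrict_chart (T : Type) (U : set T) (c : chart T) : chart U :=
  Chart [set q : U | cdom c (set_val q)] (fun q : U => c (set_val q)).

End Charts.

Section Maps.
Variables (K : numFieldType) (n m : nat) (S T : choiceType).

Definition coord_expr (c : chart K n S) (d : chart K m T) (f : S -> T) (p : S) :
    'rV[K]_n -> 'rV[K]_m :=
  fun z => d (f (chart_inv c p z)).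

(* Rows are indexed by the coordinates of c, columns by those of d. *)
Definition jac (c : chart K n S) (d : chart K m T) (f : S -> T) (p : S) :
    'M[K]_(n, m) :=
  'J (coord_expr c d f p) (c p).

(* The first conjunct amounts to continuity of f at p. *)
Definition analytic_map (A : set (chart K n S)) (B : set (chart K m T))
    (f : S -> T) : Prop :=
  forall (p : S) c d, A c -> B d -> cdom c p -> cdom d (f p) ->
    (\forall z \near c p, cdom d (f (chart_inv c p z))) /\
    (forall j, analytic_at (fun z => coord_expr c d f p z 0 j) (c p)).

End Maps.

Record manifold (K : numFieldType) (n : nat) := Manifold {
  carrier :> topologicalType ;
  atlas : set (chart K n carrier) ;
  manifold_hausdorff : hausdorff_space carrier ;
  manifold_countable : @second_countable carrier ;
  atlas_cover : forall p : carrier, exists2 c, atlas c & cdom c p ;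
  atlas_open : forall c, atlas c -> open (cdom c) ;
  atlas_inj : forall c, atlas c ->
    forall p q, cdom c p -> cdom c q -> c p = c q -> p = q ;
  atlas_continuous : forall c, atlas c ->
    forall p, cdom c p -> {for p, continuous c} ;
  atlas_open_map : forall c, atlas c ->
    forall V : set carrier, open V -> V `<=` cdom c -> open (c @` V) ;
  atlas_analytic : analytic_map atlas atlas (@id carrier)
}.
Arguments atlas {K n} X : rename.

Definition sub_atlas (K : numFieldType) (n : nat) (X : manifold K n) (U : set X) :
    set (chart K n U) :=
  restrict_chart U @` atlas X.
Arguments sub_atlas {K n} X U.

Section Forms.

(* The 2-form with matrix A, pulled back by the linear map v |-> v *m J. *)
Definition pull (L : comNzRingType) (n m : nat) (J : 'M[L]_(n, m)) (A : 'M[L]_m) :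
    'M[L]_n :=
  J *m A *m J^T.

(* A 2-form is given by its matrix w c p in each chart c of the atlas, at each
   point p of the domain of c. Its values lie in L, a ring containing K
   by means of iota. *)
Definition is_2form (K : numFieldType) (L : comNzRingType) (iota : K -> L) (n : nat)
    (M : manifold K n) (w : chart K n M -> M -> 'M[L]_n) : Prop :=
  (forall c p, atlas M c -> cdom c p -> (w c p)^T = - w c p) /\
  (forall c d p, atlas M c -> atlas M d -> cdom c p -> cdom d p ->
     w c p = pull (map_mx iota (jac c d id p)) (w d p)).

(* part extracts a scalar from the entries of w: it is the identity, or the
   real or imaginary part. *)
Definition analytic_form (K : numFieldType) (L : Type) (part : L -> K) (n : nat)
    (M : manifold K n) (w : chart K n M -> M -> 'M[L]_n) : Prop :=
  forall c p, atlas M c -> cdom c p -> forall i j,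
    analytic_at (fun z => part (w c (chart_inv c p z) i j)) (c p).

Definition closed_form (K : numFieldType) (L : Type) (part : L -> K) (n : nat)
    (M : manifold K n) (w : chart K n M -> M -> 'M[L]_n) : Prop :=
  forall c p, atlas M c -> cdom c p -> forall i j k,
    let D i j k : K :=
      'D_(delta_mx 0 i) (fun z => part (w c (chart_inv c p z) j k)) (c p) in
    D i j k + D j k i + D k i j = 0.

End Forms.

Section Unimodular.
Variable R : realType.
Local Notation C := R[i].
Local Notation Re := (@complex.Re R).
Local Notation Im := (@complex.Im R).

Record unimodular_surface := UnimodularSurface {
  surface :> manifold C 2 ;
  vol : chart C 2 surface -> surface -> 'M[C]_2 ;
  vol_form : is_2form id vol ;
  vol_holomorphic : analytic_form id vol ;
  vol_neq0 : forall c p, atlas surface c -> cdom c p -> vol c p != 0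
}.

Record analytic_unimodular_CR (M : manifold R 3)
    (Psi : chart R 3 M -> M -> 'M[C]_3) : Prop := AnalyticUnimodularCR {
  CR_form : is_2form (real_complex R) Psi ;
  CR_analytic : analytic_form Re Psi /\ analytic_form Im Psi ;
  CR_closed : closed_form Re Psi /\ closed_form Im Psi ;
  CR_free : forall c p, atlas M c -> cdom c p ->
    free [:: map_mx Re (Psi c p); map_mx Im (Psi c p)]
}.

(* The coordinates (z_1, ..., z_n) become (Re z_1, ..., Re z_n, Im z_1, ..., Im z_n). *)
Definition realify (T : Type) (n : nat) (d : chart C n T) : chart R (n + n) T :=
  Chart (cdom d) (fun q => row_mx (map_mx Re (d q)) (map_mx Im (d q))).

Definition real_atlas (n : nat) (X : manifold C n) : set (chart R (n + n) X) :=
  @realify X n @` atlas X.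
Arguments real_atlas {n} X.

(* Jacobian matrix of (z_1, ..., z_n) from that of the 2n real coordinates. *)
Definition complex_jac (k n : nat) (J : 'M[R]_(k, n + n)) : 'M[C]_(k, n) :=
  map2_mx (@Complex R) (lsubmx J) (rsubmx J).

Definition topological_embedding (S T : topologicalType) (f : S -> T) : Prop :=
  [/\ injective f, continuous f &
      forall V : set S, open V ->
        exists2 W : set T, open W & f @` V = W `&` range f].

Definition analytic_embedding (k n : nat) (M : manifold R k) (X : manifold C n)
    (f : M -> X) : Prop :=
  [/\ topological_embedding f,
      analytic_map (atlas M) (real_atlas X) f &
      forall p c d, atlas M c -> real_atlas X d -> cdom c p -> cdom d (f p) ->
        row_free (jac c d f p)].

(* f^* vol = Psi; as vol is of type (2, 0), only the derivatives of the
   holomorphic coordinates along f are involved. *)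
Definition pulls_vol_to (M : manifold R 3) (X : unimodular_surface) (f : M -> X)
    (Psi : chart R 3 M -> M -> 'M[C]_3) : Prop :=
  forall p c d, atlas M c -> atlas X d -> cdom c p -> cdom d (f p) ->
    pull (complex_jac (jac c (realify d) f p)) (vol d (f p)) = Psi c p.

Section Biholomorphism.
Variables (X1 X2 : unimodular_surface) (U1 : set X1) (U2 : set X2).

Definition biholomorphism (Phi : U1 -> U2) : Prop :=
  analytic_map (sub_atlas X1 U1) (sub_atlas X2 U2) Phi /\
  exists Phi' : U2 -> U1,
    [/\ cancel Phi Phi', cancel Phi' Phi &
        analytic_map (sub_atlas X2 U2) (sub_atlas X1 U1) Phi'].

Definition unimodular_biholomorphism (Phi : U1 -> U2) : Prop :=
  biholomorphism Phi /\
  forall (p : U1) c d, atlas X1 c -> atlas X2 d ->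
    cdom c (set_val p) -> cdom d (set_val (Phi p)) ->
    pull (jac (restrict_chart U1 c) (restrict_chart U2 d) Phi p)
      (vol d (set_val (Phi p))) = vol c (set_val p).

Definition unimodular_extension (M : Type) (phi1 : M -> X1) (phi2 : M -> X2)
    (Phi : U1 -> U2) : Prop :=
  [/\ open U1 /\ open U2,
      range phi1 `<=` U1 /\ range phi2 `<=` U2,
      unimodular_biholomorphism Phi &
      forall (x : M) (p : U1), set_val p = phi1 x -> phi2 x = set_val (Phi p)].

End Biholomorphism.

End Unimodular.

(* Main.v *)
Require Import Defs.
From HB Require Import structures.
From mathcomp Require Import all_boot all_order all_algebra.
From mathcomp Require Import all_classical all_reals all_analysis.
From mathcomp Require Import complex.
From mathcomp Require Import cyclic separable cyclotomic.
From mathcomp Require Import ring lra.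
Set Implicit Arguments.
Unset Strict Implicit.
Unset Printing Implicit Defensive.
Import Order.TTheory GRing.Theory Num.Theory.
Import numFieldNormedType.Exports.
Import Normc.
Local Open Scope classical_set_scope.
Local Open Scope complex_scope.
Local Open Scope ring_scope.

(* Near a point of M, the coordinate expressions of phi1 and phi2 extend to holomorphic
   maps f, g : C^3 -> C^2. The pullbacks of the two volume forms agree at the real points,
   hence everywhere near them by the identity theorem; as Psi does not vanish, f and g are
   submersions whose fibers are tangent to the kernel of this common form. So
   g is constant along the fibers of f, and g = Phi o f for a holomorphic Phi. Pullback by
   the submersion f being injective on forms, Phi is unimodular. Two holomorphic germs that
   agree on phi1(M) agree after composition with f at the real points, hence everywhere,
   since f is open. By this uniqueness the local extensions glue along phi1(M); exchanging
   phi1 and phi2 gives a candidate for the inverse, and uniqueness shows that it is one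
   on suitable neighbourhoods.

   Holomorphic functions are handled as uniform limits of polynomials on polydiscs.
   Cauchy's estimates for polynomials, obtained by averaging over roots of unity, make
   these limits convergent power series. *)

(** * Holomorphic functions of several variables *)

(** The complexified domain has dimension 3 and the surfaces have dimension 2, so f has no inverse
    and Phi is not simply g o f^-1: the one-dimensional fibers have to be handled. They match
    because the pullback of a nonzero 2-form of C^2 by a submersion has exactly the kernel of the
    derivative as its kernel, and the two pullbacks are the same form. Derivatives are never taken
    term by term. They are read off from Hadamard's factorization f x - f y = (x - y) A(x, y), which
    yields Jacobians and the chain rule, Lipschitz bounds, and the contraction behind the inverse
    function theorem. In the gluing, two local extensions agree only near phi1(M), not on the whole
    overlap of their domains, and phi1(M) need not be closed. All domains are therefore shrunk at
    once, by means of a countable basis and of regularity. That phi1 is a topological embedding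
    ensures that the points of phi1(M) near phi1(p) come from points of M near p, so that a local
    extension has the right value at all of them. *)

Section ComplexAbs.
Variable R : realType.
Local Notation C := R[i].
Local Notation abs := (@normc R).
Implicit Types z w : C.

(** The norm of [R[i]] has its values in [R[i]]; estimates are carried out with the real-valued
    [abs], where the order is total and [lra] applies. *)
Lemma normCE z : `|z| = (abs z)%:C.
Proof. by case: z. Qed.

Lemma absE z : abs z = complex.Re `|z|.
Proof. by rewrite normCE. Qed.

Lemma abs_ge0 z : 0 <= abs z.
Proof. by case: z => a b; rewrite sqrtr_ge0. Qed.

Lemma absN z : abs (- z) = abs z.
Proof. by rewrite !absE normrN. Qed.

Lemma abs_gt0 z : z != 0 -> 0 < abs z.
Proof.
rewrite lt_def abs_ge0 andbT; apply: contra => /eqP/eq0_normc ->; exact: eqxx.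
Qed.

Lemma absB z w : abs (z - w) = abs (w - z).
Proof. by rewrite -absN opprB. Qed.

Lemma absD z w : abs (z + w) <= abs z + abs w.
Proof. exact: le_normcD. Qed.

Lemma abs_split u z w : abs (z - w) <= abs (z - u) + abs (u - w).
Proof. by apply: le_trans (absD _ _); rewrite addrA subrK. Qed.

Lemma abs_real (x : R) : abs x%:C = `|x|.
Proof. by rewrite /= expr0n addr0 sqrtr_sqr. Qed.

Lemma absX z n : abs (z ^+ n) = abs z ^+ n.
Proof. by elim: n => [|n IH]; rewrite ?normc1 // !exprS normcM IH. Qed.

Lemma abs_sum I (r : seq I) (P : pred I) (F : I -> C) :
  abs (\sum_(i <- r | P i) F i) <= \sum_(i <- r | P i) abs (F i).
Proof.
elim/big_ind2: _ => [|a b c d h h'|//]; first by rewrite normc0.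
exact: le_trans (absD _ _) (lerD h h').
Qed.

Lemma abs_prod I (r : seq I) (P : pred I) (F : I -> C) :
  abs (\prod_(i <- r | P i) F i) = \prod_(i <- r | P i) abs (F i).
Proof. by elim/big_ind2: _ => [|a b c d <- <-|//]; rewrite ?normc1 ?normcM. Qed.

Lemma abs_Re z : `|complex.Re z| <= abs z.
Proof.
case: z => a b /=; rewrite -sqrtr_sqr ler_wsqrtr // lerDl; exact: sqr_ge0.
Qed.

Lemma abs_Im z : `|complex.Im z| <= abs z.
Proof.
case: z => a b /=; rewrite -sqrtr_sqr ler_wsqrtr // lerDr; exact: sqr_ge0.
Qed.

Lemma abs_ReIm z : abs z <= `|complex.Re z| + `|complex.Im z|.
Proof.
rewrite {1}[z]complexE; apply: le_trans (absD _ _) _.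
rewrite normcM !abs_real /= expr0n expr1n add0r sqrtr1 mul1r //.
Qed.

Lemma abs_small z (H : forall e : R, 0 < e -> abs z <= e) : z = 0.
Proof.
apply/eqP/negPn/negP => /abs_gt0 z0; have := H (abs z / 2).
by rewrite divr_gt0 // => /(_ isT); lra.
Qed.

Definition seq_lim (u : nat -> C) (l : C) : Prop :=
  forall e : R, 0 < e -> exists N, forall n, (N <= n)%N -> abs (u n - l) <= e.

Lemma seq_lim_uniq u l l' : seq_lim u l -> seq_lim u l' -> l = l'.
Proof.
move=> ul ul'; apply/eqP; rewrite -subr_eq0; apply/eqP/abs_small => e e0.
have [N1 h1] := ul _ (divr_gt0 e0 (ltr0n _ 2)).
have [N2 h2] := ul' _ (divr_gt0 e0 (ltr0n _ 2)).
apply: le_trans (abs_split (u (maxn N1 N2)) _ _) _.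
have := h1 _ (leq_maxl N1 N2); have := h2 _ (leq_maxr N1 N2).
by rewrite (absB l); lra.
Qed.

Lemma real_cauchy (u : nat -> R) :
  (forall e : R, 0 < e ->
     exists N, forall m n, (N <= m)%N -> (N <= n)%N -> `|u m - u n| <= e) ->
  exists l, forall e : R, 0 < e -> exists N, forall n, (N <= n)%N -> `|u n - l| <= e.
Proof.
move=> uC; have uc : cvgn u.
  apply/cauchy_cvgP/cauchy_ballP => e e0; have [N hN] := uC _ (divr_gt0 e0 (ltr0n _ 2)).
  exists (u @` [set n | (N <= n)%N], u @` [set n | (N <= n)%N]).
    by split; exists N => // n hn; exists n.
  move=> [x y] [[m /= hm <-] [n /= hn <-]]; rewrite -ball_normE /=.
  by apply: le_lt_trans (hN m n hm hn) _; rewrite ltr_pdivrMr // ltr_pMr // ltr1n.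
exists (limn u) => e e0; have /cvgrPdist_le /(_ _ e0) [N _ hN] := uc.
by exists N => n hn; rewrite distrC; exact: hN.
Qed.

Lemma seq_cauchy (u : nat -> C) :
  (forall e : R, 0 < e ->
     exists N, forall m n, (N <= m)%N -> (N <= n)%N -> abs (u m - u n) <= e) ->
  exists l, seq_lim u l.
Proof.
move=> uC.
have [|a ha] := @real_cauchy (fun n => complex.Re (u n)).
  move=> e /uC[N hN]; exists N => m n hm hn; apply: le_trans (hN _ _ hm hn).
  by rewrite -raddfB; exact: abs_Re.
have [|b hb] := @real_cauchy (fun n => complex.Im (u n)).
  move=> e /uC[N hN]; exists N => m n hm hn; apply: le_trans (hN _ _ hm hn).
  by rewrite -raddfB; exact: abs_Im.
exists (Complex a b) => e e0.
have [N1 h1] := ha _ (divr_gt0 e0 (ltr0n _ 2)).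
have [N2 h2] := hb _ (divr_gt0 e0 (ltr0n _ 2)).
exists (maxn N1 N2) => n; rewrite geq_max => /andP[/h1 k1 /h2 k2].
apply: le_trans (abs_ReIm _) _; rewrite !raddfB /=. lra.
Qed.

End ComplexAbs.

(** * Polydiscs, polynomial functions and their uniform limits *)

Section Polydisc.
Variable R : realType.
Local Notation C := R[i].
Local Notation abs := (@normc R).

(** Closed, so that the torus of radius [r] is included and bounds pass to limits. *)
Definition pdisc n (a : 'rV[C]_n) (r : R) : set 'rV[C]_n :=
  [set z | forall i, abs (z 0 i - a 0 i) <= r].

Lemma pdisc_center n (a : 'rV[C]_n) r : 0 <= r -> pdisc a r a.
Proof. by move=> r0 i; rewrite subrr normc0. Qed.

Lemma pdisc_sub n (a : 'rV[C]_n) r s : s <= r -> pdisc a s `<=` pdisc a r.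
Proof. by move=> sr z h i; apply: le_trans sr; exact: h. Qed.

Lemma pdisc_minl n (a : 'rV[C]_n) r s : pdisc a (Num.min r s) `<=` pdisc a r.
Proof. by apply: pdisc_sub; rewrite ge_min lexx. Qed.

Lemma pdisc_minr n (a : 'rV[C]_n) r s : pdisc a (Num.min r s) `<=` pdisc a s.
Proof. by apply: pdisc_sub; rewrite ge_min lexx orbT. Qed.

Lemma pdisc_trans n (a b : 'rV[C]_n) r s z :
  pdisc a r b -> pdisc b s z -> pdisc a (r + s) z.
Proof.
move=> h k i; apply: le_trans (abs_split (b 0 i) _ _) _.
by rewrite addrC; exact: lerD (h i) (k i).
Qed.

Inductive polyf n : ('rV[C]_n -> C) -> Prop :=
| polyf_cst c : polyf (fun=> c)
| polyf_coord i : polyf (fun z => z 0 i)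
| polyfD f g : polyf f -> polyf g -> polyf (fun z => f z + g z)
| polyfM f g : polyf f -> polyf g -> polyf (fun z => f z * g z).

Lemma polyf_comp n m (f : 'rV[C]_m -> C) (h : 'rV[C]_n -> 'rV[C]_m) :
  polyf f -> (forall j, polyf (fun z => h z 0 j)) -> polyf (f \o h).
Proof.
move=> pf ph; elim: pf => [c|i|f1 f2 _ i1 _ i2|f1 f2 _ i1 _ i2].
- exact: polyf_cst.
- exact: ph.
- exact: polyfD.
- exact: polyfM.
Qed.

(* This class is visibly stable under composition and uniform limits, and does not
   depend on a choice of center for the polynomials; that it consists of convergent
   power series is polylim_series and series_polylim. *)
Definition polylim n (a : 'rV[C]_n) (r : R) (f : 'rV[C]_n -> C) : Prop :=
  forall e : R, 0 < e -> exists2 p, polyf p &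
    forall z, pdisc a r z -> abs (f z - p z) <= e.

Section Approx.
Variables (n : nat) (a : 'rV[C]_n) (r : R).
Local Notation polylim := (polylim a r).
Local Notation P := (pdisc a r).
Implicit Types f g : 'rV[C]_n -> C.

Lemma polylim_polyf f : polyf f -> polylim f.
Proof. by move=> pf e e0; exists f => // z _; rewrite subrr normc0 ltW. Qed.

Lemma polylim_cst c : polylim (fun=> c).
Proof. exact/polylim_polyf/polyf_cst. Qed.

Lemma polylim_coord i : polylim (fun z => z 0 i).
Proof. exact/polylim_polyf/polyf_coord. Qed.

Lemma polylim_ext f g : (forall z, P z -> f z = g z) -> polylim f -> polylim g.
Proof.
move=> fg af e /af[p pp hp]; exists p => // z Pz.
by rewrite -fg //; exact: hp.
Qed.

Lemma polylim_lim f :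
  (forall e : R, 0 < e -> exists2 g, polylim g &
     forall z, P z -> abs (f z - g z) <= e) -> polylim f.
Proof.
move=> H e e0; have e2 := divr_gt0 e0 (ltr0n R 2).
have [g ag fg] := H _ e2; have [p pp gp] := ag _ e2.
exists p => // z Pz; apply: le_trans (abs_split (g z) _ _) _.
by have := fg _ Pz; have := gp _ Pz; lra.
Qed.

Lemma polylimD f g : polylim f -> polylim g -> polylim (fun z => f z + g z).
Proof.
move=> af ag e e0; have e2 := divr_gt0 e0 (ltr0n R 2).
have [p pp hp] := af _ e2; have [q qq hq] := ag _ e2.
exists (fun z => p z + q z); first exact: polyfD.
move=> z Pz; rewrite opprD addrACA; apply: le_trans (absD _ _) _.
by have := hp _ Pz; have := hq _ Pz; lra.
Qed.

Lemma polyf_bounded p : polyf p ->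
  exists2 B : R, 0 < B & forall z, P z -> abs (p z) <= B.
Proof.
elim=> [c|i|f g _ [B B0 hB] _ [D D0 hD]|f g _ [B B0 hB] _ [D D0 hD]].
- by exists (abs c + 1) => [|z _]; have := abs_ge0 c; lra.
- exists (`|r| + abs (a 0 i) + 1) => [|z /(_ i) h].
    by have := normr_ge0 r; have := abs_ge0 (a 0 i); lra.
  have := absD (z 0 i - a 0 i) (a 0 i); rewrite subrK.
  have := ler_norm r; lra.
- exists (B + D) => [|z Pz]; first lra.
  by have := absD (f z) (g z); have := hB _ Pz; have := hD _ Pz; lra.
- exists (B * D) => [|z Pz]; first exact: mulr_gt0.
  by rewrite normcM ler_pM ?abs_ge0 ?hB ?hD.
Qed.

Lemma polylim_bounded f : polylim f ->
  exists2 B : R, 0 < B & forall z, P z -> abs (f z) <= B.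
Proof.
move=> /(_ 1 ltr01)[p /polyf_bounded[B B0 hB] hp].
exists (B + 1) => [|z Pz]; first lra.
have := absD (f z - p z) (p z); rewrite subrK.
by have := hB _ Pz; have := hp _ Pz; lra.
Qed.

(** Two successive approximations: [g] is replaced by a polynomial, against a bound on [f], and then
    [f], against a bound on that polynomial. *)
Lemma polylimM f g : polylim f -> polylim g -> polylim (fun z => f z * g z).
Proof.
move=> af ag; have [B B0 hB] := polylim_bounded af.
apply: polylim_lim => e e0.
have [q qq hq] := ag _ (divr_gt0 e0 B0).
exists (fun z => f z * q z); last first.
  move=> z Pz; rewrite -mulrBr normcM.
  have -> : e = B * (e / B) by rewrite mulrCA divff ?mulr1 ?gt_eqF.
  by rewrite ler_pM ?abs_ge0 ?hB ?hq.
have [D D0 hD] := polyf_bounded qq.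
apply: polylim_lim => d d0; have [p pp hp] := af _ (divr_gt0 d0 D0).
exists (fun z => p z * q z); first exact/polylim_polyf/polyfM.
move=> z Pz; rewrite -mulrBl normcM.
have -> : d = (d / D) * D by rewrite divfK ?gt_eqF.
by rewrite ler_pM ?abs_ge0 ?hD ?hp.
Qed.

Lemma polylimN f : polylim f -> polylim (fun z => - f z).
Proof.
move=> af; apply: (@polylim_ext (fun z => -1 * f z)) => [z _|].
  by rewrite mulN1r.
exact: polylimM (polylim_cst _) af.
Qed.

Lemma polylimB f g : polylim f -> polylim g -> polylim (fun z => f z - g z).
Proof. by move=> af ag; exact: polylimD af (polylimN ag). Qed.

Lemma polylim_sum I (s : seq I) (Q : pred I) (F : I -> 'rV[C]_n -> C) :
  (forall i, polylim (F i)) -> polylim (fun z => \sum_(i <- s | Q i) F i z).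
Proof.
move=> aF; elim: s => [|i s IH].
  by apply: polylim_ext (polylim_cst 0) => z _; rewrite big_nil.
have [Qi|Qi] := boolP (Q i); last first.
  by apply: polylim_ext IH => z _; rewrite big_cons (negbTE Qi).
by apply: polylim_ext (polylimD (aF i) IH) => z _; rewrite big_cons Qi.
Qed.

Lemma polylim_prod I (s : seq I) (Q : pred I) (F : I -> 'rV[C]_n -> C) :
  (forall i, polylim (F i)) -> polylim (fun z => \prod_(i <- s | Q i) F i z).
Proof.
move=> aF; elim: s => [|i s IH].
  by apply: polylim_ext (polylim_cst 1) => z _; rewrite big_nil.
have [Qi|Qi] := boolP (Q i); last first.
  by apply: polylim_ext IH => z _; rewrite big_cons (negbTE Qi).
by apply: polylim_ext (polylimM (aF i) IH) => z _; rewrite big_cons Qi.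
Qed.

Lemma polylim_limseq (g : nat -> 'rV[C]_n -> C) :
  (forall k, polylim (g k)) ->
  (forall e : R, 0 < e -> exists N, forall k l, (N <= k)%N -> (N <= l)%N ->
     forall z, P z -> abs (g k z - g l z) <= e) ->
  exists2 f, polylim f & forall e : R, 0 < e -> exists N, forall k, (N <= k)%N ->
     forall z, P z -> abs (g k z - f z) <= e.
Proof.
move=> ag gC.
have /choice[f hf] : forall z, exists l, P z -> seq_lim (g^~ z) l.
  (* The sequence may diverge outside of the polydisc; 0 is an arbitrary value there. *)
  move=> z; have [Pz|nPz] := pselect (P z); last by exists 0.
  have [l hl] : exists l, seq_lim (g^~ z) l; last by exists l.
  by apply: seq_cauchy => e /gC[N hN]; exists N => k l hk hl; exact: hN.
have key : forall e : R, 0 < e -> exists N, forall k, (N <= k)%N ->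
     forall z, P z -> abs (g k z - f z) <= e.
  move=> e e0; have e2 := divr_gt0 e0 (ltr0n R 2).
  have [N hN] := gC _ e2; exists N => k hk z Pz.
  have [N' hN'] := hf z Pz _ e2.
  apply: le_trans (abs_split (g (maxn N N') z) _ _) _.
  have := hN _ _ hk (leq_maxl N N') z Pz; have := hN' _ (leq_maxr N N'); lra.
exists f => //; apply: polylim_lim => e /key[N hN]; exists (g N) => // z Pz.
by rewrite absB; exact: hN.
Qed.

End Approx.

Lemma polylim_sub n (a b : 'rV[C]_n) r s f :
  pdisc b s `<=` pdisc a r -> polylim a r f -> polylim b s f.
Proof. by move=> ab af e /af[p pp hp]; exists p => // z /ab; exact: hp. Qed.

(** Replacing [f] by a polynomial makes a uniform error, as [h] maps one polydisc into the other; a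
    polynomial in the components of [h] is handled by induction on its construction. *)
Lemma polylim_comp n m (a : 'rV[C]_n) r (b : 'rV[C]_m) s f (h : 'rV[C]_n -> 'rV[C]_m) :
  polylim b s f -> (forall j, polylim a r (fun z => h z 0 j)) ->
  (forall z, pdisc a r z -> pdisc b s (h z)) -> polylim a r (f \o h).
Proof.
move=> af ah hab; apply: polylim_lim => e /af[p pp hp].
exists (p \o h); last by move=> z /hab; exact: hp.
elim: pp {hp} => [c|i|f1 f2 _ i1 _ i2|f1 f2 _ i1 _ i2].
- exact: polylim_cst.
- exact: ah.
- exact: polylimD.
- exact: polylimM.
Qed.

Lemma polyf_continuous n (p : 'rV[C]_n -> C) (a : 'rV[C]_n) e : polyf p -> 0 < e ->
  exists2 d : R, 0 < d & forall z, pdisc a d z -> abs (p z - p a) <= e.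
Proof.
move=> pp; elim: pp e => [c|i|f g pf i1 pg i2|f g pf i1 pg i2] e e0.
- by exists 1 => // z _; rewrite subrr normc0 ltW.
- by exists e.
- have e2 := divr_gt0 e0 (ltr0n R 2).
  have [d1 d10 h1] := i1 _ e2; have [d2 d20 h2] := i2 _ e2.
  exists (Num.min d1 d2) => [|z zd]; first by rewrite lt_min d10.
  have k1 := h1 z (pdisc_minl zd).
  have k2 := h2 z (pdisc_minr zd).
  rewrite opprD addrACA; apply: le_trans (absD _ _) _; lra.
have [B B0 hB] := @polyf_bounded _ a 1 _ pf.
have D0 : 0 < abs (g a) + 1 by have := abs_ge0 (g a); lra.
have [d1 d10 h1] := i1 _ (divr_gt0 (divr_gt0 e0 (ltr0n R 2)) D0).
have [d2 d20 h2] := i2 _ (divr_gt0 (divr_gt0 e0 (ltr0n R 2)) B0).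
exists (Num.min 1 (Num.min d1 d2)) => [|z zd]; first by rewrite !lt_min ltr01 d10.
have k1 : abs (f z) <= B by apply: hB; apply: pdisc_sub zd; rewrite ge_min lexx.
have k2 := h1 z (pdisc_sub _ zd).
have k3 := h2 z (pdisc_sub _ zd).
have -> : f z * g z - f a * g a = f z * (g z - g a) + (f z - f a) * g a by ring.
apply: le_trans (absD _ _) _; rewrite !normcM.
have : abs (f z) * abs (g z - g a) <= B * (e / 2 / B).
  by rewrite ler_pM ?abs_ge0 //; apply: k3; rewrite !ge_min lexx !orbT.
have : abs (f z - f a) * abs (g a) <= (e / 2 / (abs (g a) + 1)) * (abs (g a) + 1).
  rewrite ler_pM ?abs_ge0 //; last lra.
  by apply: k2; rewrite !ge_min lexx !orbT.
rewrite [B * _]mulrC !divfK ?gt_eqF //; lra.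
Qed.

Lemma polylim_continuous n (a b : 'rV[C]_n) r d f e : polylim a r f -> 0 < d ->
  pdisc b d `<=` pdisc a r -> 0 < e ->
  exists2 d : R, 0 < d & forall z, pdisc b d z -> abs (f z - f b) <= e.
Proof.
move=> af d0 ba e0; have e3 := divr_gt0 e0 (ltr0n R 3).
have [p pp hp] := af _ e3.
have [d' d'0 hd'] := polyf_continuous b pp e3.
exists (Num.min d d') => [|z zd]; first by rewrite lt_min d0.
have := hd' z (pdisc_minr zd).
have := hp z (ba _ (pdisc_minl zd)).
have := hp b (ba _ (pdisc_center _ (ltW d0))).
have := abs_split (p z) (f z) (f b); have := abs_split (p b) (p z) (f b).
rewrite (absB (p b)); lra.
Qed.

End Polydisc.

Section Box.
Variable n : nat.

Definition ffnat N (m : {ffun 'I_n -> 'I_N}) : {ffun 'I_n -> nat} :=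
  [ffun i => m i : nat].

(** Puts partial sums of different sizes over the same box, so that their difference becomes a sum
    over the complement of the smaller one. *)
Lemma box_sum (V : nmodType) (F : {ffun 'I_n -> nat} -> V) N N' : (N <= N')%N ->
  \sum_(m : {ffun 'I_n -> 'I_N}) F (ffnat m) =
  \sum_(m : {ffun 'I_n -> 'I_N'} | [forall i, (m i < N)%N]) F (ffnat m).
Proof.
move=> NN'; pose h (m : {ffun 'I_n -> 'I_N}) : {ffun 'I_n -> 'I_N'} :=
  [ffun i => widen_ord NN' (m i)].
have hE m : ffnat (h m) = ffnat m by apply/ffunP => i; rewrite !ffunE.
have h_inj : injective h.
  move=> x y /ffunP xy; apply/ffunP => i; apply: val_inj.
  by have := xy i; rewrite !ffunE => /(congr1 val).
transitivity (\sum_(m in h @: [set: {ffun 'I_n -> 'I_N}]%SET) F (ffnat m)).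
  rewrite big_imset /=; last by move=> x y _ _; exact: h_inj.
  by apply: eq_big => m; rewrite ?finset.inE // => _; rewrite hE.
apply: eq_bigl => m; apply/imsetP/forallP => [[x _ ->] i|H].
  by rewrite ffunE /=.
exists [ffun i => Ordinal (H i)] => //.
by apply/ffunP => i; apply: val_inj; rewrite !ffunE.
Qed.

End Box.

(** * Cauchy's estimates by averaging over roots of unity *)

Section Cauchy.
Variable R : realType.
Local Notation C := R[i].
Local Notation abs := (@normc R).
Implicit Types (r B : R).

(** The polynomial ['X^N - 1] splits over [C] and is separable in characteristic 0; a field with [N]
    distinct [N]-th roots of unity contains a primitive one. *)
Lemma prim_root_exists N : (0 < N)%N -> exists w : C, N.-primitive_root w.
Proof.
move=> N0; pose p : {poly C} := 'X^N - 1; have [r Dp] := closed_field_poly_normal p.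
move: Dp; rewrite (monicP _) ?monicXnsubC // scale1r => Dp.
have rn1 : all N.-unity_root r by apply/allP => z; rewrite -root_prod_XsubC -Dp.
have sz_r : (N < (size r).+1)%N by rewrite -(size_prod_XsubC r id) -Dp size_XnsubC.
have [|z] := hasP (has_prim_root N0 rn1 _ sz_r); last by exists z.
by rewrite -separable_prod_XsubC -Dp separable_Xn_sub_1 // pnatr_eq0 -lt0n.
Qed.

Lemma abs_prim_root N (w : C) : N.-primitive_root w -> abs w = 1.
Proof.
move=> w1; have N0 := prim_order_gt0 w1; apply/eqP.
rewrite -(@pexpr_eq1 R (abs w) N) ?abs_ge0 //.
by rewrite -absX (prim_expr_order w1) normc1.
Qed.

(** Discrete orthogonality of characters: for distinct [m] and [k] the sum is, up to a factor, a
    geometric sum whose ratio [y] is an [N]-th root of unity other than 1. *)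
Lemma root_average N (w x : C) m k : N.-primitive_root w -> x != 0 ->
  (m < N)%N -> (k < N)%N ->
  \sum_(l < N) (x * w ^+ l) ^+ m * (x * w ^+ l) ^- k = N%:R * (m == k)%:R.
Proof.
move=> w1 x0 mN kN; have w0 : w != 0.
  by apply: contraTneq isT => w0; have := abs_prim_root w1; rewrite w0 normc0 => /eqP;
     rewrite eq_sym oner_eq0.
have u l : x * w ^+ l != 0 by rewrite mulf_neq0 // expf_neq0.
have [->|mk] := eqVneq m k.
  rewrite (eq_bigr (fun=> 1)) => [|l _]; first by rewrite sumr_const card_ord mulr1.
  by rewrite divff // expf_neq0.
pose y := w ^+ m / w ^+ k.
rewrite (eq_bigr (fun l : 'I_N => x ^+ m / x ^+ k * y ^+ l)) => [|l _]; last first.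
  by rewrite /y !exprMn exprVn invfM -!exprM ![(l * _)%N]mulnC mulrACA.
rewrite -mulr_sumr mulr0.
have : (y - 1) * \sum_(l < N) y ^+ l = 0.
  rewrite -subrX1 /y expr_div_n -!exprM ![(_ * N)%N]mulnC !exprM (prim_expr_order w1).
  by rewrite !expr1n divr1 subrr.
move=> /eqP; rewrite mulf_eq0 => /orP[|/eqP ->]; last by rewrite mulr0.
rewrite subr_eq0 => /eqP y1.
have : w ^+ m == w ^+ k.
  by rewrite -(mulfVK (expf_neq0 k w0) (w ^+ m)) -/y y1 mul1r.
by rewrite (eq_prim_root_expr w1) !modn_small // (negbTE mk).
Qed.

Variable n : nat.
Implicit Types (a h z : 'rV[C]_n) (c : {ffun 'I_n -> nat} -> C).

Definition monom (m : {ffun 'I_n -> nat}) h : C := \prod_i h 0 i ^+ m i.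

Lemma psumE c h N : psum c h N = \sum_(m : {ffun 'I_n -> 'I_N})
  c (ffnat m) * monom (ffnat m) h.
Proof.
apply: eq_bigr => m _; congr (_ * _); apply: eq_bigr => i _.
by rewrite ffunE.
Qed.

(* Multiplying by T^-k and averaging over the grid T of points of the torus with coordinates
   r w^j, for w a primitive N-th root of unity, extracts the coefficient of index k. *)
Lemma coef_bound a r c N B : 0 < r ->
  (forall z, (forall i, abs (z 0 i - a 0 i) = r) -> abs (psum c (z - a) N) <= B) ->
  forall k : {ffun 'I_n -> 'I_N}, abs (c (ffnat k)) * \prod_i r ^+ k i <= B.
Proof.
move=> r0 HB k.
(* For [N = 0] the index [k] can exist only if there are no variables; the partial sum is then its
   single coefficient. *)
have [N0|N0] := posnP N.
  have n0 : n = 0%N.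
    by case: n k => // n' /(_ ord0); rewrite N0 => -[].
  have /(_ a) := HB; rewrite psumE.
  have kE (m : {ffun 'I_n -> 'I_N}) : m = k.
    by apply/ffunP => i; have := ltn_ord i; rewrite {2}n0.
  rewrite (eq_bigl (pred1 k)) => [|m]; last by rewrite /= (kE m) eqxx.
  rewrite big_pred1_eq /monom !big1 ?mulr1 => [|i _|i _].
  - by apply; move=> i; have := ltn_ord i; rewrite {2}n0.
  - by have := ltn_ord i; rewrite {2}n0.
  - by have := ltn_ord i; rewrite {2}n0.
have [w w1] := prim_root_exists N0.
have rC : r%:C != 0 by rewrite (inj_eq (@complexI _)) gt_eqF.
pose T (j : {ffun 'I_n -> 'I_N}) : 'rV[C]_n := \row_i (r%:C * w ^+ j i).
pose G (j : {ffun 'I_n -> 'I_N}) := (psum c (T j) N * \prod_i (T j 0 i) ^- k i).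
have absT j i : abs (T j 0 i) = r.
  by rewrite mxE normcM absX (abs_prim_root w1) expr1n mulr1 abs_real gtr0_norm.
have GE : \sum_j G j = (N%:R ^+ n) * c (ffnat k).
  rewrite /G; under eq_bigr do rewrite psumE mulr_suml.
  rewrite exchange_big /=.
  under eq_bigr => m _.
    under eq_bigr do rewrite -mulrA /monom -big_split /=.
    rewrite -mulr_sumr.
    over.
  (* By distributivity the sum over the grid is a product of one-variable averages. *)
  have inner (m : {ffun 'I_n -> 'I_N}) :
      \sum_(j : {ffun 'I_n -> 'I_N}) \prod_i (T j 0 i ^+ ffnat m i * T j 0 i ^- k i)
      = N%:R ^+ n * (m == k)%:R.
    transitivity (\prod_(i < n) \sum_(l < N)
        (r%:C * w ^+ l) ^+ m i * (r%:C * w ^+ l) ^- k i).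
      rewrite bigA_distr_bigA /=; apply: eq_bigr => j _; apply: eq_bigr => i _.
      by rewrite !mxE !ffunE.
    under eq_bigr do rewrite root_average //.
    rewrite big_split /= prodr_const card_ord; congr (_ * _).
    have [->|mk] := eqVneq m k; first by rewrite big1 // => i _; rewrite eqxx.
    have [i mki] : exists i, m i != k i.
      apply/existsP; rewrite -negb_forall; apply: contra mk => /forallP H.
      by apply/eqP/ffunP => i; apply/eqP.
    by rewrite (bigD1 i) //= (negbTE (mki : val (m i) != val (k i))) mul0r.
  under eq_bigr do rewrite inner.
  rewrite (bigD1 k) //= big1 => [|m /negbTE ->]; last by rewrite !mulr0.
  by rewrite eqxx mulr1 addr0 mulrC.
have P0 : 0 < \prod_i r ^+ k i by rewrite prodr_gt0 // => i _; rewrite exprn_gt0.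
have Gb j : abs (G j) <= B / \prod_i r ^+ k i.
  rewrite /G normcM; apply: ler_pM; rewrite ?abs_ge0 //.
    have := HB (a + T j); rewrite [a + T j]addrC addrK; apply => i.
    by rewrite mxE addrK.
  rewrite abs_prod -prodfV ler_prod // => i _; rewrite abs_ge0 /=.
  by rewrite normcV absX absT.
have N0R : 0 < N%:R ^+ n :> R by rewrite exprn_gt0 // ltr0n.
rewrite -ler_pdivlMr // -(ler_pM2l N0R).
have := abs_sum (index_enum _) xpredT G; rewrite GE normcM absX.
have -> : abs N%:R = N%:R by rewrite -(rmorph_nat (real_complex R)) abs_real normr_nat.
move=> h; apply: le_trans h _; apply: le_trans (ler_sum _ (fun j _ => Gb j)) _.
by rewrite sumr_const card_ffun !card_ord -[leLHS]mulr_natl natrX.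
Qed.

Lemma geom_half_le N : \sum_(l < N) (2^-1 : R) ^+ l <= 2.
Proof.
have := subrX1 (2^-1 : R) N; have : 0 <= (2^-1 : R) ^+ N by rewrite exprn_ge0.
lra.
Qed.

(** At half the radius, the term of index m is at most B 2^-|m|; the sum over a box is then B times
    a product of [n] geometric sums, each at most 2. *)
Lemma psum_bound a r c B z N : 0 < r -> 0 <= B ->
  (forall m : {ffun 'I_n -> 'I_N}, abs (c (ffnat m)) * \prod_i r ^+ m i <= B) ->
  pdisc a (r / 2) z ->
  \sum_(m : {ffun 'I_n -> 'I_N})
    abs (c (ffnat m)) * \prod_i abs ((z - a) 0 i) ^+ m i <= B * 2 ^+ n.
Proof.
move=> r0 B0 HB Pz.
apply: (@le_trans _ _ (\sum_(m : {ffun 'I_n -> 'I_N}) B * \prod_i 2^-1 ^+ m i)).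
  apply: ler_sum => m _; apply: le_trans (ler_wpM2r _ (HB m)); last first.
    by rewrite prodr_ge0 // => i _; rewrite exprn_ge0.
  rewrite -mulrA ler_wpM2l ?abs_ge0 // -big_split /= ler_prod // => i _.
  by rewrite exprn_ge0 ?abs_ge0 // -exprMn lerXn2r ?nnegrE ?abs_ge0 //
    ?divr_ge0 // ?(ltW r0) // 2!mxE; exact: Pz.
rewrite -mulr_sumr ler_wpM2l //.
rewrite -(bigA_distr_bigA (fun (i : 'I_n) (l : 'I_N) => (2^-1 : R) ^+ l)) /=.
rewrite -[n in leRHS]card_ord -prodr_const ler_prod // => i _.
rewrite geom_half_le andbT sumr_ge0 // => l _; exact: exprn_ge0.
Qed.

End Cauchy.

Lemma le_half2 (R : realFieldType) (x y e : R) : x <= e / 2 -> y <= e / 2 -> x + y <= e.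
Proof. lra. Qed.

(** * Uniform limits of polynomials are the convergent power series *)

Section Series.
Variables (R : realType) (n : nat).
Local Notation C := R[i].
Local Notation abs := (@normc R).
Implicit Types (r B : R) (a h z : 'rV[C]_n) (c : {ffun 'I_n -> nat} -> C).
Implicit Types (p f : 'rV[C]_n -> C).

Lemma monomD (m k : {ffun 'I_n -> nat}) h :
  monom [ffun i => (m i + k i)%N] h = monom m h * monom k h.
Proof.
by rewrite /monom -big_split /=; apply: eq_bigr => i _; rewrite ffunE exprD.
Qed.

Lemma polyf_monom p : polyf p -> exists s : seq (C * {ffun 'I_n -> nat}),
  forall h, p h = \sum_(t <- s) t.1 * monom t.2 h.
Proof.
elim=> [c|i|f g _ [s hs] _ [u hu]|f g _ [s hs] _ [u hu]].
- exists [:: (c, [ffun=> 0%N])] => h; rewrite big_seq1 /monom big1 ?mulr1 // => i _.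
  by rewrite ffunE.
- exists [:: (1, [ffun j => (j == i) : nat])] => h; rewrite big_seq1 /monom mul1r.
  rewrite (bigD1 i) //= big1 => [|j /negbTE ji]; rewrite ffunE ?eqxx ?mulr1 //.
  by rewrite ji.
- by exists (s ++ u) => h; rewrite big_cat /= hs hu.
- pose mul (t v : C * {ffun 'I_n -> nat}) : C * {ffun 'I_n -> nat} :=
    (t.1 * v.1, [ffun i => (t.2 i + v.2 i)%N]).
  exists [seq mul t v | t <- s, v <- u] => h.
  rewrite big_allpairs_dep /= hs hu mulr_suml; apply: eq_bigr => t _.
  by rewrite mulr_sumr; apply: eq_bigr => v _ /=; rewrite monomD mulrACA.
Qed.

(** The Taylor coefficients at [a]: the partial sums are stationary once the box contains the
    exponents of all monomials. *)
Lemma polyf_psum p a : polyf p -> exists c N0,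
  forall N z, (N0 <= N)%N -> p z = psum c (z - a) N.
Proof.
move=> pp; have : polyf (fun h => p (a + h)).
  apply: polyf_comp pp _ => j; pose f h : C := a 0 j + h 0 j.
  rewrite (_ : (fun h => (a + h) 0 j) = f); last by apply/funext => h; rewrite mxE.
  exact/polyfD/polyf_coord/polyf_cst.
move=> /polyf_monom[s hs].
suff [c [N0 hc]] : exists c N0, forall N h, (N0 <= N)%N ->
    \sum_(t <- s) t.1 * monom t.2 h = psum c h N.
  by exists c, N0 => N z N0N; rewrite -hc // -hs addrC subrK.
elim: s {hs} => [|[d m] s [c [N0 IH]]].
  exists (fun=> 0), 0%N => N h _; rewrite big_nil psumE big1 // => m _.
  by rewrite mul0r.
(* A box of size [N] contains the exponents below [N] only, hence the successor of each [m i]. *)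
exists (fun k => (k == m)%:R * d + c k), (maxn N0 (\max_i (m i).+1)).
move=> N h; rewrite geq_max => /andP[N0N /bigmax_leqP mN].
rewrite big_cons (IH N) // !psumE /=; under [RHS]eq_bigr do rewrite mulrDl.
rewrite big_split /=; congr (_ + _).
have mN' i : (m i < N)%N by exact: mN.
pose k : {ffun 'I_n -> 'I_N} := [ffun i => Ordinal (mN' i)].
have kE : ffnat k = m by apply/ffunP => i; rewrite !ffunE.
rewrite (bigD1 k) //= kE eqxx mul1r big1 ?addr0 // => l lk.
have [E|_] := eqVneq (ffnat l) m; last by rewrite !mul0r.
case/negP: lk; apply/eqP/ffunP => i; apply: val_inj.
by rewrite ffunE /= -E ffunE.
Qed.

Lemma psum_le_abs c z a N : abs (psum c (z - a) N) <=
  \sum_(m : {ffun 'I_n -> 'I_N})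
    abs (c (ffnat m)) * \prod_i abs ((z - a) 0 i) ^+ m i.
Proof.
rewrite psumE; apply: le_trans (abs_sum _ _ _) _; apply: ler_sum => m _.
rewrite normcM abs_prod ler_wpM2l ?abs_ge0 // le_eqVlt; apply/orP; left; apply/eqP.
by apply: eq_bigr => i _; rewrite absX ffunE.
Qed.

Lemma psumB c d h N : psum c h N - psum d h N = psum (fun m => c m - d m) h N.
Proof. by rewrite !psumE -sumrB; apply: eq_bigr => m _; rewrite mulrBl. Qed.

Lemma box_of (m : {ffun 'I_n -> nat}) : exists N0, forall N, (N0 <= N)%N ->
  exists k : {ffun 'I_n -> 'I_N}, ffnat k = m.
Proof.
exists (\max_i (m i).+1) => N /bigmax_leqP mN.
have mN' i : (m i < N)%N by exact: mN.
by exists [ffun i => Ordinal (mN' i)]; apply/ffunP => i; rewrite !ffunE.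
Qed.

(** Cauchy's estimates for the differences of the approximating polynomials make their coefficients
    of each index converge. The limits stay close to the coefficients of one polynomial, uniformly
    in the index after weighting by powers of [r], so on the half polydisc the partial sums stay
    close to that polynomial and hence to [f]. *)
Lemma polylim_series a r f : 0 < r -> polylim a r f -> exists c, exists2 B, 0 <= B &
  (forall m, abs (c m) * \prod_i r ^+ m i <= B) /\
  (forall z, pdisc a (r / 2) z -> seq_lim (psum c (z - a)) (f z)).
Proof.
move=> r0 af.
have [eps [eps0 inv_small]] : exists eps : nat -> R, (forall j, 0 < eps j) /\
    forall e, 0 < e -> exists N, forall k, (N <= k)%N -> eps k <= e.
  exists (fun j => j.+1%:R^-1); split=> [j|e e0]; first by rewrite invr_gt0.
  have [k] := near_infty_natSinv_lt (PosNum e0).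
  by move=> _ hk; exists k => l /hk /ltW.
have /choice[q hq] : forall j : nat, exists q : ({ffun 'I_n -> nat} -> C) * nat,
    forall N z, (q.2 <= N)%N -> pdisc a r z ->
      abs (f z - psum q.1 (z - a) N) <= eps j.
  move=> j; have [p /(polyf_psum a)[c [N0 hc]] hp] := af _ (eps0 j).
  by exists (c, N0) => N z /= h Pz; rewrite -hc //; exact: hp.
have P0 (m : {ffun 'I_n -> nat}) : 0 < \prod_i r ^+ m i.
  by rewrite prodr_gt0 // => i _; rewrite exprn_gt0.
have cb j l m : abs ((q j).1 m - (q l).1 m) * \prod_i r ^+ m i <=
    eps j + eps l.
  have [N0 hN0] := box_of m.
  pose N := maxn N0 (maxn (q j).2 (q l).2).
  have [k km] := hN0 N (leq_maxl _ _).
  have := @coef_bound R n a r (fun m => (q j).1 m - (q l).1 m) N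
    (eps j + eps l) r0 _ k; rewrite km.
  rewrite (eq_bigr (fun i => r ^+ m i)) => [|i _]; last by rewrite -km ffunE.
  apply=> z hz; rewrite -psumB; apply: le_trans (abs_split (f z) _ _) _.
  have Pz : pdisc a r z by move=> i; rewrite hz.
  apply: lerD; first by rewrite absB; apply: hq => //; rewrite !leq_max leqnn !orbT.
  by apply: hq => //; rewrite !leq_max leqnn !orbT.
have /choice[c hc] : forall m, exists l, seq_lim (fun j => (q j).1 m) l.
  move=> m; apply: seq_cauchy => e e0.
  have := inv_small (e * (\prod_i r ^+ m i) / 2).
  rewrite divr_gt0 ?mulr_gt0 // => /(_ isT)[N hN].
  exists N => j l /hN hj /hN hl; rewrite -(ler_pM2r (P0 m)).
  by apply: le_trans (cb _ _ _) _; exact: le_half2.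
(* The limit of [cb] in its other index; the factor 2 comes from taking that index so large that its
   error is at most [eps j]. *)
have cb' j m : abs (c m - (q j).1 m) * \prod_i r ^+ m i <= 2 * eps j.
  apply/ler_addgt0Pr => e e0.
  have e1 : 0 < e / (\prod_i r ^+ m i) by rewrite divr_gt0.
  have [N hN] := hc m _ e1; have j0 := eps0 j.
  have [N' hN'] := inv_small _ j0; pose l := maxn N N'.
  have := hN l (leq_maxl _ _); rewrite -(ler_pM2r (P0 m)) divfK ?gt_eqF // => h1.
  have := cb l j m; have := hN' l (leq_maxr _ _).
  have := abs_split ((q l).1 m) (c m) ((q j).1 m).
  rewrite -(ler_pM2r (P0 m)) mulrDl (absB (c m) ((q l).1 m)); lra.
have [B0 B00 hB0] := polylim_bounded af.
have q0b m : abs ((q 0%N).1 m) * \prod_i r ^+ m i <= B0 + eps 0%N.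
  have [N0 hN0] := box_of m.
  pose N := maxn N0 (q 0%N).2.
  have [k km] := hN0 N (leq_maxl _ _).
  have := @coef_bound R n a r (q 0%N).1 N (B0 + eps 0%N) r0 _ k; rewrite km.
  rewrite (eq_bigr (fun i => r ^+ m i)) => [|i _]; last by rewrite -km ffunE.
  apply=> z hz; have Pz : pdisc a r z by move=> i; rewrite hz.
  have := hq 0%N N z (leq_maxr _ _) Pz; have := hB0 _ Pz.
  have := abs_split (f z) (psum (q 0%N).1 (z - a) N) 0.
  by rewrite !subr0 absB; lra.
have e0 := eps0 0%N.
(* [B0 + eps 0] bounds the coefficients of the polynomial of index 0, and [2 * eps 0] their distance
   to the limits. *)
exists c, (B0 + 3 * eps 0%N); first lra; split=> [m|z Pz e {}e0].
  have := cb' 0%N m; have := q0b m; have := abs_split ((q 0%N).1 m) (c m) 0.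
  by rewrite !subr0 -(ler_pM2r (P0 m)) mulrDl; lra.
(* The error is [eps j] between [f] and the polynomial, plus [2 * eps j * 2 ^+ n] between the
   polynomial and the partial sum of the limit series. *)
have D0 : 0 < 2 * 2 ^+ n + 1 :> R.
  by have : 0 < 2 ^+ n :> R by rewrite exprn_gt0; lra.
have [j hj] := inv_small (e / (2 * 2 ^+ n + 1)) (divr_gt0 e0 D0).
have {}hj := hj j (leqnn j); exists (q j).2 => N hN.
have Pz' : pdisc a r z by apply: pdisc_sub Pz; lra.
apply: le_trans (abs_split (psum (q j).1 (z - a) N) _ _) _.
rewrite psumB; have := hq j N z hN Pz'; rewrite absB => h1.
have j0 : 0 <= 2 * eps j by rewrite mulr_ge0 // ltW.
have h2 := @psum_bound R n a r (fun m => c m - (q j).1 m) (2 * eps j) z N r0 j0 _ Pz.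
have {}h2 : abs (psum (fun m => c m - (q j).1 m) (z - a) N) <= 2 * eps j * 2 ^+ n.
  apply: le_trans (psum_le_abs _ _ _ _) (h2 _) => m.
  by have := cb' j (ffnat m); under eq_bigr do rewrite ffunE.
have : eps j * (2 * 2 ^+ n + 1) <= e by rewrite -ler_pdivlMr.
lra.
Qed.

(** Weierstrass's test: the majorant sums [S] increase and are bounded, hence Cauchy, and their
    differences dominate those of the partial sums on the whole polydisc. *)
Lemma series_polylim a r c B : 0 <= r ->
  (forall N, \sum_(m : {ffun 'I_n -> 'I_N})
    abs (c (ffnat m)) * \prod_i r ^+ m i <= B) ->
  exists2 f, polylim a r f & forall z, pdisc a r z -> seq_lim (psum c (z - a)) (f z).
Proof.
move=> r0 HB; pose S N := \sum_(m : {ffun 'I_n -> 'I_N})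
  abs (c (ffnat m)) * \prod_i r ^+ m i.
pose Fr m := abs (c m) * \prod_(i < n) r ^+ m i.
have SE N : S N = \sum_(m : {ffun 'I_n -> 'I_N}) Fr (ffnat m).
  by apply: eq_bigr => m _; rewrite /Fr; under [in RHS]eq_bigr do rewrite ffunE.
have Fr0 m : 0 <= Fr m.
  by rewrite mulr_ge0 ?abs_ge0 ?prodr_ge0 // => i _; rewrite exprn_ge0.
have SNN' N N' z : (N <= N')%N -> pdisc a r z ->
    abs (psum c (z - a) N' - psum c (z - a) N) <= S N' - S N.
  move=> NN' Pz; rewrite !SE !psumE (box_sum Fr NN').
  rewrite (box_sum (fun m => c m * monom m (z - a)) NN').
  pose Q := (fun m : {ffun 'I_n -> 'I_N'} => [forall i, (m i < N)%N]).
  rewrite (bigID Q) /= addrAC subrr add0r.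
  rewrite [X in _ <= X - _](bigID Q) /= addrAC subrr add0r.
  apply: le_trans (abs_sum _ _ _) _; apply: ler_sum => m _.
  rewrite normcM ler_wpM2l ?abs_ge0 // abs_prod ler_prod // => i _.
  by rewrite absX exprn_ge0 ?abs_ge0 //= lerXn2r ?nnegrE ?abs_ge0 // 2!mxE; exact: Pz.
have S_nd : nondecreasing_seq S.
  move=> N N' NN'; rewrite -subr_ge0.
  apply: le_trans (abs_ge0 _) (SNN' _ _ a NN' (pdisc_center _ r0)).
have S_cvg : cvgn S by apply: nondecreasing_is_cvgn => //; exists B => _ [N _ <-]; exact: HB.
have key : forall e : R, 0 < e -> exists N, forall k l, (N <= k)%N -> (N <= l)%N ->
     forall z, pdisc a r z -> abs (psum c (z - a) k - psum c (z - a) l) <= e.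
  move=> e e0; have /cvgrPdist_le /(_ _ (divr_gt0 e0 (ltr0n _ 2)))[N _ hN] := S_cvg.
  exists N => k l hk hl z Pz; wlog kl : k l hk hl / (k <= l)%N => [W|].
    by have [/W|/ltnW /W] := leqP k l; [apply | rewrite absB; apply].
  rewrite absB; apply: le_trans (SNN' _ _ z kl Pz) _.
  have := hN k hk; have := hN l hl; rewrite /= !ler_distlC => /andP[h1 h2] /andP[h3 h4].
  rewrite [e]splitr; lra.
have [|f af hf] := @polylim_limseq R n a r (fun N z => psum c (z - a) N) _ key.
  move=> N; rewrite (_ : (fun z => _) = (fun z => \sum_(m : {ffun 'I_n -> 'I_N})
    c (ffnat m) * \prod_i ((z 0 i - a 0 i) ^+ m i))); last first.
    by apply/funext => z; rewrite psumE; apply: eq_bigr => m _; congr (_ * _);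
       apply: eq_bigr => i _; rewrite !mxE ffunE.
  apply: polylim_sum => m; apply: polylimM; first exact: polylim_cst.
  apply: polylim_prod => i; elim: (nat_of_ord (m i)) => [|k IH].
    by rewrite (_ : (fun z => _) = (fun=> 1)) ?expr0 //; exact: polylim_cst.
  rewrite (_ : (fun z => _) = (fun z => (z 0 i - a 0 i) * (z 0 i - a 0 i) ^+ k)).
    by apply: polylimM => //; apply: polylimB (polylim_coord _ _ _) (polylim_cst _ _ _).
  by apply/funext => z; rewrite exprS.
by exists f => // z Pz e /hf[N hN]; exists N => k /hN; apply.
Qed.

End Series.

(** * Neighbourhoods and limits in terms of polydiscs and real radii *)

Section Near.
Variable R : realType.
Local Notation C := (Num.NumField.sort (R[i] : numFieldType)).
Local Notation abs := (@normc R).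

Lemma abs_lt (z : C) (e : R) : (`|z| < e%:C) = (abs z < e).
Proof. by rewrite normCE ltcR. Qed.

Lemma abs_le (z : C) (e : R) : (`|z| <= e%:C) = (abs z <= e).
Proof. by rewrite normCE lecR. Qed.

Lemma posC (e : C) : 0 < e -> exists2 r : R, 0 < r & e = r%:C.
Proof.
move=> e0; have /complex_realP[r E] : e \is Num.real by rewrite gtr0_real.
by exists r => //; rewrite -ltcR -E.
Qed.

Lemma near_pdisc n (a : 'rV[C]_n) (P : 'rV[C]_n -> Prop) :
  (\forall z \near a, P z) <-> exists2 r : R, 0 < r & forall z, pdisc a r z -> P z.
Proof.
split=> [/nbhs_ballP[e /posC[r r0 ->] H]|[r r0 H]].
  exists (r / 2) => [|z Pz]; first exact: divr_gt0.
  apply: H; split=> [|i j]; first by rewrite ltcR.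
  rewrite -ball_normE /= abs_lt (ord1 i) absB.
  by apply: le_lt_trans (Pz j) _; rewrite ltr_pdivrMr // ltr_pMr // ltr1n.
apply/nbhs_ballP; exists r%:C; first by rewrite /= ltcR.
move=> z [_ Pz]; apply: H => i; have := Pz 0 i.
by rewrite -ball_normE /= abs_lt absB => /ltW.
Qed.

Lemma near_real n (a : 'rV[R]_n) (P : 'rV[R]_n -> Prop) :
  (\forall z \near a, P z) <->
  exists2 r : R, 0 < r & forall z : 'rV[R]_n, (forall i, `|z 0 i - a 0 i| <= r) -> P z.
Proof.
split=> [/nbhs_ballP[e /= e0 H]|[r r0 H]].
  exists (e / 2) => [|z Pz]; first exact: divr_gt0.
  apply: H; split=> // i j; rewrite -ball_normE /= (ord1 i) distrC.
  by apply: le_lt_trans (Pz j) _; rewrite ltr_pdivrMr // ltr_pMr // ltr1n.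
apply/nbhs_ballP; exists r => // z [_ Pz]; apply: H => i; have := Pz 0 i.
by rewrite -ball_normE /= distrC => /ltW.
Qed.

Lemma cvg_seq_lim (u : nat -> C) (l : C) : u @ \oo --> l <-> seq_lim u l.
Proof.
split=> [/cvgrPdist_le H e e0|H].
  have [|N _ hN] := H e%:C; first by rewrite ltcR.
  by exists N => n /hN; rewrite /= abs_le absB.
apply/cvgrPdist_le => _ /posC[e e0 ->]; have [N hN] := H e e0.
by exists N => // n /hN; rewrite /= abs_le absB.
Qed.

End Near.

(** * Germs of holomorphic functions and maps *)

Section Holo.
Variable R : realType.
Local Notation C := (Num.NumField.sort (R[i] : numFieldType)).
Local Notation abs := (@normc R).

Definition holo n (f : 'rV[C]_n -> C) (a : 'rV[C]_n) : Prop :=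
  exists2 r : R, 0 < r & polylim a r f.

Lemma psum_bounded_abs n (c : {ffun 'I_n -> nat} -> C) (h : 'rV[C]_n) (B : C) N :
  psum (fun m => `|c m|) (map_mx Num.norm h) N <= B ->
  \sum_(m : {ffun 'I_n -> 'I_N})
    abs (c (ffnat m)) * \prod_i abs (h 0 i) ^+ m i <= complex.Re B.
Proof.
set S := \sum_(_ | _) _; suff -> : psum (fun m => `|c m|) (map_mx Num.norm h) N = S%:C.
  by rewrite lecE => /andP[_].
rewrite /S rmorph_sum; apply: eq_bigr => m _.
rewrite rmorphM rmorph_prod normCE; congr (_ * _); apply: eq_bigr => i _.
by rewrite rmorphXn mxE normCE.
Qed.

Lemma analytic_holo n (f : 'rV[C]_n -> C) (a : 'rV[C]_n) :
  analytic_at f a <-> holo f a.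
Proof.
split=> [[c /near_pdisc[r r0 H]]|[r r0 af]].
  (* At this corner all coordinates of the increment have modulus [r], so absolute convergence there
     controls the series on the whole polydisc. *)
  have [|[B HB] _] := H (a + const_mx r%:C).
    by move=> i; rewrite !mxE addrAC subrr add0r abs_real gtr0_norm.
  have [N|F aF hF] := @series_polylim R n a r c (complex.Re B) (ltW r0).
    have := psum_bounded_abs (HB N); rewrite addrAC subrr add0r.
    apply: le_trans; apply: ler_sum => m _; rewrite ler_wpM2l ?abs_ge0 //.
    rewrite le_eqVlt; apply/orP; left; apply/eqP; apply: eq_bigr => i _.
    by rewrite mxE abs_real gtr0_norm.
  exists r => //; apply: polylim_ext aF => z Pz.
  apply: seq_lim_uniq (hF _ Pz) _; have [_] := H z Pz.
  by move=> /cvg_seq_lim.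
have [c [B B0 [hB hc]]] := polylim_series r0 af; exists c; apply/near_pdisc.
exists (r / 2) => [|z Pz]; first exact: divr_gt0.
split; last exact/cvg_seq_lim/hc.
exists ((B * 2 ^+ n)%:C) => N.
have := @psum_bound R n a r c B z N r0 B0 _ Pz.
rewrite -lecR => H; apply: le_trans (H _) => [|m]; last first.
  by have := hB (ffnat m); under eq_bigr do rewrite ffunE.
rewrite rmorph_sum ler_sum // => m _; rewrite normCE rmorphM rmorph_prod.
rewrite le_eqVlt; apply/orP; left; apply/eqP; congr (_ * _).
by apply: eq_bigr => i _; rewrite rmorphXn mxE normCE.

Qed.

Lemma holo_ext n (f g : 'rV[C]_n -> C) a :
  (\forall z \near a, f z = g z) -> holo f a -> holo g a.
Proof.
move=> /near_pdisc[r r0 fg] [s s0 af]; exists (Num.min r s); first by rewrite lt_min r0.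
apply: (@polylim_ext _ _ _ _ f) => [z /pdisc_minl|]; first exact: fg.
by apply: polylim_sub af => z /pdisc_minr.
Qed.

Lemma holo_near n (f : 'rV[C]_n -> C) a : holo f a -> \forall z \near a, holo f z.
Proof.
move=> [r r0 af]; apply/near_pdisc; exists (r / 2) => [|z Pz]; first exact: divr_gt0.
exists (r / 2); first exact: divr_gt0.
by apply: polylim_sub af => w; rewrite [r in pdisc a r]splitr; exact: pdisc_trans Pz.
Qed.

Lemma holo_polylim n (I : finType) (f : I -> 'rV[C]_n -> C) a :
  (forall i, holo (f i) a) -> exists2 r : R, 0 < r & forall i, polylim a r (f i).
Proof.
move=> hf; have /choice[r hr] : forall i, exists r : R, 0 < r /\ polylim a r (f i).
  by move=> i; have [r] := hf i; exists r.
exists (\big[Num.min/1]_i r i) => [|i].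
  by apply/bigmin_gtP; split => // i _; have [] := hr i.
have [_] := hr i; apply: polylim_sub; apply: pdisc_sub; exact: bigmin_le.
Qed.

Lemma holo_eps n (f : 'rV[C]_n -> C) a (e : R) : holo f a -> 0 < e ->
  exists2 d : R, 0 < d & forall z, pdisc a d z -> abs (f z - f a) <= e.
Proof. by move=> [r r0 af] e0; exact: (polylim_continuous af r0). Qed.

Section Algebra.
Variables (n : nat) (a : 'rV[C]_n).
Implicit Types f g : 'rV[C]_n -> C.

Lemma holo_cst c : holo (fun=> c) a.
Proof. by exists 1 => //; exact: polylim_cst. Qed.

Lemma holo_coord i : holo (fun z => z 0 i) a.
Proof. by exists 1 => //; exact: polylim_coord. Qed.

Let lift2 (op : C -> C -> C) :
  (forall r f g, polylim a r f -> polylim a r g -> polylim a r (fun z => op (f z) (g z))) ->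
  forall f g, holo f a -> holo g a -> holo (fun z => op (f z) (g z)) a.
Proof.
move=> H f g [r r0 af] [s s0 ag]; exists (Num.min r s); first by rewrite lt_min r0.
by apply: H; [apply: polylim_sub af => z /pdisc_minl | apply: polylim_sub ag => z /pdisc_minr].
Qed.

Lemma holoD f g : holo f a -> holo g a -> holo (fun z => f z + g z) a.
Proof. by apply: lift2 => r; exact: polylimD. Qed.

Lemma holoB f g : holo f a -> holo g a -> holo (fun z => f z - g z) a.
Proof. by apply: (lift2 (op := fun x y => x - y)) => r; exact: polylimB. Qed.

Lemma holoM f g : holo f a -> holo g a -> holo (fun z => f z * g z) a.
Proof. by apply: lift2 => r; exact: polylimM. Qed.

Lemma holo_sum (I : finType) (Q : pred I) (F : I -> 'rV[C]_n -> C) :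
  (forall i, holo (F i) a) -> holo (fun z => \sum_(i | Q i) F i z) a.
Proof. by move=> /holo_polylim[r r0 H]; exists r => //; exact: polylim_sum. Qed.

Lemma holo_prod (I : finType) (Q : pred I) (F : I -> 'rV[C]_n -> C) :
  (forall i, holo (F i) a) -> holo (fun z => \prod_(i | Q i) F i z) a.
Proof. by move=> /holo_polylim[r r0 H]; exists r => //; exact: polylim_prod. Qed.

End Algebra.

Definition holo_map n m (h : 'rV[C]_n -> 'rV[C]_m) (a : 'rV[C]_n) : Prop :=
  forall j, holo (fun z => h z 0 j) a.

Lemma holo_map_eps n m (h : 'rV[C]_n -> 'rV[C]_m) a (e : R) : holo_map h a -> 0 < e ->
  exists2 d : R, 0 < d & forall z, pdisc a d z -> pdisc (h a) e (h z).
Proof.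
move=> hh e0; have /choice[d hd] : forall j, exists d : R, 0 < d /\
    forall z, pdisc a d z -> abs (h z 0 j - h a 0 j) <= e.
  by move=> j; have [d d0 H] := holo_eps (hh j) e0; exists d.
exists (\big[Num.min/1]_j d j) => [|z Pz j].
  by apply/bigmin_gtP; split => // j _; have [] := hd j.
have [_] := hd j; apply; apply: pdisc_sub Pz; exact: bigmin_le.
Qed.

Lemma holo_comp n m (f : 'rV[C]_m -> C) (h : 'rV[C]_n -> 'rV[C]_m) a :
  holo_map h a -> holo f (h a) -> holo (f \o h) a.
Proof.
move=> hh [s s0 af]; have [r r0 ah] := holo_polylim hh.
have [d d0 hd] := holo_map_eps hh s0.
exists (Num.min r d); first by rewrite lt_min r0.
apply: (polylim_comp af) => [j|z /pdisc_minr]; last exact: hd.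
by apply: polylim_sub (ah j) => z /pdisc_minl.
Qed.

Lemma holo_map_comp n m k (f : 'rV[C]_m -> 'rV[C]_k) (h : 'rV[C]_n -> 'rV[C]_m) a :
  holo_map h a -> holo_map f (h a) -> holo_map (f \o h) a.
Proof. by move=> hh hf j; exact: holo_comp hh (hf j). Qed.

Lemma near_map n m (h : 'rV[C]_n -> 'rV[C]_m) a (P : 'rV[C]_m -> Prop) :
  holo_map h a -> (\forall w \near h a, P w) -> \forall z \near a, P (h z).
Proof.
move=> hh /near_pdisc[r r0 hP]; have [d d0 hd] := holo_map_eps hh r0.
by apply/near_pdisc; exists d => // z /hd; exact: hP.
Qed.

End Holo.

(** * Division by a coordinate and Hadamard's lemma *)

Section Division.
Variable R : realType.
Local Notation C := (Num.NumField.sort (R[i] : numFieldType)).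
Local Notation abs := (@normc R).

Definition set_coord n (i : 'I_n) (c : C) (z : 'rV[C]_n) : 'rV[C]_n :=
  \row_j (if j == i then c else z 0 j).

Lemma polyf_set_coord n (i : 'I_n) (p : 'rV[C]_n -> C) (c : 'rV[C]_n -> C) :
  polyf p -> polyf c -> polyf (fun z => p (set_coord i (c z) z)).
Proof.
move=> pp pc; apply: (polyf_comp (f := p) (h := fun z => set_coord i (c z) z)) => // j.
rewrite (_ : (fun z => _) = (fun z => if j == i then c z else z 0 j)).
  by have [_|_] := eqVneq j i => //; exact: polyf_coord.
by apply/funext => z; rewrite mxE.
Qed.

(** The quotient is the divided difference in one coordinate; products follow the discrete Leibniz
    rule. *)
Lemma polyf_div n (i : 'I_n) (p : 'rV[C]_n -> C) (c : C) : polyf p ->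
  exists2 q, polyf q & forall z, p z - p (set_coord i c z) = (z 0 i - c) * q z.
Proof.
elim=> [d|j|f g pf [p1 pp1 h1] _ [p2 pp2 h2]|f g pf [p1 pp1 h1] pg [p2 pp2 h2]].
- by exists (fun=> 0) => [|z]; [exact: polyf_cst|rewrite subrr mulr0].
- exists (fun=> (j == i)%:R) => [|z]; first exact: polyf_cst.
  by rewrite mxE; case: eqP => [->|_]; rewrite ?mulr1 // subrr mulr0.
- exists (fun z => p1 z + p2 z) => [|z]; first exact: polyfD.
  by rewrite opprD addrACA h1 h2 mulrDr.
- exists (fun z => p1 z * g z + f (set_coord i c z) * p2 z) => [|z].
    by apply: polyfD; apply: polyfM => //; apply: polyf_set_coord => //; exact: polyf_cst.
  have := h1 z; have := h2 z.
  move: (f z) (f (set_coord i c z)) (g z) (g (set_coord i c z)) (p1 z) (p2 z) (z 0 i - c).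
  move=> f1 f0 g1 g0 q1 q2 d e2 e1.
  have -> : f1 = f0 + d * q1 by rewrite -e1 addrC subrK.
  have -> : g1 = g0 + d * q2 by rewrite -e2 addrC subrK.
  by ring.
Qed.

(** Stands in for the maximum principle: Cauchy's estimates on the torus, then the geometric bound
    on the half polydisc, at the cost of a factor [2 ^+ n]. *)
Lemma torus_bound n (p : 'rV[C]_n -> C) (a z : 'rV[C]_n) (r B : R) : polyf p -> 0 < r -> 0 <= B ->
  (forall z : 'rV[C]_n, (forall i, abs (z 0 i - a 0 i) = r) -> abs (p z) <= B) ->
  pdisc a (r / 2) z -> abs (p z) <= B * 2 ^+ n.
Proof.
move=> pp r0 B0 HB Pz; have [c [N hc]] := polyf_psum a pp.
rewrite (hc N) //; apply: le_trans (psum_le_abs _ _ _ _) _.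
apply: (psum_bound r0 B0 _ Pz) => m.
apply: (coef_bound (a := a) r0) => w hw.
by rewrite -hc //; exact: HB.
Qed.

Lemma invS_small (e : R) : 0 < e -> exists N, forall k, (N <= k)%N -> k.+1%:R^-1 <= e.
Proof.
move=> e0; have [k] := near_infty_natSinv_lt (PosNum e0).
by move=> _ hk; exists k => l /hk /ltW.
Qed.

(* The polynomial quotients are compared on the torus, where the denominator has constant
   modulus, and the torus bound makes them converge inside. *)
Lemma holo_div n (f : 'rV[C]_n -> C) a i : holo f a ->
  (\forall z \near a, (z : 'rV[C]_n) 0 i = a 0 i -> f z = 0) ->
  exists2 q, holo q a & \forall z \near a, f z = ((z : 'rV[C]_n) 0 i - a 0 i) * q z.
Proof.
move=> [r0 r00 af0] /near_pdisc[s s0 f0].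
pose r := Num.min r0 s; have rp : 0 < r by rewrite lt_min r00.
have af : polylim a r f by apply: polylim_sub af0 => z /pdisc_minl.
have {}f0 z : pdisc a r z -> z 0 i = a 0 i -> f z = 0 by move=> /pdisc_minr; exact: f0.
have [eps [eps0 epsS]] : exists eps : nat -> R, (forall j, 0 < eps j) /\
    forall e, 0 < e -> exists N, forall k, (N <= k)%N -> eps k <= e.
  exists (fun j => j.+1%:R^-1); split=> [j|e e0]; first by rewrite invr_gt0.
  exact: invS_small.
have /choice[p hp] : forall k, exists p, polyf p /\
    forall z, pdisc a r z -> abs (f z - p z) <= eps k.
  by move=> k; have [p] := af _ (eps0 k); exists p.
have /choice[q hq] : forall k, exists q, polyf q /\
    forall z, p k z - p k (set_coord i (a 0 i) z) = (z 0 i - a 0 i) * q z.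
  by move=> k; have [q] := polyf_div i (a 0 i) (hp k).1; exists q.
have pd_set_coord z : pdisc a r z -> pdisc a r (set_coord i (a 0 i) z).
  move=> Pz j; rewrite mxE; case: eqP => [->|_]; last exact: Pz.
  by rewrite subrr normc0 ltW.
(* As [f] vanishes on the hyperplane, [p k] has modulus at most [eps k] there; the second [eps k] is
   the distance of [f] to [p k] at [z]. *)
have q_err k z : pdisc a r z -> abs (f z - (z 0 i - a 0 i) * q k z) <= 2 * eps k.
  move=> Pz; rewrite -(hq k).2; have h1 := (hp k).2 z Pz.
  have h2 := (hp k).2 _ (pd_set_coord z Pz).
  rewrite (f0 (set_coord i (a 0 i) z)) ?mxE ?eqxx // in h2; last exact: pd_set_coord.
  rewrite opprB addrCA addrC; apply: le_trans (absD _ _) _.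
  by rewrite sub0r absN in h2; lra.
have q_cauchy k l z : pdisc a (r / 2) z ->
    abs (q k z - q l z) <= (2 * eps k + 2 * eps l) / r * 2 ^+ n.
  have pkl : polyf (fun z => q k z - q l z).
    rewrite (_ : (fun z => _) = (fun z => q k z + -1 * q l z)).
      by apply: polyfD (hq k).1 _; apply: polyfM (hq l).1; exact: polyf_cst.
    by apply/funext => w; rewrite mulN1r.
  apply: (torus_bound (p := fun z => q k z - q l z)) => //.
    by rewrite divr_ge0 ?addr_ge0 ?mulr_ge0 // ltW.
  move=> w hw; have Pw : pdisc a r w by move=> j; rewrite hw.
  rewrite ler_pdivlMr // mulrC -{1}(hw i) -normcM mulrBr.
  apply: le_trans (abs_split (f w) _ _) _; rewrite absB; apply: lerD; exact: q_err.
have D0 : 0 < 4 / r * 2 ^+ n :> R by rewrite mulr_gt0 ?divr_gt0 ?exprn_gt0.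
have [k|e e0|g ag hg] := @polylim_limseq R n a (r / 2) q.
- exact/polylim_polyf/(hq k).1.
- have [N hN] := epsS _ (divr_gt0 e0 D0); exists N => k l hk hl z Pz.
  apply: le_trans (q_cauchy k l z Pz) _.
  have -> : (2 * eps k + 2 * eps l) / r * 2 ^+ n = (eps k + eps l) / 2 * (4 / r * 2 ^+ n).
    by field; rewrite gt_eqF.
  rewrite -ler_pdivlMr //; have := hN k hk; have := hN l hl; lra.
exists g; first by exists (r / 2) => //; exact: divr_gt0.
apply/near_pdisc; exists (r / 2) => [|z Pz]; first exact: divr_gt0.
apply/eqP; rewrite -subr_eq0; apply/eqP/abs_small => e e0.
have e4 := divr_gt0 e0 (ltr0n R 4).
have [N hN] := epsS _ e4; have [N' hN'] := hg _ (divr_gt0 e4 rp).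
pose k := maxn N N'; have h1 := hN k (leq_maxl _ _).
have h2 := hN' k (leq_maxr _ _) z Pz.
have Pz' : pdisc a r z by apply: pdisc_sub Pz; lra.
have h3 := q_err k z Pz'.
apply: le_trans (abs_split ((z 0 i - a 0 i) * q k z) _ _) _.
rewrite -mulrBr normcM.
have : abs (z 0 i - a 0 i) * abs (q k z - g z) <= r * (e / 4 / r).
  by rewrite ler_pM ?abs_ge0.
rewrite [r * _]mulrC divfK ?gt_eqF //; lra.
Qed.

Lemma near_forall n (I : finType) (a : 'rV[C]_n) (P : I -> 'rV[C]_n -> Prop) :
  (forall i, \forall z \near a, P i z) -> \forall z \near a, forall i, P i z.
Proof.
move=> H; have /choice[r hr] : forall i, exists r : R, 0 < r /\
    forall z, pdisc a r z -> P i z.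
  by move=> i; have /near_pdisc[r] := H i; exists r.
apply/near_pdisc; exists (\big[Num.min/1]_i r i) => [|z Pz i].
  by apply/bigmin_gtP; split => // i _; have [] := hr i.
by have [_] := hr i; apply; apply: pdisc_sub Pz; exact: bigmin_le.
Qed.

(** The coordinates of the left point are replaced by those of the right point one at a time. The
    i-th difference vanishes when the two i-th coordinates coincide, hence is divisible by their
    difference. *)
Lemma holo_hadamard n (f : 'rV[C]_n -> C) a : holo f a ->
  exists2 Q : 'I_n -> 'rV[C]_(n + n) -> C,
    forall i, holo (Q i) (row_mx a a) &
    \forall w \near row_mx a a, f (lsubmx w) - f (rsubmx w) =
      \sum_i (lsubmx w 0 i - rsubmx w 0 i) * Q i w.
Proof.
move=> hf; pose b := row_mx a a.
pose T (k : nat) (w : 'rV[C]_(n + n)) : 'rV[C]_n :=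
  \row_j (if (j < k)%N then rsubmx w 0 j else lsubmx w 0 j).
have Tb k : T k b = a.
  by apply/rowP => j; rewrite mxE /b row_mxKl row_mxKr if_same.
have hT k : holo_map (T k) b.
  move=> j; rewrite (_ : (fun z => _) = (fun w : 'rV[C]_(n + n) =>
    if (j < k)%N then w 0 (rshift n j) else w 0 (lshift n j))).
    by case: (j < k)%N; exact: holo_coord.
  by apply/funext => w; rewrite !mxE.
have step (i : 'I_n) : exists Q : 'rV[C]_(n + n) -> C, holo Q b /\
    \forall w \near b, f (T i w) - f (T i.+1 w) = (lsubmx w 0 i - rsubmx w 0 i) * Q w.
  (* A shear fixing [b] that carries the hyperplane where the left i-th coordinate is [a 0 i] to the
     one where the two i-th coordinates coincide; [holo_div] divides along the former. Its inverse
     is [S']. *)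
  pose S (u : 'rV[C]_(n + n)) :=
    set_coord (lshift n i) (u 0 (lshift n i) + u 0 (rshift n i) - a 0 i) u.
  pose S' (u : 'rV[C]_(n + n)) :=
    set_coord (lshift n i) (u 0 (lshift n i) - u 0 (rshift n i) + a 0 i) u.
  have lr : (rshift n i == lshift n i :> 'I_(n + n)) = false by rewrite eq_rlshift.
  have bl : b 0 (lshift n i) = a 0 i by rewrite /b row_mxEl.
  have br : b 0 (rshift n i) = a 0 i by rewrite /b row_mxEr.
  have SK w : S (S' w) = w.
    apply/rowP => j; rewrite !mxE eqxx lr; case: eqP => // ->.
    by ring.
  have Sb : S b = b by apply/rowP => j; rewrite mxE bl br addrK; case: eqP => // ->.
  have Sb' : S' b = b by apply/rowP => j; rewrite mxE bl br subrr add0r; case: eqP => // ->.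
  have hS : holo_map S b.
    move=> j; rewrite (_ : (fun z => _) = (fun u : 'rV[C]_(n + n) => if j == lshift n i then
        u 0 (lshift n i) + u 0 (rshift n i) - a 0 i else u 0 j)).
      case: (j == lshift n i); last exact: holo_coord.
      by apply: holoB; [apply: holoD; exact: holo_coord | exact: holo_cst].
    by apply/funext => u; rewrite mxE.
  have hS' : holo_map S' b.
    move=> j; rewrite (_ : (fun z => _) = (fun u : 'rV[C]_(n + n) => if j == lshift n i then
        u 0 (lshift n i) - u 0 (rshift n i) + a 0 i else u 0 j)).
      case: (j == lshift n i); last exact: holo_coord.
      by apply: holoD; [apply: holoB; exact: holo_coord | exact: holo_cst].
    by apply/funext => u; rewrite mxE.
  pose g w := f (T i w) - f (T i.+1 w).
  have hg : holo g b.
    by apply: holoB; [apply: (holo_comp (f := f) (hT i)) | apply: (holo_comp (f := f) (hT i.+1))];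
      rewrite Tb.
  have [||q hq gq] := @holo_div (n + n) (g \o S) b (lshift n i).
  - by apply: holo_comp => //; rewrite Sb.
  - apply: filterE => u; rewrite bl => ui; rewrite /= /g; apply/eqP; rewrite subr_eq0.
    apply/eqP; congr f; apply/rowP => j; rewrite !mxE ltnS [(j <= i)%N]leq_eqVlt.
    have [->|ji] := eqVneq j i; last by rewrite (negbTE (ji : val j != val i)).
    by rewrite eqxx ltnn /= eqxx lr ui addrAC subrr add0r.
  exists (q \o S'); split; first by apply: holo_comp; rewrite ?Sb'.
  have := near_map hS'; rewrite Sb' => /(_ _ gq); apply: filterS => w.
  by rewrite /= SK /g => ->; rewrite bl !mxE eqxx addrK.
have /choice[Q hQ] := step; exists Q => [i|]; first by have [] := hQ i.
have : \forall w \near b, forall i : 'I_n,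
    f (T i w) - f (T i.+1 w) = (lsubmx w 0 i - rsubmx w 0 i) * Q i w.
  by apply: near_forall => i; have [] := hQ i.
apply: filterS => w H; under eq_bigr do rewrite -H.
have -> : lsubmx w = T 0%N w by apply/rowP => j; rewrite !mxE.
have -> : rsubmx w = T n w by apply/rowP => j; rewrite !mxE ltn_ord.
rewrite -(big_mkord xpredT (fun i => f (T i w) - f (T i.+1 w))) -opprB.
rewrite -(telescope_sumr (fun k => f (T k w)) (leq0n n)) -sumrN.
by apply: eq_bigr => i _; rewrite opprB.
Qed.

End Division.

(** * Jacobian matrices from factorizations of increments *)

Section Jacobian.
Variable K : numFieldType.

Lemma near_always n (x : 'rV[K]_n) (P : 'rV[K]_n -> Prop) :
  (forall y, P y) -> \forall y \near x, P y.
Proof. by move=> H; apply/nbhs_ballP; exists 1 => //= y _; exact: H. Qed.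

Lemma mx_entry_le n m (A : 'M[K]_(n, m)) i j : `|A i j| <= `|A|.
Proof.
rewrite [leRHS]/Num.Def.normr /= mx_normE -[leLHS]nngE num_le.
exact: (le_bigmax _ (fun ij : 'I_n * 'I_m => `|A ij.1 ij.2|%:nng) (i, j)).
Qed.

Lemma mx_norm_le n m (A : 'M[K]_(n, m)) (e : K) : 0 <= e ->
  (forall i j, `|A i j| <= e) -> `|A| <= e.
Proof.
move=> /nonnegP[{}e] He; rewrite [leLHS]/Num.Def.normr /= mx_normE num_le.
by apply/bigmax_leP; split=> [|[i j] _]; rewrite -num_le /=.
Qed.

Lemma mulmx_norm_le n m (v : 'rV[K]_n) (A : 'M[K]_(n, m)) (e : K) : 0 <= e ->
  (forall i j, `|A i j| <= e) -> `|v *m A| <= n%:R * e * `|v|.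
Proof.
move=> e0 He; apply: mx_norm_le => [|i j]; first by rewrite !mulr_ge0.
rewrite mxE; apply: le_trans (ler_norm_sum _ _ _) _.
apply: (@le_trans _ _ (\sum_(k < n) e * `|v|)).
  by apply: ler_sum => k _; rewrite normrM mulrC ler_pM ?mx_entry_le.
by rewrite sumr_const card_ord -[leLHS]mulr_natl mulrA.
Qed.

Lemma mulmxr_continuous n m (A : 'M[K]_(n, m)) :
  continuous (fun v : 'rV[K]_n => v *m A).
Proof.
move=> v; suff : (w *m A)@[w --> v] --> v *m A by [].
have FF : Filter (nbhs v) by exact: nbhs_filter.
apply/cvgrPdist_le => e e0.
pose S := n%:R * `|A| + 1; have S0 : 0 < S by rewrite ltr_wpDl // mulr_ge0.
near=> w; rewrite -mulmxBl.
apply: le_trans (mulmx_norm_le _ (normr_ge0 A) (mx_entry_le A)) _.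
have : S * `|v - w| <= e.
  rewrite mulrC -ler_pdivlMr //; near: w.
  by apply: cvgr_dist_le; [exact: cvg_id | rewrite divr_gt0].
by apply: le_trans; rewrite ler_wpM2r // lerDl.
Unshelve. all: by end_near. Qed.

(** Caratheodory's form of differentiability: an increment factored through a matrix continuous at
    [x] has the value of this matrix at [x] as its derivative. *)
Lemma has_jacobian n m (f : 'rV[K]_n -> 'rV[K]_m) (A : 'rV[K]_n -> 'M[K]_(n, m)) (x : 'rV[K]_n) :
  (\forall y \near x, f y - f x = (y - x) *m A y) ->
  (forall e, 0 < e -> \forall y \near x, forall i j, `|A y i j - A x i j| <= e) ->
  differentiable f x /\ 'J f x = A x.
Proof.
move=> fA Ac.
pose V : normedModType K := 'rV[K]_n; pose W : normedModType K := 'rV[K]_m.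
pose df : {linear V -> W} := mulmxr (A x).
have H : (f : V -> W) \o shift (x : V) = cst (f x) + df +o_ (0 : V) id.
  apply/eqaddoP => e e0; pose S : K := n%:R + 1.
  have S0 : 0 < S by rewrite ltr_wpDl.
  have e1 : 0 < e / S by rewrite divr_gt0.
  have sh (P : V -> Prop) : (\forall y \near (x : V), P y) ->
      \forall h \near (0 : V), P (h + x).
    rewrite (near_shift (0 : V) (x : V)); apply: filterS => h.
    by rewrite subr0.
  have := sh _ fA; have := sh _ (Ac _ e1); apply: filterS2 => h h1 h2.
  rewrite /= -[X in `|X|]/((f (h + x)) - (f x + h *m A x)).
  rewrite opprD addrA h2 addrK -mulmxBr.
  apply: le_trans (mulmx_norm_le (e := e / S) _ (ltW e1) _) _.
    by move=> i j; rewrite 2!mxE.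
  by rewrite ler_wpM2r // mulrA ler_pdivrMr // mulrC ler_wpM2l ?(ltW e0) // lerDl.
have dfc : continuous (df : V -> W) by exact: (@mulmxr_continuous n m (A x)).
have dfE := diff_unique dfc H.
split; last by apply/matrixP => i j; rewrite /jacobian mxE dfE /= -rowE mxE.
apply/diff_locallyP; rewrite dfE; by split.
Unshelve. all: by end_near. Qed.

(** Jacobians act on row vectors from the right, so the factor of the map applied first stands on
    the left. *)
Lemma jacobian_comp n m k (f : 'rV[K]_n -> 'rV[K]_m) (g : 'rV[K]_m -> 'rV[K]_k) x :
  differentiable f x -> differentiable g (f x) ->
  differentiable (g \o f) x /\ 'J (g \o f) x = 'J f x *m 'J g (f x).
Proof.
move=> df dg; split; first exact: differentiable_comp.
apply/row_matrixP => i; rewrite !rowE mulmxA /jacobian !mul_rV_lin1.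
by rewrite diff_comp.
Qed.

End Jacobian.

Section HoloJacobian.
Variable R : realType.
Local Notation C := (Num.NumField.sort (R[i] : numFieldType)).
Local Notation abs := (@normc R).

Lemma jacobian_mulmxr (K : numFieldType) n m (L : 'M[K]_(n, m)) (x : 'rV[K]_n) :
  differentiable (fun v : 'rV[K]_n => v *m L) x /\
  'J (fun v : 'rV[K]_n => v *m L) x = L.
Proof.
apply: (@has_jacobian K n m (fun v => v *m L) (fun=> L)) => [|e e0].
  by apply: near_always => y; rewrite mulmxBl.
by apply: near_always => y i j; rewrite subrr normr0 ltW.
Qed.

Lemma pdisc_row_mx n (a y z : 'rV[C]_n) (r : R) :
  pdisc a r y -> pdisc a r z -> pdisc (row_mx a a) r (row_mx y z).
Proof.
move=> Py Pz i; rewrite -(splitK i); case: (fintype.split i) => j /=.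
  by rewrite !row_mxEl.
by rewrite !row_mxEr.
Qed.

Lemma holo_map_row_mx n (z a : 'rV[C]_n) : holo_map (fun y => row_mx y z) a.
Proof.
move=> i; rewrite -(splitK i); case: (fintype.split i) => j /=.
  rewrite (_ : (fun _ => _) = (fun y : 'rV[C]_n => y 0 j)); first exact: holo_coord.
  by apply/funext => y; rewrite row_mxEl.
rewrite (_ : (fun _ => _) = (fun=> z 0 j)); first exact: holo_cst.
by apply/funext => y; rewrite row_mxEr.
Qed.

Lemma holo_map_diag n (a : 'rV[C]_n) : holo_map (fun y => row_mx y y) a.
Proof.
move=> i; rewrite -(splitK i); case: (fintype.split i) => j /=.
  rewrite (_ : (fun _ => _) = (fun y : 'rV[C]_n => y 0 j)); first exact: holo_coord.
  by apply/funext => y; rewrite row_mxEl.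
rewrite (_ : (fun _ => _) = (fun y : 'rV[C]_n => y 0 j)); first exact: holo_coord.
by apply/funext => y; rewrite row_mxEr.
Qed.

Lemma holo_near2 n m (f : 'I_n -> 'I_m -> 'rV[C]_(n + n) -> C) b :
  (forall i j, holo (f i j) b) -> \forall w \near b, forall i j, holo (f i j) w.
Proof. by move=> H; do 2![apply: near_forall => ?]; exact: holo_near. Qed.

(** With the right point frozen at [z], the factorization is Caratheodory's criterion at [z]. The
    Jacobian is thus the restriction of [A] to the diagonal, which makes it holomorphic. *)
Lemma holo_map_hadamard n m (h : 'rV[C]_n -> 'rV[C]_m) a : holo_map h a ->
  exists A : 'rV[C]_(n + n) -> 'M[C]_(n, m),
  [/\ forall i j, holo (fun w => A w i j) (row_mx a a),
      \forall w \near row_mx a a,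
        h (lsubmx w) - h (rsubmx w) = (lsubmx w - rsubmx w) *m A w &
      \forall z \near a, differentiable h z /\ 'J h z = A (row_mx z z)].
Proof.
move=> hh; have /choice[Q hQ] : forall j, exists Q : 'I_n -> 'rV[C]_(n + n) -> C,
    (forall i, holo (Q i) (row_mx a a)) /\
    \forall w \near row_mx a a, h (lsubmx w) 0 j - h (rsubmx w) 0 j =
      \sum_i (lsubmx w 0 i - rsubmx w 0 i) * Q i w.
  by move=> j; have [Q Q1 Q2] := holo_hadamard (hh j); exists Q.
pose A w : 'M[C]_(n, m) := \matrix_(i, j) Q j i w.
have hA i j : holo (fun w => A w i j) (row_mx a a).
  rewrite (_ : (fun _ => _) = Q j i); first exact: (hQ j).1.
  by apply/funext => w; rewrite mxE.
have AE : \forall w \near row_mx a a,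
    h (lsubmx w) - h (rsubmx w) = (lsubmx w - rsubmx w) *m A w.
  have := near_forall (fun j => (hQ j).2); apply: filterS => w H.
  apply/rowP => j; rewrite !mxE H; apply: eq_bigr => i _.
  by rewrite !mxE.
exists A; split => //.
have /near_pdisc[r r0 H] : \forall w \near row_mx a a,
    h (lsubmx w) - h (rsubmx w) = (lsubmx w - rsubmx w) *m A w /\
    forall i j, holo (fun w => A w i j) w.
  exact: filterI AE (holo_near2 hA).
apply/near_pdisc; exists (r / 2) => [|z Pz]; first exact: divr_gt0.
have r2 : 0 < r / 2 by exact: divr_gt0.
have Pz' : pdisc a r z by apply: pdisc_sub Pz; lra.
have key y : pdisc z (r / 2) y -> pdisc (row_mx a a) r (row_mx y z).
  move=> Py; apply: pdisc_row_mx => //.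
  by rewrite [r]splitr; exact: pdisc_trans Pz Py.
apply: (@has_jacobian _ n m h (fun y => A (row_mx y z))).
  apply/near_pdisc; exists (r / 2) => // y /key /H[].
  by rewrite row_mxKl row_mxKr.
move=> _ /posC[e e0 ->]; have [_ hAz] := H _ (key z (pdisc_center _ (ltW r2))).
suff H2 (i : 'I_n) (j : 'I_m) : \forall y \near (z : 'rV[C]_n),
    `|A (row_mx y z) i j - A (row_mx z z) i j| <= e%:C.
  exact: near_forall (fun i => near_forall (H2 i)).
have [d d0 hd] := holo_eps (holo_comp (holo_map_row_mx z z) (hAz i j)) e0.
by apply/near_pdisc; exists d => // y /hd; rewrite abs_le.
Qed.

Lemma holo_differentiable n m (h : 'rV[C]_n -> 'rV[C]_m) a :
  holo_map h a -> differentiable h a.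
Proof. by move=> /holo_map_hadamard[A [_ _ /nbhs_singleton[]]]. Qed.

Lemma holo_map_near n m (h : 'rV[C]_n -> 'rV[C]_m) a :
  holo_map h a -> \forall z \near a, holo_map h z.
Proof. by move=> hh; apply: near_forall => j; exact: holo_near. Qed.

Lemma holo_jacobian n m (h : 'rV[C]_n -> 'rV[C]_m) a i j :
  holo_map h a -> holo (fun z => 'J h z i j) a.
Proof.
move=> /holo_map_hadamard[A [hA _ JA]].
apply: (@holo_ext _ _ (fun z => A (row_mx z z) i j)).
  by move: JA; apply: filterS => z [_ ->].
exact: (holo_comp (holo_map_diag a) (hA i j)).
Qed.

Lemma eq_jacobian n m (f g : 'rV[C]_n -> 'rV[C]_m) a : holo_map f a ->
  (\forall z \near a, f z = g z) -> 'J f a = 'J g a.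
Proof.
move=> hf fg.
have [A [hA /near_pdisc[r r0 H] JA]] := holo_map_hadamard hf.
have [_ ->] := nbhs_singleton JA.
have [] // := @has_jacobian _ n m g (fun y => A (row_mx y a)) a.
  have := fg; have : \forall y \near a, pdisc a r y by apply/near_pdisc; exists r.
  apply: filterS2 => y Py <-; rewrite -(nbhs_singleton fg).
  have := H (row_mx y a) (pdisc_row_mx Py (pdisc_center _ (ltW r0))).
  by rewrite row_mxKl row_mxKr.
move=> _ /posC[e e0 ->].
suff H2 (i : 'I_n) (j : 'I_m) : \forall y \near (a : 'rV[C]_n),
    `|A (row_mx y a) i j - A (row_mx a a) i j| <= e%:C.
  exact: near_forall (fun i => near_forall (H2 i)).
have [d d0 hd] := holo_eps (holo_comp (holo_map_row_mx a a) (hA i j)) e0.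
by apply/near_pdisc; exists d => // y /hd; rewrite abs_le.
Qed.

Lemma holo_jacobian_comp n m k (f : 'rV[C]_n -> 'rV[C]_m) (g : 'rV[C]_m -> 'rV[C]_k) a :
  holo_map f a -> holo_map g (f a) -> 'J (g \o f) a = 'J f a *m 'J g (f a).
Proof.
by move=> hf hg; have [] := jacobian_comp (holo_differentiable hf) (holo_differentiable hg).
Qed.

End HoloJacobian.

(** * Complexification of real-analytic maps *)

Section RealPoints.
Variable R : realType.
Local Notation C := (Num.NumField.sort (R[i] : numFieldType)).
Local Notation abs := (@normc R).

Definition cplx n m : 'M[R]_(n, m) -> 'M[C]_(n, m) := map_mx (real_complex R).

Lemma pdisc_cplx n (a x : 'rV[R]_n) (r : R) :
  pdisc (cplx a) r (cplx x) <-> forall i, `|x 0 i - a 0 i| <= r.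
Proof. by split=> H i; have := H i; rewrite !mxE -rmorphB abs_real. Qed.

Lemma near_cplx n (a : 'rV[R]_n) (P : 'rV[C]_n -> Prop) :
  (\forall z \near cplx a, P z) -> \forall x \near a, P (cplx x).
Proof.
move=> /near_pdisc[r r0 H]; apply/near_real; exists r => // x /pdisc_cplx; exact: H.
Qed.

Lemma psum_cplx n (c : {ffun 'I_n -> nat} -> R) (h : 'rV[R]_n) N :
  psum (fun m => (c m)%:C) (cplx h) N = (psum c h N)%:C.
Proof.
rewrite /psum rmorph_sum; apply: eq_bigr => m _; rewrite rmorphM rmorph_prod.
by congr (_ * _); apply: eq_bigr => i _; rewrite mxE rmorphXn.
Qed.

(** The same coefficients define the extension: the real majorant makes the series converge on the
    complex polydisc of the same radius. *)
Lemma analytic_real_holo n (u : 'rV[R]_n -> R) a : analytic_at u a ->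
  exists2 F : 'rV[C]_n -> C, holo F (cplx a) &
    \forall x \near a, F (cplx x) = (u x)%:C.
Proof.
move=> [c /near_real[r r0 H]].
have [|[B HB] _] := H (a + const_mx r).
  by move=> i; rewrite !mxE addrAC subrr add0r gtr0_norm.
have [|F aF hF] := @series_polylim R n (cplx a) r (fun m => (c m)%:C) B (ltW r0).
  move=> N; have := HB N; rewrite addrAC subrr add0r.
  apply: le_trans; apply: ler_sum => m _; rewrite abs_real ler_wpM2l //.
  rewrite le_eqVlt; apply/orP; left; apply/eqP; apply: eq_bigr => i _.
  by rewrite !mxE gtr0_norm.
exists F; first by exists r.
apply/near_real; exists r => // x Px; have [_ ux] := H x Px.
apply: seq_lim_uniq (hF _ (iffRL (pdisc_cplx a x r) Px)) _ => e e0.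
move: ux => /cvgrPdist_le /(_ _ e0)[N _ hN]; exists N => k /hN /=.
by rewrite -map_mxB psum_cplx -rmorphB abs_real distrC.
Qed.

Lemma psum1 (c : {ffun 'I_1 -> nat} -> C) (h : 'rV[C]_1) N :
  psum c h N = \sum_(k < N) c [ffun=> k : nat] * h 0 0 ^+ k.
Proof.
rewrite psumE (reindex_onto (fun k : 'I_N => [ffun=> k] : {ffun 'I_1 -> 'I_N})
  (fun m => m 0)) /=.
  apply: eq_big => [k|k _]; first by rewrite ffunE eqxx.
  rewrite /monom big_ord1 ffunE ffunE; congr (c _ * _).
  by apply/ffunP => i; rewrite !ffunE.
by move=> m _; apply/ffunP => i; rewrite ffunE (ord1 i).
Qed.

Lemma geom_tail (x : R) k N : 0 <= x -> x <= 2^-1 ->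
  \sum_(j < N | (k < j)%N) x ^+ j <= 2 * x ^+ k.+1.
Proof.
move=> x0 x2; have [Nk|kN] := leqP N k.+1.
  rewrite big_pred0 => [|j]; first by rewrite mulr_ge0 ?exprn_ge0.
  by apply: negbTE; rewrite -leqNgt -ltnS (leq_trans (ltn_ord j)).
rewrite -(big_mkord (fun j => k < j)%N (fun j => x ^+ j)).
rewrite (big_cat_nat (n := k.+1)) ?(ltnW kN) //= big1_seq ?add0r; last first.
  by move=> j /andP[kj]; rewrite mem_index_iota => /andP[_]; rewrite ltnS leqNgt kj.
rewrite -{1}[k.+1]add0n big_addn.
apply: (@le_trans _ _ (\sum_(0 <= i < N - k.+1) 2^-1 ^+ i * x ^+ k.+1)).
  rewrite big_mkcond /=; apply: ler_sum => i _; case: ifP => _.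
    by rewrite exprD ler_wpM2r ?exprn_ge0 // lerXn2r ?nnegrE // invr_ge0.
  by rewrite mulr_ge0 ?exprn_ge0 // invr_ge0.
rewrite -mulr_suml ler_wpM2r ?exprn_ge0 // big_mkord; exact: geom_half_le.
Qed.

(** By strong induction the coefficients before the k-th vanish. At distance [t] from the center,
    the k-th term is then cancelled by the tail, of order t^(k+1), which forces the k-th coefficient
    to be 0 as [t] shrinks. *)
Lemma polylim_identity1 (f : 'rV[C]_1 -> C) (a : R) (r : R) : 0 < r ->
  polylim (const_mx a%:C) r f ->
  (forall t : R, `|t - a| <= r / 2 -> f (const_mx t%:C) = 0) ->
  forall z, pdisc (const_mx a%:C) (r / 2) z -> f z = 0.
Proof.
move=> r0 af f0; have [c [B B0 [hB hc]]] := polylim_series r0 af.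
pose d (k : nat) := c [ffun=> k].
have hd k : abs (d k) * r ^+ k <= B by have := hB [ffun=> k]; rewrite big_ord1 ffunE.
suff d0 k : d k = 0.
  move=> z Pz; apply: seq_lim_uniq (hc z Pz) _ => e e0; exists 0%N => N _.
  rewrite psum1 big1 => [|k _]; first by rewrite subrr normc0 ltW.
  by rewrite [c _]d0 mul0r.
elim/ltn_ind: k => k IH; apply: abs_small => e e0.
(* The first bound keeps the point where [f] vanishes and the ratio [t / r] at most one half; the
   second makes [2 * B * t / r ^+ k.+1] at most [e], with [2 * B + 1] to divide by a positive
   number. *)
pose t := Num.min (r / 2) (e * r ^+ k.+1 / (2 * B + 1)).
have BB : 0 < 2 * B + 1 by lra.
have rk m : 0 < r ^+ m by rewrite exprn_gt0.
have t0 : 0 < t by rewrite lt_min !divr_gt0 // mulr_gt0.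
have tr : t / r <= 2^-1 by rewrite ler_pdivrMr // mulrC /t ge_min lexx.
have tr0 : 0 <= t / r by rewrite divr_ge0 // ltW.
have Pt : pdisc (const_mx a%:C) (r / 2) (const_mx (a + t)%:C : 'rV[C]_1).
  by move=> i; rewrite !mxE -rmorphB addrAC subrr add0r abs_real gtr0_norm // /t ge_min lexx.
have key N : (k < N)%N ->
    abs (psum c (const_mx (a + t)%:C - const_mx a%:C) N - d k * t%:C ^+ k) <=
    2 * B * (t / r) ^+ k.+1.
  move=> kN; rewrite psum1 (bigID (fun j : 'I_N => k < j)%N) /=.
  rewrite [X in _ + X - _](bigD1 (Ordinal kN)) ?ltnn //= [X in _ + (_ + X) - _]big1; last first.
    move=> j /andP[]; rewrite -leqNgt leq_eqVlt => /orP[/eqP jk|jk _].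
      by case/eqP; apply: val_inj.
    by rewrite [c _](IH j jk) mul0r.
  have -> : (const_mx (a + t)%:C - const_mx a%:C : 'rV[C]_1) 0 0 = t%:C.
    by rewrite !mxE -rmorphB addrAC subrr add0r.
  rewrite addr0 addrK; apply: le_trans (abs_sum _ _ _) _.
  rewrite [2 * B]mulrC -mulrA; apply: le_trans (ler_wpM2l B0 (geom_tail k N tr0 tr)).
  rewrite mulr_sumr; apply: ler_sum => j _.
  rewrite normcM absX abs_real gtr0_norm // expr_div_n mulrA ler_pdivlMr ?rk //.
  by rewrite mulrAC ler_wpM2r ?exprn_ge0 ?(ltW t0) //; exact: hd.
have bound : abs (d k) * t ^+ k <= 2 * B * (t / r) ^+ k.+1.
  apply/ler_addgt0Pr => s s0; have [N hN] := hc _ Pt _ s0.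
  have := hN (maxn N k.+1) (leq_maxl _ _); rewrite f0; last first.
    by rewrite addrAC subrr add0r gtr0_norm // /t ge_min lexx.
  have := key (maxn N k.+1) (leq_maxr _ _).
  set S := psum _ _ _; rewrite subr0 => h1 h2.
  have := abs_split S (d k * t%:C ^+ k) 0; rewrite !subr0 absB.
  rewrite normcM absX abs_real gtr0_norm //; lra.
have : abs (d k) <= 2 * B * t / r ^+ k.+1.
  rewrite ler_pdivlMr // -(ler_pM2r (exprn_gt0 k t0)).
  rewrite mulrAC -ler_pdivlMr //; apply: le_trans bound _.
  by rewrite expr_div_n exprS !mulrA.
move=> /le_trans; apply; rewrite ler_pdivrMr //.
have : (2 * B + 1) * t <= e * r ^+ k.+1.
  by rewrite mulrC -ler_pdivlMr // /t ge_min lexx orbT.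
by apply: le_trans; rewrite ler_wpM2r ?(ltW t0) // lerDl.
Qed.

(** One coordinate at a time: if [f] vanishes at the points whose coordinates from the k-th on are
    real, the one-variable theorem in the k-th coordinate frees it from this constraint. *)
Lemma holo_identity n (f : 'rV[C]_n -> C) (a : 'rV[R]_n) : holo f (cplx a) ->
  (\forall x \near a, f (cplx x) = 0) -> \forall z \near cplx a, f z = 0.
Proof.
move=> [r1 r10 af1] /near_real[s s0 f0].
pose r := Num.min r1 s; have r0 : 0 < r by rewrite lt_min r10.
have af : polylim (cplx a) r f by apply: polylim_sub af1 => z /pdisc_minl.
apply/near_pdisc; exists (r / 2); first exact: divr_gt0.
suff H k : forall z, pdisc (cplx a) (r / 2) z ->
    (forall j : 'I_n, (k <= j)%N -> z 0 j = (complex.Re (z 0 j))%:C) -> f z = 0.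
  by move=> z Pz; apply: (H n z Pz) => j; rewrite leqNgt ltn_ord.
elim: k => [|k IH] z Pz zr.
  pose x : 'rV[R]_n := \row_j complex.Re (z 0 j).
  have zE : z = cplx x by apply/rowP => j; rewrite !mxE -zr.
  rewrite zE; apply: f0; apply/pdisc_cplx; rewrite -zE; apply: pdisc_sub Pz.
  have : r <= s by rewrite /r ge_min lexx orbT.
  lra.
have [kn|nk] := ltnP k n; last first.
  by apply: IH => // j kj; have := ltn_ord j; rewrite ltnNge (leq_trans nk kj).
pose i := Ordinal kn.
have zE : z = set_coord i (z 0 i) z by apply/rowP => j; rewrite mxE; case: eqP => [->|].
pose h (t : 'rV[C]_1) := set_coord i (t 0 0) z.
have := @polylim_identity1 (f \o h) (a 0 i) r r0.
have Ph s' t : s' <= r -> pdisc (const_mx (a 0 i)%:C) s' t -> r / 2 <= s' ->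
    pdisc (cplx a) s' (h t).
  move=> s'r Pt rs j; rewrite mxE; case: eqP => [->|_].
    by have := Pt 0; rewrite !mxE.
  exact: le_trans (Pz j) rs.
move=> /(_ _ _ (const_mx (z 0 i))); rewrite /= /h mxE -zE; apply.
- apply: (polylim_comp af) => [j|t Pt]; last by apply: Ph => //; lra.
  rewrite (_ : (fun _ => _) = (fun t : 'rV[C]_1 => if j == i then t 0 0 else z 0 j)).
    by case: (j == i); [exact: polylim_coord | exact: polylim_cst].
  by apply/funext => t; rewrite mxE.
- move=> t Pt; apply: IH.
    apply: Ph => //; first lra.
    by move=> j; rewrite !mxE -rmorphB abs_real.
  move=> j; rewrite leq_eqVlt => /orP[/eqP kj|kj].
    by rewrite !mxE ifT //; apply/eqP/val_inj.
  rewrite mxE ifF; last by apply/negbTE; rewrite neq_ltn kj orbT.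
  by apply: zr.
- by move=> j; rewrite !mxE; have := Pz i; rewrite !mxE.
Qed.

End RealPoints.

(** * Jacobians of complexified maps at real points *)

Section RealJacobian.
Variable R : realType.
Local Notation C := (Num.NumField.sort (R[i] : numFieldType)).
Local Notation abs := (@normc R).

Lemma rowmx_cplx k n (x y : 'M[R]_(k, n)) : row_mx (cplx x) (cplx y) = cplx (row_mx x y).
Proof. by rewrite /cplx map_row_mx. Qed.

Lemma Re_mul_cplx n m (v : 'rV[R]_n) (A : 'M[C]_(n, m)) j :
  complex.Re ((cplx v *m A) 0 j) = (v *m map_mx (@complex.Re R) A) 0 j.
Proof.
rewrite !mxE raddf_sum; apply: eq_bigr => i _; rewrite !mxE.
by case: (A i j) => p q /=; rewrite mul0r subr0.
Qed.

Lemma Im_mul_cplx n m (v : 'rV[R]_n) (A : 'M[C]_(n, m)) j :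
  complex.Im ((cplx v *m A) 0 j) = (v *m map_mx (@complex.Im R) A) 0 j.
Proof.
rewrite !mxE raddf_sum; apply: eq_bigr => i _; rewrite !mxE.
by case: (A i j) => p q /=; rewrite mul0r addr0.
Qed.

(** Between real points, the real part of Hadamard's factorization of [U] is a factorization for
    [u]. The imaginary part is one for the null map, so the matrix is real on the diagonal. Both are
    instances of [part]. *)
Lemma real_jacobian n m (u : 'rV[R]_n -> 'rV[R]_m) (U : 'rV[C]_n -> 'rV[C]_m) a :
  holo_map U (cplx a) -> (\forall x \near a, U (cplx x) = cplx (u x)) ->
  \forall x \near a, differentiable u x /\ 'J U (cplx x) = cplx ('J u x).
Proof.
move=> hU uU; have [A [hA AE JA]] := holo_map_hadamard hU.
have [r r0 H] : exists2 r : R, 0 < r & forall w, pdisc (cplx (row_mx a a)) r w ->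
    U (lsubmx w) - U (rsubmx w) = (lsubmx w - rsubmx w) *m A w /\
    forall i j, holo (fun w => A w i j) w.
  by apply/near_pdisc; rewrite -rowmx_cplx; exact: filterI AE (holo_near2 hA).
have /near_real[s s0 us] := uU; have /near_cplx /near_real[s' s'0 JA'] := JA.
pose t := Num.min (Num.min r s) s'.
have t0 : 0 < t by rewrite !lt_min r0 s0.
have [tr ts ts'] : [/\ t <= r, t <= s & t <= s'].
  by split; rewrite /t !ge_min lexx ?orbT.
apply/near_real; exists (t / 2) => [|x Px]; first exact: divr_gt0.
have t2 : 0 < t / 2 by exact: divr_gt0.
have ux : U (cplx x) = cplx (u x) by apply: us => i; have := Px i; lra.
have [_ JUx] : differentiable U (cplx x) /\ 'J U (cplx x) = A (row_mx (cplx x) (cplx x)).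
  by apply: JA' => i; have := Px i; lra.
have key (y : 'rV[R]_n) : (forall i, `|y 0 i - x 0 i| <= t / 2) ->
    cplx (u y - u x) = cplx (y - x) *m A (row_mx (cplx y) (cplx x)) /\
    forall i j, holo (fun w => A w i j) (row_mx (cplx y) (cplx x)).
  move=> Py; have Pay i : `|y 0 i - a 0 i| <= t.
    have -> : y 0 i - a 0 i = (y 0 i - x 0 i) + (x 0 i - a 0 i) by rewrite addrA subrK.
    by apply: le_trans (ler_normD _ _) _; have := Px i; have := Py i; lra.
  have [|] := H (row_mx (cplx y) (cplx x)).
    rewrite -rowmx_cplx; apply: pdisc_row_mx; apply/pdisc_cplx => i.
      exact: le_trans tr.
    by have := Px i; lra.
  rewrite row_mxKl row_mxKr ux us => [E|i]; last exact: le_trans ts.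
  by split=> //; rewrite /cplx !map_mxB -E.
have hAx : forall i j, holo (fun w => A w i j) (row_mx (cplx x) (cplx x)).
  by apply: (key x _).2 => i; rewrite subrr normr0 ltW.
have cont (e : R) : 0 < e -> \forall y \near (x : 'rV[R]_n), forall i j,
    abs (A (row_mx (cplx y) (cplx x)) i j - A (row_mx (cplx x) (cplx x)) i j) <= e.
  move=> e0; suff H2 (i : 'I_n) (j : 'I_m) : \forall z \near (cplx x : 'rV[C]_n),
      abs (A (row_mx z (cplx x)) i j - A (row_mx (cplx x) (cplx x)) i j) <= e.
    by apply: near_cplx (near_forall (fun i => near_forall (H2 i))).
  have [d d0 hd] := holo_eps (holo_comp (holo_map_row_mx _ _) (hAx i j)) e0.
  by apply/near_pdisc; exists d.
have near_t : \forall y \near (x : 'rV[R]_n), forall i, `|(y : 'rV[R]_n) 0 i - x 0 i| <= t / 2.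
  by apply/near_real; exists (t / 2).
pose A0 y := A (row_mx (cplx y) (cplx x)).
have part (p : C -> R) (pB : {morph p : z w / z - w}) (p_le : forall z, `|p z| <= abs z)
    (f : 'rV[R]_n -> 'rV[R]_m) :
    (forall y j, p ((cplx (y - x) *m A0 y) 0 j) = ((y - x) *m map_mx p (A0 y)) 0 j) ->
    (forall y j, p (cplx (u y - u x) 0 j) = (f y - f x) 0 j) ->
    differentiable f x /\ 'J f x = map_mx p (A0 x).
  move=> pA pf; have H1 : \forall y \near (x : 'rV[R]_n),
      f y - f x = (y - x) *m map_mx p (A0 y).
    by move: near_t; apply: filterS => y /key[E _]; apply/rowP => j; rewrite -pA -E pf.
  have H2 (e : R) : 0 < e -> \forall y \near (x : 'rV[R]_n), forall i j,
      `|map_mx p (A0 y) i j - map_mx p (A0 x) i j| <= e.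
    move=> /cont; apply: filterS => y H2 i j; rewrite !mxE -pB.
    exact: le_trans (p_le _) (H2 i j).
  exact: has_jacobian H1 H2.
have Re_u y j : complex.Re (cplx (u y - u x) 0 j) = (u y - u x) 0 j by rewrite mxE.
have Im_u y j : complex.Im (cplx (u y - u x) 0 j) = (0 - 0 : 'rV[R]_m) 0 j.
  by rewrite !mxE subrr.
have [du Ju] := part _ (raddfB (@complex.Re R)) (@abs_Re R) u
  (fun y j => Re_mul_cplx _ _ j) Re_u.
have [_ J0] := part _ (raddfB (@complex.Im R)) (@abs_Im R) (fun=> 0)
  (fun y j => Im_mul_cplx _ _ j) Im_u.
have [_ J0'] : differentiable (fun=> 0 : 'rV[R]_m) x /\
    'J (fun=> 0 : 'rV[R]_m) x = 0.
  apply: (@has_jacobian R n m (fun=> 0) (fun=> 0)) => [|e e0].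
    by apply: near_always => y; rewrite mulmx0 subrr.
  by apply: near_always => y i j; rewrite subrr normr0 ltW.
split=> //; rewrite JUx Ju; apply/matrixP => i j; rewrite !mxE.
have : map_mx (@complex.Im R) (A (row_mx (cplx x) (cplx x))) i j = 0.
  by rewrite -J0 J0' mxE.
by rewrite mxE; case: (A _ i j) => p q /= ->.
Qed.

Lemma near_near_real n (a : 'rV[R]_n) (P : 'rV[R]_n -> Prop) :
  (\forall x \near a, P x) -> \forall x \near a, \forall y \near x, P y.
Proof.
move=> /near_real[r r0 H]; have r2 : 0 < r / 2 by exact: divr_gt0.
apply/near_real; exists (r / 2) => // x Px; apply/near_real; exists (r / 2) => // y Py.
apply: H => i; have -> : y 0 i - a 0 i = (y 0 i - x 0 i) + (x 0 i - a 0 i).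
  by rewrite addrA subrK.
by apply: le_trans (ler_normD _ _) _; have := Px i; have := Py i; lra.
Qed.

Definition cvec n (v : 'rV[R]_(n + n)) : 'rV[C]_n :=
  map2_mx (@Complex R) (lsubmx v) (rsubmx v).

(** Written as a product with the complex matrix (1, i), recombining the coordinates makes sense at
    nonreal values of the 2n coordinates too, which is where complexified maps take their values. *)
Lemma cvecE k n (v : 'M[R]_(k, n + n)) : map2_mx (@Complex R) (lsubmx v) (rsubmx v) =
  cplx v *m (col_mx 1%:M (scalar_mx (Complex 0 1)) : 'M[C]_(n + n, n)).
Proof.
rewrite -[v in RHS]hsubmxK -rowmx_cplx mul_row_col mulmx1 mul_mx_scalar.
apply/matrixP => i j; rewrite !mxE; move: (lshift n j) (rshift n j) => a b.
by apply/eqP; rewrite eq_complex /= !mul0r !mul1r subrr addr0 !add0r !eqxx.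
Qed.

(** The quantification over [u'] is there because the coordinate expression of a map depends,
    through the default value of [chart_inv], on the base point: at a nearby point it is another
    function, with the same germ. *)
Lemma analytic_real_holo_map n m (u : 'rV[R]_n -> 'rV[R]_(m + m)) a :
  (forall j, analytic_at (fun x => u x 0 j) a) ->
  exists2 F : 'rV[C]_n -> 'rV[C]_m, holo_map F (cplx a) &
    \forall b \near a, F (cplx b) = cvec (u b) /\
      forall u', (\forall x \near b, u' x = u x) ->
      'J F (cplx b) = complex_jac ('J u' b).
Proof.
move=> au; have /choice[U0 hU0] : forall j, exists U : 'rV[C]_n -> C, holo U (cplx a) /\
    \forall x \near a, U (cplx x) = (u x 0 j)%:C.
  by move=> j; have [U U1 U2] := analytic_real_holo (au j); exists U.
pose U z : 'rV[C]_(m + m) := \row_j U0 j z.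
have hU : holo_map U (cplx a).
  move=> j; rewrite (_ : (fun _ => _) = U0 j); first exact: (hU0 j).1.
  by apply/funext => z; rewrite mxE.
have UE : \forall x \near a, U (cplx x) = cplx (u x).
  have : \forall x \near a, forall j, U0 j (cplx x) = (u x 0 j)%:C.
    apply/near_real; have /choice[r hr] : forall j, exists r : R, 0 < r /\
        forall x : 'rV[R]_n, (forall i, `|x 0 i - a 0 i| <= r) -> U0 j (cplx x) = (u x 0 j)%:C.
      by move=> j; have [_ /near_real[r]] := hU0 j; exists r.
    exists (\big[Num.min/1]_j r j) => [|z Pz i].
      by apply/bigmin_gtP; split => // i _; have [] := hr i.
    have [_] := hr i; apply=> j; apply: le_trans (Pz j) _; exact: bigmin_le.
  by apply: filterS => x H; apply/rowP => j; rewrite !mxE H.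
pose L : 'M[C]_(m + m, m) := col_mx 1%:M (scalar_mx (Complex 0 1)).
have hL b : holo_map (fun v : 'rV[C]_(m + m) => v *m L) b.
  move=> j; rewrite (_ : (fun _ => _) = (fun z : 'rV[C]_(m + m) => \sum_k z 0 k * L k j)).
    by apply: holo_sum => k; apply: holoM; [exact: holo_coord | exact: holo_cst].
  by apply/funext => z; rewrite mxE.
exists (fun z => U z *m L); first exact: (holo_map_comp hU (hL _)).
have := near_cplx (holo_map_near hU); have := near_near_real UE.
apply: filterS3 UE => b Ub UEb hUb; rewrite Ub -cvecE; split=> // u' u'u.
have UE' : \forall x \near b, U (cplx x) = cplx (u' x).
  by apply: filterS2 UEb u'u => x h1 h2; rewrite h2; exact: h1.
have [_ JU] := nbhs_singleton (real_jacobian hUb UE').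
rewrite /complex_jac cvecE -JU (holo_jacobian_comp hUb (hL _)); congr (_ *m _).
by have [] := jacobian_mulmxr L (U (cplx b)).
Qed.

End RealJacobian.

(** * Submersions and local extensions *)

Section Inverse.
Variable R : realType.
Local Notation C := (Num.NumField.sort (R[i] : numFieldType)).
Local Notation abs := (@normc R).

Lemma half_pow_small (c e : R) : 0 < e -> exists k, c / 2 ^+ k <= e.
Proof.
move=> e0; pose k := Num.truncn (`|c| / e); exists k.+1.
have h : c / e < k.+1%:R.
  apply: le_lt_trans (truncnS_gt (`|c| / e)).
  by rewrite ler_wpM2r ?ler_norm // invr_ge0 ltW.
rewrite ler_pdivrMr ?exprn_gt0 // mulrC -ler_pdivrMr //.
apply: ltW; apply: lt_trans h _; rewrite -natrX ltr_nat; exact: ltn_expl.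
Qed.

Lemma holo_map_mulmxr n m (L : 'M[C]_(n, m)) a : holo_map (fun v : 'rV[C]_n => v *m L) a.
Proof.
move=> j; rewrite (_ : (fun _ => _) = (fun z : 'rV[C]_n => \sum_k z 0 k * L k j)).
  by apply: holo_sum => k; apply: holoM; [exact: holo_coord | exact: holo_cst].
by apply/funext => z; rewrite mxE.
Qed.

Lemma holo_map_subl n (b a : 'rV[C]_n) : holo_map (fun v => v - b) a.
Proof.
move=> j; rewrite (_ : (fun _ => _) = (fun z : 'rV[C]_n => z 0 j - b 0 j)).
  by apply: holoB; [exact: holo_coord | exact: holo_cst].
by apply/funext => z; rewrite !mxE.
Qed.

(* H w is the fixed point of x |-> x - (F x - w) J^-1; each Picard iterate is a uniform
   limit of polynomials in w, hence so is H. *)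
Theorem inverse_function n (F : 'rV[C]_n -> 'rV[C]_n) a :
  holo_map F a -> 'J F a \in unitmx ->
  exists H : 'rV[C]_n -> 'rV[C]_n, [/\ holo_map H (F a),
    \forall x \near a, H (F x) = x & \forall w \near F a, F (H w) = w].
Proof.
move=> hF JU; have [A [hA AE /nbhs_singleton[_ JA]]] := holo_map_hadamard hF.
set J := 'J F a in JU JA; pose K := invmx J.
pose T w x : 'rV[C]_n := x - (F x - w) *m K.
(* The factorization of [F] gives T w x - T w y = (x - y) E(x, y), and [E] vanishes at (a, a): near
   [a] the map [T w] is a contraction. *)
pose E w : 'M[C]_n := 1%:M - A w *m K.
have Eaa : E (row_mx a a) = 0 by rewrite /E -JA mulmxV // subrr.
have hE i j : holo (fun w => E w i j) (row_mx a a).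
  rewrite (_ : (fun _ => _) = (fun w => (1%:M : 'M[C]_n) i j - \sum_k A w i k * K k j)).
    apply: holoB; first exact: holo_cst.
    by apply: holo_sum => k; apply: holoM; [exact: hA | exact: holo_cst].
  by apply/funext => w; rewrite !mxE.
(* A matrix with entries of modulus at most [c] contracts the sup norm by one half; [n.+1] avoids
   dividing by 0 when [n = 0]. *)
pose c : R := (2 * n.+1%:R)^-1; have c0 : 0 < c by rewrite invr_gt0 mulr_gt0.
have [rho1 rho10 HE] : exists2 r : R, 0 < r & forall w, pdisc (row_mx a a) r w ->
    F (lsubmx w) - F (rsubmx w) = (lsubmx w - rsubmx w) *m A w /\
    forall i j, abs (E w i j) <= c.
  apply/near_pdisc; apply: filterI AE _.
  suff H2 (i j : 'I_n) : \forall w \near (row_mx a a : 'rV[C]_(n + n)), abs (E w i j) <= c.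
    exact: near_forall (fun i => near_forall (H2 i)).
  have [d d0 hd] := holo_eps (hE i j) c0; apply/near_pdisc; exists d => // w /hd.
  by rewrite Eaa [X in _ - X]mxE subr0.
have [rho2 rho20 aF] := holo_polylim hF.
pose rho := Num.min rho1 rho2; have rho0 : 0 < rho by rewrite lt_min rho10.
have Tsub w x y : pdisc a rho x -> pdisc a rho y ->
    T w x - T w y = (x - y) *m E (row_mx x y) /\ forall i j, abs (E (row_mx x y) i j) <= c.
  move=> /pdisc_minl Px /pdisc_minl Py; have [] := HE _ (pdisc_row_mx Px Py).
  rewrite row_mxKl row_mxKr => FE; split=> //; rewrite /E mulmxBr mulmx1 mulmxA -FE /T.
  have -> : F x - F y = (F x - w) - (F y - w) by rewrite opprB addrA subrK.
  rewrite [in RHS]mulmxBl; set p := _ *m K; set q := _ *m K.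
  by rewrite !opprB addrACA [RHS]addrACA [- p - y]addrC.
have Tcontr w x y (d : R) : pdisc a rho x -> pdisc a rho y -> pdisc y d x ->
    pdisc (T w y) (d / 2) (T w x).
  move=> Px Py Pxy j; have [TE Eb] := Tsub w x y Px Py.
  have -> : T w x 0 j - T w y 0 j = (T w x - T w y) 0 j by rewrite !mxE.
  rewrite TE mxE; apply: le_trans (abs_sum _ _ _) _.
  have d0 : 0 <= d by apply: le_trans (abs_ge0 _) (Pxy j).
  apply: (@le_trans _ _ (\sum_(i < n) d * c)).
    apply: ler_sum => i _; rewrite normcM ler_pM ?abs_ge0 //.
    by rewrite !mxE; exact: Pxy.
  rewrite sumr_const card_ord -[leLHS]mulr_natl.
  have : n%:R <= n.+1%:R :> R by rewrite ler_nat.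
  rewrite -(ler_pM2r (mulr_gt0 (ltr0n R 2) c0)) => H.
  have : n.+1%:R * (2 * c) = 1 by rewrite mulrCA mulrA divff // gt_eqF // mulr_gt0.
  move=> H'; rewrite H' in H; have := ler_wpM2l d0 H; lra.
(* For such [w] the first iterate [T w a] is within [rho / 2] of [a]; the contraction contributes at
   most another [rho / 2], so the polydisc of radius [rho] is stable. *)
have [sig sig0 Psig] : exists2 s : R, 0 < s & forall w, pdisc (F a) s w ->
    pdisc 0 (rho / 2) ((w - F a) *m K).
  have hL : holo_map ((fun v : 'rV[C]_n => v *m K) \o (fun w => w - F a)) (F a).
    by apply: holo_map_comp; [exact: holo_map_subl | exact: holo_map_mulmxr].
  have [s s0 hs] := holo_map_eps hL (divr_gt0 rho0 (ltr0n R 2)).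
  by exists s => // w /hs; rewrite /= subrr mul0mx.
have Tstab w x : pdisc (F a) sig w -> pdisc a rho x -> pdisc a rho (T w x).
  move=> /Psig Pw Px; have Paa := pdisc_center a (ltW rho0).
  suff P1 : pdisc a (rho / 2) (T w a).
    by have := pdisc_trans P1 (Tcontr w x a rho Px Paa Px); rewrite -splitr.
  have E1 : T w a = a + (w - F a) *m K by rewrite /T -mulNmx opprB.
  move=> j; rewrite E1 mxE addrAC subrr add0r.
  by have := Pw j; rewrite [X in _ - X]mxE subr0.
have Tuniq w x y : pdisc a rho x -> pdisc a rho y -> T w x = x -> T w y = y -> x = y.
  move=> Px Py Tx Ty.
  have H k : pdisc y ((2 * rho) / 2 ^+ k) x.
    elim: k => [|k IH].
      move=> j; rewrite expr0 divr1; apply: le_trans (abs_split (a 0 j) _ _) _.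
      by rewrite (absB (a 0 j)); have := Px j; have := Py j; lra.
    by have := Tcontr w x y _ Px Py IH; rewrite Tx Ty exprS invfM mulrA mulrAC.
  apply/rowP => j; apply/eqP; rewrite -subr_eq0; apply/eqP/abs_small => e e0.
  have [k hk] := half_pow_small (2 * rho) e0; exact: (le_trans (H k j) hk).
pose X w k := iter k (T w) a.
have PX w k : pdisc (F a) sig w -> pdisc a rho (X w k).
  move=> Pw; elim: k => [|k IH]; first by apply: pdisc_center; exact: ltW.
  exact: Tstab.
have XC w k m : pdisc (F a) sig w -> pdisc (X w k) (rho / 2 ^+ k) (X w (k + m)%N).
  move=> Pw; elim: k => [|k IH]; first by rewrite expr0 divr1; exact: PX.
  rewrite addSn exprS invfM mulrA mulrAC; apply: Tcontr => //; exact: PX.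
have aX k j : polylim (F a) sig (fun w => X w k 0 j).
  elim: k j => [|k IH] j; first exact: polylim_cst.
  rewrite (_ : (fun _ => _) =
    (fun w => X w k 0 j - \sum_i (F (X w k) 0 i - w 0 i) * K i j)).
    apply: polylimB => //; apply: polylim_sum => i; apply: polylimM; last exact: polylim_cst.
    apply: polylimB; last exact: polylim_coord.
    apply: (polylim_comp (aF i)) => // w Pw; apply: pdisc_minr (PX w k Pw).
  by apply/funext => w; rewrite /= /T !mxE; under [in RHS]eq_bigr do rewrite -/(X w k);
     congr (_ - _); apply: eq_bigr => i _; rewrite !mxE.
have /choice[H0 hH0] : forall j, exists f, polylim (F a) sig f /\
    forall e : R, 0 < e -> exists N, forall k, (N <= k)%N ->
      forall w, pdisc (F a) sig w -> abs (X w k 0 j - f w) <= e.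
  move=> j; have [|f af hf] := @polylim_limseq R n (F a) sig (fun k w => X w k 0 j) (aX ^~ j).
    move=> e e0; have [N hN] := half_pow_small (rho + rho) e0.
    exists N => k l /subnKC kE /subnKC lE w Pw.
    apply: le_trans (abs_split (X w N 0 j) _ _) _; apply: (le_trans _ hN).
    rewrite mulrDl; apply: lerD.
      by have := XC w N (k - N)%N Pw j; rewrite kE.
    by rewrite absB; have := XC w N (l - N)%N Pw j; rewrite lE.
  by exists f.
pose H w : 'rV[C]_n := \row_j H0 j w.
have hH : holo_map H (F a).
  move=> j; exists sig => //; rewrite (_ : (fun _ => _) = H0 j); first exact: (hH0 j).1.
  by apply/funext => w; rewrite mxE.
have XH (e : R) : 0 < e -> forall w, pdisc (F a) sig w ->
    exists N, forall k, (N <= k)%N -> pdisc (H w) e (X w k).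
  move=> e0 w Pw; have /choice[N hN] : forall j, exists N, forall k, (N <= k)%N ->
      abs (X w k 0 j - H0 j w) <= e.
    by move=> j; have [_ /(_ e e0)[N hN]] := hH0 j; exists N => k /hN; exact.
  exists (\max_j N j) => k /bigmax_leqP hk j.
  by rewrite mxE; apply: hN; exact: hk.
have PH w : pdisc (F a) sig w -> pdisc a rho (H w).
  move=> Pw j; apply/ler_addgt0Pr => e e0; have [N hN] := XH e e0 w Pw.
  apply: le_trans (abs_split (X w N 0 j) _ _) _; rewrite addrC; apply: lerD.
    exact: PX.
  by rewrite absB; exact: hN.
have TH w : pdisc (F a) sig w -> T w (H w) = H w.
  move=> Pw; apply/rowP => j; apply/eqP; rewrite -subr_eq0; apply/eqP/abs_small => e e0.
  have e2 := divr_gt0 e0 (ltr0n R 2); have [N hN] := XH _ e2 w Pw.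
  apply: le_trans (abs_split (X w N.+1 0 j) _ _) _.
  have h1 := hN N.+1 (leqnSn _) j.
  have h2 := Tcontr w _ _ _ (PX w N Pw) (PH w Pw) (hN N (leqnn _)) j.
  rewrite absB; rewrite /= in h1 h2 *; lra.
exists H; split => //; last first.
  apply/near_pdisc; exists sig => // w /TH.
  move=> /(congr1 (fun v => H w - v)); rewrite /T opprB addrC subrK subrr.
  move=> /(congr1 (fun v => v *m J)); rewrite mul0mx mulmxKV // => /eqP.
  by rewrite subr_eq0 => /eqP.
have [d d0 hd] := holo_map_eps hF sig0.
apply/near_pdisc; exists (Num.min d rho) => [|x Px]; first by rewrite lt_min d0.
have PFx := hd x (pdisc_minl Px).
apply: (Tuniq (F x)) (TH _ PFx) _; [exact: PH | exact: pdisc_minr Px |].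
by rewrite /T subrr mul0mx subr0.
Qed.

End Inverse.

(** * Constancy along a coordinate and straightening of submersions *)

Section Submersions.
Variable R : realType.
Local Notation C := (Num.NumField.sort (R[i] : numFieldType)).
Local Notation abs := (@normc R).

Lemma holo_lipschitz n (f : 'rV[C]_n -> C) a : holo f a ->
  exists2 r : R, 0 < r & exists2 B : R, 0 <= B & forall x y d,
    pdisc a r x -> pdisc a r y -> pdisc y d x -> abs (f x - f y) <= B * d.
Proof.
move=> hf; have [Q hQ fQ] := holo_hadamard hf.
have [r r0 aQ] := holo_polylim hQ; have /near_pdisc[s s0 H] := fQ.
have /choice[B hB] : forall i, exists B : R, 0 < B /\
    forall w, pdisc (row_mx a a) r w -> abs (Q i w) <= B.
  by move=> i; have [B] := polylim_bounded (aQ i); exists B.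
exists (Num.min r s); first by rewrite lt_min r0.
exists (\sum_i B i) => [|x y d Px Py Pxy].
  by apply: sumr_ge0 => i _; have [/ltW] := hB i.
have := H _ (pdisc_row_mx (pdisc_minr Px) (pdisc_minr Py)).
rewrite row_mxKl row_mxKr => ->; apply: le_trans (abs_sum _ _ _) _.
rewrite mulr_suml; apply: ler_sum => i _; rewrite normcM mulrC.
rewrite ler_pM ?abs_ge0 //; have [_] := hB i; apply.
exact: pdisc_row_mx (pdisc_minl Px) (pdisc_minl Py).
Qed.

(** Cutting the interval into N equal steps bounds the total variation by N times D / N^2; here N is
    a power of 2. *)
Lemma quadratic_const (phi : R -> C) (D : R) :
  (forall s t, 0 <= s <= 1 -> 0 <= t <= 1 -> abs (phi s - phi t) <= D * (s - t) ^+ 2) ->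
  phi 1 = phi 0.
Proof.
move=> H; apply/eqP; rewrite -subr_eq0; apply/eqP/abs_small => e e0.
have [k hk] := half_pow_small D e0; apply: le_trans hk.
pose N := (2 ^ k)%N; have N0 : 0 < N%:R :> R by rewrite ltr0n expn_gt0.
pose u (j : nat) := phi (j%:R / N%:R).
have -> : phi 1 - phi 0 = \sum_(0 <= j < N) (u j.+1 - u j).
  by rewrite telescope_sumr // /u mul0r divff // gt_eqF.
apply: le_trans (abs_sum _ _ _) _.
apply: (@le_trans _ _ (\sum_(0 <= j < N) D * N%:R^-1 ^+ 2)).
  rewrite !big_nat; apply: ler_sum => j jN.
  have -> : N%:R^-1 = j.+1%:R / N%:R - j%:R / N%:R :> R.
    by rewrite -mulrBl -natrB // subSnn mul1r.
  apply: H; rewrite divr_ge0 ?ler0n ?(ltW N0) //= ler_pdivrMr // mul1r ler_nat //.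
  exact: ltnW.
rewrite sumr_const_nat subn0 -[leLHS]mulr_natl -natrX -/N.
have -> : N%:R * (D * N%:R^-1 ^+ 2) = D / N%:R by field; rewrite gt_eqF.
exact: lexx.
Qed.

(* The last row of the Hadamard matrix of G vanishes on the diagonal and is Lipschitz, so
   G varies quadratically, hence not at all, in the last coordinate. *)
Lemma const_last n m (G : 'rV[C]_(n + 1) -> 'rV[C]_m) b : holo_map G b ->
  (\forall v \near b, row (rshift n 0) ('J G v) = 0) ->
  exists2 r : R, 0 < r & forall x y, pdisc b r x -> pdisc b r y ->
    lsubmx x = lsubmx y -> G x = G y.
Proof.
move=> hG JG0; have [A [hA /near_pdisc[r1 r10 AE] JA]] := holo_map_hadamard hG.
have /near_pdisc[r2 r20 JA'] : \forall v \near b, forall j, A (row_mx v v) (rshift n 0) j = 0.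
  apply: filterS2 JG0 JA => v J0 [_ <-] j.
  by have := congr1 (fun M : 'rV_m => M 0 j) J0; rewrite !mxE.
have /choice[r hr] : forall j, exists r : R, 0 < r /\ forall x y,
    pdisc b r x -> pdisc b r y -> lsubmx x = lsubmx y -> G x 0 j = G y 0 j; last first.
  exists (\big[Num.min/1]_j r j) => [|x y Px Py xy].
    by apply/bigmin_gtP; split => // j _; have [] := hr j.
  apply/rowP => j; have [_] := hr j; apply => //.
    by apply: pdisc_sub Px; exact: bigmin_le.
  by apply: pdisc_sub Py; exact: bigmin_le.
move=> j; have [r3 r30 [B B0 HB]] := holo_lipschitz (hA (rshift n 0) j).
pose r := Num.min r1 (Num.min r2 r3).
have [rr1 rr2 rr3] : [/\ r <= r1, r <= r2 & r <= r3].
  by split; rewrite /r !ge_min lexx ?orbT.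
exists r; split; first by rewrite !lt_min r10 r20.
have key x y : pdisc b r x -> pdisc b r y -> lsubmx x = lsubmx y ->
    abs (G x 0 j - G y 0 j) <= B * abs (x 0 (rshift n 0) - y 0 (rshift n 0)) ^+ 2.
  move=> Px Py xy; set d := abs (x 0 _ - _).
  have lxy i : x 0 (lshift 1 i) - y 0 (lshift 1 i) = 0.
    have := congr1 (fun M : 'rV_n => M 0 i) xy; rewrite !mxE => ->; exact: subrr.
  have Pxy : pdisc y d x.
    move=> i; rewrite -(splitK i); case: (fintype.split i) => k /=.
      by rewrite lxy normc0 abs_ge0.
    by rewrite (ord1 k).
  have := AE _ (pdisc_row_mx (pdisc_sub rr1 Px) (pdisc_sub rr1 Py)).
  rewrite row_mxKl row_mxKr => /(congr1 (fun M : 'rV_m => M 0 j)).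
  rewrite 2!mxE => ->; rewrite mxE big_split_ord /= big1 ?add0r => [|i _]; last first.
    by rewrite !mxE lxy mul0r.
  rewrite big_ord1 !mxE normcM expr2 mulrCA -/d ler_wpM2l ?abs_ge0 //.
  rewrite -[A _ _ _]subr0 -(JA' y (pdisc_sub rr2 Py) j); apply: HB.
  - exact: pdisc_row_mx (pdisc_sub rr3 Px) (pdisc_sub rr3 Py).
  - exact: pdisc_row_mx (pdisc_sub rr3 Py) (pdisc_sub rr3 Py).
  - exact: pdisc_row_mx Pxy (pdisc_center _ (abs_ge0 _)).
move=> x y Px Py xy.
(* The segment from [y] to [x] stays in the polydisc by convexity and keeps the first [n]
   coordinates fixed, so [key] applies to any two of its points. *)
pose p (t : R) : 'rV[C]_(n + 1) := y + t%:C *: (x - y).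
have Pp t : 0 <= t <= 1 -> pdisc b r (p t).
  move=> /andP[t0 t1] i; rewrite !mxE.
  have -> : y 0 i + t%:C * (x 0 i - y 0 i) - b 0 i =
      t%:C * (x 0 i - b 0 i) + (1 - t)%:C * (y 0 i - b 0 i).
    by rewrite rmorphB rmorph1; ring.
  apply: le_trans (absD _ _) _; rewrite !normcM !abs_real ger0_norm // ger0_norm ?subr_ge0 //.
  have := ler_wpM2l t0 (Px i); have t1' : 0 <= 1 - t by lra.
  have := ler_wpM2l t1' (Py i); lra.
have -> : x = p 1 by rewrite /p scale1r addrC subrK.
have -> : y = p 0 by rewrite /p scale0r addr0.
apply: (@quadratic_const (fun t => G (p t) 0 j)
  (B * abs (x 0 (rshift n 0) - y 0 (rshift n 0)) ^+ 2)) => s t s01 t01.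
apply: le_trans (key _ _ (Pp s s01) (Pp t t01) _) _.
  apply/rowP => i; rewrite !mxE.
  have -> : x 0 (lshift 1 i) = y 0 (lshift 1 i).
    by have := congr1 (fun M : 'rV_n => M 0 i) xy; rewrite !mxE.
  by rewrite subrr !mulr0.
rewrite -mulrA ler_wpM2l // !mxE.
set yy := y 0 _; set xx := x 0 _.
have -> : yy + s%:C * (xx - yy) - (yy + t%:C * (xx - yy)) = (s - t)%:C * (xx - yy).
  by rewrite rmorphB; ring.
by rewrite normcM exprMn abs_real real_normK ?num_real // mulrC.
Qed.

(** The [n] columns of [B] cannot span a space of dimension n + 1; a standard basis vector outside
    of their span completes them. *)
Lemma row_full_complement n (B : 'M[C]_(n + 1, n)) : row_full B ->
  exists e : 'cV[C]_(n + 1), row_mx B e \in unitmx.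
Proof.
move=> Bf; have rB : \rank B^T = n by rewrite mxrank_tr; exact/eqP.
have [i iB] : exists i, ~~ (row i (1%:M : 'M[C]_(n + 1)) <= B^T)%MS.
  apply/existsP; rewrite -negb_forall; apply/negP => /forallP H.
  have /mxrankS : (1%:M <= B^T)%MS by apply/row_subP.
  by rewrite mxrank1 rB addn1 ltnn.
set v := row i _ in iB.
exists v^T; rewrite -unitmx_tr tr_row_mx trmxK -row_free_unit -row_leq_rank.
have : (B^T < col_mx B^T v)%MS.
  rewrite /ltmx -!addsmxE addsmxSl /=; apply: contra iB.
  by move=> H; apply: submx_trans (addsmxSr _ _) H.
move=> /rank_ltmx; rewrite rB; apply: leq_trans; by rewrite addn1.
Qed.

Lemma jacobian_mul n m k (f : 'rV[C]_n -> 'rV[C]_m) (L : 'M[C]_(m, k)) a :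
  holo_map f a -> 'J (fun x => f x *m L) a = 'J f a *m L.
Proof.
move=> hf; rewrite (holo_jacobian_comp hf (holo_map_mulmxr L (f a))).
by have [_ ->] := jacobian_mulmxr L (f a).
Qed.

(** A linear form complementing the derivative completes [f] to a map with invertible Jacobian. In
    the resulting coordinates [f] is the projection that forgets the last one. *)
Lemma submersion_chart n (f : 'rV[C]_(n + 1) -> 'rV[C]_n) a :
  holo_map f a -> row_full ('J f a) ->
  exists (e : 'cV[C]_(n + 1)) (H : 'rV[C]_(n + 1) -> 'rV[C]_(n + 1)),
    let F x := row_mx (f x) (x *m e) in
    [/\ holo_map F a, holo_map H (F a),
        \forall x \near a, H (F x) = x & \forall w \near F a, F (H w) = w].
Proof.
move=> hf /row_full_complement[e Je].
pose F x := row_mx (f x) (x *m e).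
have hF : holo_map F a.
  move=> i; rewrite -(splitK i); case: (fintype.split i) => j /=.
    rewrite (_ : (fun _ => _) = (fun z => f z 0 j)) //.
    by apply/funext => z; rewrite row_mxEl.
  rewrite (_ : (fun _ => _) = (fun z : 'rV[C]_(n + 1) => (z *m e) 0 j)).
    exact: holo_map_mulmxr.
  by apply/funext => z; rewrite row_mxEr.
have JF : 'J F a = row_mx ('J f a) e.
  rewrite -[LHS]hsubmxK; congr row_mx.
    pose L : 'M[C]_(n + 1, n) := col_mx 1%:M 0.
    have -> : lsubmx ('J F a) = 'J F a *m L.
      by rewrite -{2}['J F a]hsubmxK mul_row_col mulmx1 mulmx0 addr0.
    rewrite -(jacobian_mul L hF) (_ : (fun x => F x *m L) = f) //.
    by apply/funext => x; rewrite /F mul_row_col mulmx1 mulmx0 addr0.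
  pose L : 'M[C]_(n + 1, 1) := col_mx 0 1%:M.
  have -> : rsubmx ('J F a) = 'J F a *m L.
    by rewrite -{2}['J F a]hsubmxK mul_row_col mulmx1 mulmx0 add0r.
  rewrite -(jacobian_mul L hF) (_ : (fun x => F x *m L) = (fun x => x *m e)).
    by have [_ ->] := jacobian_mulmxr e a.
  by apply/funext => x; rewrite /F mul_row_col mulmx1 mulmx0 add0r.
have [|H [H1 H2 H3]] := inverse_function hF; first by rewrite JF.
by exists e, H.
Qed.

Lemma holo_det n m (A : 'rV[C]_n -> 'M[C]_m) a :
  (forall i j, holo (fun z => A z i j) a) -> holo (fun z => \det (A z)) a.
Proof.
move=> hA; apply: holo_sum => s; apply: holoM; first exact: holo_cst.
by apply: holo_prod => i.
Qed.

End Submersions.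

(** * Linear algebra of pullbacks *)

Section Pull.
Variable L : comUnitRingType.

Lemma pull_mul n m k (J : 'M[L]_(n, m)) (K : 'M[L]_(m, k)) (A : 'M[L]_k) :
  pull (J *m K) A = pull J (pull K A).
Proof. by rewrite /pull trmx_mul !mulmxA. Qed.

Lemma pull1 n (A : 'M[L]_n) : pull 1%:M A = A.
Proof. by rewrite /pull trmx1 mulmx1 mul1mx. Qed.

(** Up to the unit [S *m J], the matrix [S] is a left inverse of [J]; pulling back along it recovers
    the form. *)
Lemma pull_inj n m (S : 'M[L]_(m, n)) (J : 'M[L]_(n, m)) : S *m J \in unitmx ->
  injective (pull J).
Proof.
move=> SJ A B AB; rewrite -[A]pull1 -[B]pull1 -(mulVmx SJ) !pull_mul.
by rewrite AB.
Qed.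

End Pull.

(** * Identity theorem and factorization through a submersion *)

Section HolomorphicExtension.
Variable R : realType.
Local Notation C := (Num.NumField.sort (R[i] : numFieldType)).
Local Notation abs := (@normc R).

Lemma near_near n (a : 'rV[C]_n) (P : 'rV[C]_n -> Prop) :
  (\forall z \near a, P z) -> \forall z \near a, \forall w \near z, P w.
Proof.
move=> /near_pdisc[r r0 H]; have r2 : 0 < r / 2 by exact: divr_gt0.
apply/near_pdisc; exists (r / 2) => // z Pz; apply/near_pdisc; exists (r / 2) => // w Pw.
by apply: H; rewrite [r]splitr; exact: pdisc_trans Pz Pw.
Qed.

Lemma jacobian_id n (a : 'rV[C]_n) : 'J (@id 'rV[C]_n) a = 1%:M.
Proof.
have [_] := jacobian_mulmxr (1%:M : 'M[C]_n) a.
by rewrite (_ : (fun v => _) = id) //; apply/funext => v; rewrite mulmx1.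
Qed.

(** A left inverse [S] of the Jacobian at [a] serves at all nearby points: the determinant of
    [S *m 'J f x] is holomorphic in [x] and equals 1 at [a], so it stays within one half of 1. *)
Lemma row_full_near n m (f : 'rV[C]_n -> 'rV[C]_m) a : holo_map f a ->
  row_full ('J f a) -> exists S : 'M[C]_(m, n), \forall x \near a, S *m 'J f x \in unitmx.
Proof.
move=> hf /row_fullP[S SJ]; exists S.
have hd : holo (fun x => \det (S *m 'J f x)) a.
  apply: holo_det => i j.
  rewrite (_ : (fun _ => _) = (fun z => \sum_k S i k * 'J f z k j)).
    by apply: holo_sum => k; apply: holoM; [exact: holo_cst | exact: holo_jacobian].
  by apply/funext => z; rewrite mxE.
have [d d0 H] := holo_eps hd (divr_gt0 (@ltr01 R) (ltr0n R 2)).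
apply/near_pdisc; exists d => // z /H h; rewrite unitmxE unitfE.
have contr (u w : C) : u = 0 -> w = 1 -> abs (u - w) <= 1 / 2 -> False.
  by move=> -> ->; rewrite sub0r absN normc1; lra.
by apply/eqP => z0; apply: (contr _ _ z0 _ h); rewrite SJ det1.
Qed.

(** The identity theorem is applied upstairs to phi o f - psi o f; the local section [H \o s] of [f]
    brings the conclusion down. *)
Lemma submersion_identity n (f : 'rV[C]_(n + 1) -> 'rV[C]_n) (phi psi : 'rV[C]_n -> C)
    (a : 'rV[R]_(n + 1)) :
  holo_map f (cplx a) -> row_full ('J f (cplx a)) ->
  holo phi (f (cplx a)) -> holo psi (f (cplx a)) ->
  (\forall x \near a, phi (f (cplx x)) = psi (f (cplx x))) ->
  \forall z \near f (cplx a), phi z = psi z.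
Proof.
move=> hf Jf hphi hpsi E; have [e [H [hF hH HF FH]]] := submersion_chart hf Jf.
set F := (X in holo_map X _) in hF hH HF FH.
have Ha : H (F (cplx a)) = cplx a := nbhs_singleton HF.
have E' : \forall x \near cplx a, phi (f x) - psi (f x) = 0.
  apply: (@holo_identity R _ (fun x => phi (f x) - psi (f x)) a).
    by apply: holoB; [exact: (holo_comp hf hphi) | exact: (holo_comp hf hpsi)].
  by apply: filterS E => x ->; rewrite subrr.
pose s z : 'rV[C]_(n + 1) := row_mx z (cplx a *m e).
have hs : holo_map s (f (cplx a)).
  move=> i; rewrite -(splitK i); case: (fintype.split i) => j /=.
    rewrite (_ : (fun _ => _) = (fun z : 'rV[C]_n => z 0 j)); first exact: holo_coord.
    by apply/funext => z; rewrite row_mxEl.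
  rewrite (_ : (fun _ => _) = (fun=> (cplx a *m e) 0 j)); first exact: holo_cst.
  by apply/funext => z; rewrite row_mxEr.
have FHs : \forall z \near f (cplx a), F (H (s z)) = s z by exact: (near_map hs FH).
have hHs : holo_map (H \o s) (f (cplx a)) by exact: holo_map_comp.
have Es : \forall z \near f (cplx a), phi (f (H (s z))) - psi (f (H (s z))) = 0.
  by apply: (near_map (h := H \o s) (P := fun x => phi (f x) - psi (f x) = 0) hHs);
    rewrite /= Ha.
apply: filterS2 FHs Es => z /(congr1 lsubmx); rewrite !row_mxKl => -> /eqP.
by rewrite subr_eq0 => /eqP.
Qed.

(* Phi z = g (H (z, w0)), where H inverts x |-> (f x, x e): the derivative of H (z, w) in w
   spans the kernel of df, hence lies in the kernel of dg. *)
Lemma local_extension n (f g : 'rV[C]_(n + 1) -> 'rV[C]_n) (A1 A2 : 'rV[C]_n -> 'M[C]_n) a :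
  holo_map f a -> holo_map g a -> row_full ('J f a) -> row_full ('J g a) ->
  (\forall z \near g a, A2 z \in unitmx) ->
  (\forall x \near a, pull ('J f x) (A1 (f x)) = pull ('J g x) (A2 (g x))) ->
  exists Phi : 'rV[C]_n -> 'rV[C]_n, [/\ holo_map Phi (f a),
    \forall x \near a, Phi (f x) = g x &
    \forall z \near f a, pull ('J Phi z) (A2 (Phi z)) = A1 z].
Proof.
move=> hf hg Jf Jg A2u E; have [e [H [hF hH HF FH]]] := submersion_chart hf Jf.
set F := (X in holo_map X _) in hF hH HF FH.
have Ha : H (F a) = a := nbhs_singleton HF.
have [S1 S1u] := row_full_near hf Jf; have [S2 S2u] := row_full_near hg Jg.
have A2g := near_map hg A2u.
have hgH : holo_map (g \o H) (F a) by apply: holo_map_comp => //; rewrite Ha.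
have toF (P : 'rV[C]_(n + 1) -> Prop) : (\forall x \near a, P x) ->
    \forall w \near F a, P (H w).
  by rewrite -{1}Ha; exact: near_map.
have n1 : \forall x \near a, [/\ holo_map F x, holo_map f x & holo_map g x].
  apply: filterS3 (holo_map_near hF) (holo_map_near hf) (holo_map_near hg) => x h1 h2 h3.
  exact: And3 h1 h2 h3.
have n2 : \forall x \near a, [/\ pull ('J f x) (A1 (f x)) = pull ('J g x) (A2 (g x)),
    S2 *m 'J g x \in unitmx & A2 (g x) \in unitmx].
  by apply: filterS3 E S2u A2g => x h1 h2 h3; exact: And3 h1 h2 h3.
pose L : 'M[C]_(n + 1, n) := col_mx 1%:M 0.
have FL : (fun x => F x *m L) = f.
  by apply/funext => x; rewrite /F mul_row_col mulmx1 mulmx0 addr0.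
have last0 : \forall w \near F a, row (rshift n 0) ('J (g \o H) w) = 0.
  have n4 : \forall w \near F a, [/\ holo_map F (H w), holo_map f (H w) & holo_map g (H w)] /\
      [/\ pull ('J f (H w)) (A1 (f (H w))) = pull ('J g (H w)) (A2 (g (H w))),
      S2 *m 'J g (H w) \in unitmx & A2 (g (H w)) \in unitmx].
    exact: filterI (toF _ n1) (toF _ n2).
  apply: filterS3 n4 (near_near FH) (holo_map_near hH) => w.
  move=> [[hFw hfw hgw] [Ew Su Au]] FHw hHw.
  rewrite (holo_jacobian_comp hHw hgw) row_mul; set v := row _ _; set x := H w in hFw hfw hgw Ew Su Au *.
  (* As F o H is the identity, [v] is mapped to the last basis vector, whose components along [f]
     are 0; hence [vf]. *)
  have vF : v *m 'J F x = row (rshift n 0) 1%:M.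
    rewrite -row_mul -(holo_jacobian_comp hHw hFw).
    by rewrite (eq_jacobian (g := id) (holo_map_comp hHw hFw) FHw) jacobian_id.
  have vf : v *m 'J f x = 0.
    by rewrite -FL (jacobian_mul L hFw) mulmxA vF -row_mul mul1mx rowKd row0.
  (* [v] is in the kernel of the common form. Multiplying by the transpose of [S2] produces the
     invertible transpose of [S2 *m 'J g x]; cancelling it and [A2] leaves [v *m 'J g x = 0]. *)
  have : v *m pull ('J g x) (A2 (g x)) = 0 by rewrite -Ew /pull !mulmxA vf !mul0mx.
  move=> /(congr1 (fun M => M *m S2^T)); rewrite mul0mx /pull -!mulmxA -trmx_mul.
  rewrite !mulmxA => /(canRL (mulmxK _)); rewrite unitmx_tr => /(_ Su).
  by rewrite mul0mx => /(canRL (mulmxK Au)); rewrite mul0mx.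
have [r r0 Hr] := const_last hgH last0.
pose s z : 'rV[C]_(n + 1) := row_mx z (a *m e).
have hs : holo_map s (f a).
  move=> i; rewrite -(splitK i); case: (fintype.split i) => j /=.
    rewrite (_ : (fun _ => _) = (fun z : 'rV[C]_n => z 0 j)); first exact: holo_coord.
    by apply/funext => z; rewrite row_mxEl.
  rewrite (_ : (fun _ => _) = (fun=> (a *m e) 0 j)); first exact: holo_cst.
  by apply/funext => z; rewrite row_mxEr.
have hHs : holo_map (H \o s) (f a) by apply: holo_map_comp.
have hPhi : holo_map (g \o (H \o s)) (f a) by apply: holo_map_comp => //=; rewrite Ha.
(* [F x] and [s (f x)] differ in their last coordinate only, on which [g \o H] does not depend. *)
have PhiE : \forall x \near a, (g \o (H \o s)) (f x) = g x.
  have sF : \forall x \near a, pdisc (F a) r (s (f x)) by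
    apply: (near_map (P := fun z => pdisc (F a) r (s z)) hf);
    apply: (near_map (P := pdisc (F a) r) hs); apply/near_pdisc; exists r.
  have FF : \forall x \near a, pdisc (F a) r (F x) by
    apply: (near_map (P := pdisc (F a) r) hF); apply/near_pdisc; exists r.
  apply: filterS3 sF FF HF => x s1 F1 HFx.
  have := Hr _ _ s1 F1; rewrite /= HFx; apply.
  by rewrite !row_mxKl.
exists (g \o (H \o s)); split=> //.
have toS (P : 'rV[C]_(n + 1) -> Prop) : (\forall x \near a, P x) ->
    \forall z \near f a, P (H (s z)).
  by move=> nP; apply: (near_map (P := P) hHs); rewrite /= Ha.
have n5 : \forall z \near f a,
    [/\ holo_map F (H (s z)), holo_map f (H (s z)) & holo_map g (H (s z))] /\
    pull ('J f (H (s z))) (A1 (f (H (s z)))) = pull ('J g (H (s z))) (A2 (g (H (s z)))).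
  exact: filterI (toS _ n1) (toS _ E).
have n6 : \forall z \near f a,
    (\forall y \near H (s z), (g \o (H \o s)) (f y) = g y) /\
    S1 *m 'J f (H (s z)) \in unitmx.
  exact: filterI (toS _ (near_near PhiE)) (toS _ S1u).
have n7 : \forall z \near f a, F (H (s z)) = s z /\ holo_map (g \o (H \o s)) z.
  exact: filterI (near_map hs FH) (holo_map_near hPhi).
apply: filterS3 n5 n6 n7 => z [[_ hfz hgz] Ez] [Phiz Su] [FHz hPz].
set x := H (s z) in hfz hgz Ez Phiz Su.
have fx : f x = z by have := congr1 lsubmx FHz; rewrite !row_mxKl.
have gx : (g \o (H \o s)) z = g x by rewrite -[LHS](nbhs_singleton Phiz) fx.
have Jgx : 'J g x = 'J f x *m 'J (g \o (H \o s)) z.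
  rewrite -{1}fx -(holo_jacobian_comp hfz); last by rewrite fx; exact: hPz.
  by apply: (eq_jacobian hgz); apply: filterS Phiz => y Ey; exact: esym Ey.
by move: Ez; rewrite Jgx fx -gx pull_mul => /(pull_inj Su) ->.
Qed.

End HolomorphicExtension.

(** * Germs of maps between manifolds *)

Section Charts.
Variables (K : numFieldType) (n : nat) (X : manifold K n).
Implicit Types (c : chart K n X) (p q : X).

Lemma chart_invK c p q : atlas X c -> cdom c q -> chart_inv c p (c q) = q.
Proof.
move=> Xc cq; rewrite /chart_inv; case: xgetP => [q' _ [cq' e]|/(_ q)[]//].
exact: atlas_inj cq' cq e.
Qed.

Lemma near_cdom c p : atlas X c -> cdom c p -> \forall q \near p, cdom c q.
Proof. by move=> Xc cp; apply: open_nbhs_nbhs; split => //; exact: atlas_open. Qed.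

(** Moves a property of points of the manifold to coordinates. [p'] is arbitrary, being only the
    default value of [chart_inv]. *)
Lemma near_chart_inv c p p' (P : X -> Prop) : atlas X c -> cdom c p ->
  (\forall q \near p, P q) ->
  \forall z \near c p, exists q, [/\ cdom c q, c q = z, chart_inv c p' z = q & P q].
Proof.
move=> Xc cp nP.
pose V := [set q | P q]° `&` cdom c.
have oV : open V by apply: openI; [exact: open_interior | exact: atlas_open].
have ocV : open (c @` V) by apply: atlas_open_map => // q [].
have Vp : V p by split.
have : nbhs (c p) (c @` V) by apply: open_nbhs_nbhs; split => //; exists p.
apply: filterS => _ [q [Pq cq] <-]; exists q; split => //.
  exact: chart_invK.
exact: interior_subset Pq.
Qed.

Lemma near_chart c p (Q : 'rV[K]_n -> Prop) : atlas X c -> cdom c p ->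
  (\forall z \near c p, Q z) -> \forall q \near p, Q (c q).
Proof. by move=> Xc cp nQ; exact: atlas_continuous nQ. Qed.

End Charts.

(** * Holomorphic germs in charts: independence of charts and composition *)

Section AnalyticMaps.
Variable R : realType.
Local Notation C := (Num.NumField.sort (R[i] : numFieldType)).

Section TwoManifolds.
Variables (n m : nat) (X : manifold R[i] n) (Y : manifold R[i] m).
Implicit Types (c : chart R[i] n X) (d : chart R[i] m Y) (s : X -> Y) (x : X).

(** The condition of [analytic_map] at one point. A germ is handled as a total function of which
    only the values near the point matter. *)
Definition analytic_at_pt s x : Prop := forall c d, atlas X c -> atlas Y d ->
  cdom c x -> cdom d (s x) ->
  (\forall z \near c x, cdom d (s (chart_inv c x z))) /\
  (forall j, analytic_at (fun z => coord_expr c d s x z 0 j) (c x)).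

(** Unlike [coord_expr], which depends on the base point, the same [h] serves at all points near
    [x]. *)
Definition represents c d s x (h : 'rV[C]_n -> 'rV[C]_m) : Prop :=
  holo_map h (c x) /\ \forall q \near x, cdom d (s q) /\ d (s q) = h (c q).

Lemma analytic_represents c d s x : atlas X c -> atlas Y d -> cdom c x ->
  cdom d (s x) -> analytic_at_pt s x -> exists h, represents c d s x h.
Proof.
move=> Xc Yd cx dx /(_ c d Xc Yd cx dx)[sd sa]; exists (coord_expr c d s x).
split=> [j|]; first exact/analytic_holo.
have := near_chart Xc cx sd; apply: filterS2 (near_cdom Xc cx) => q cq.
by rewrite /coord_expr chart_invK.
Qed.

Lemma represents_jac c d s x h : atlas X c -> cdom c x ->
  represents c d s x h -> jac c d s x = 'J h (c x).
Proof.
move=> Xc cx [hh sE]; apply/esym; apply: (eq_jacobian hh).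
have := near_chart_inv x Xc cx sE; apply: filterS => z [q [cq <- e [_ Ed]]].
by rewrite /coord_expr e Ed.
Qed.

Lemma represents_near c d s x h : atlas X c -> cdom c x ->
  represents c d s x h -> \forall x' \near x, represents c d s x' h.
Proof.
move=> Xc cx [hh sE]; have := near_chart Xc cx (holo_map_near hh).
by apply: filterS2 (nbhs_interior sE) => x' H1 H2; split.
Qed.

End TwoManifolds.

Lemma analytic_id n (X : manifold R[i] n) x : analytic_at_pt (@id X) x.
Proof. by move=> c d Xc Xd cx dx; exact: (atlas_analytic Xc Xd cx dx). Qed.

Lemma represents_comp n m k (X : manifold R[i] n) (Y : manifold R[i] m)
    (Z : manifold R[i] k) c d e (s : X -> Y) (t : Y -> Z) x h g :
  atlas Y d -> continuous_at x s ->
  represents c d s x h -> represents d e t (s x) g -> represents c e (t \o s) x (g \o h).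
Proof.
move=> Yd sc [hh sE] [hg tE]; have [ds Ed] := nbhs_singleton sE.
split; first by apply: holo_map_comp => //; rewrite -Ed.
by have := sc _ tE; apply: filterS2 sE => q [_ Eq] [H1 H2]; split=> //=; rewrite -Eq.
Qed.

Section ChartIndependence.
Variables (n m : nat) (X : manifold R[i] n) (Y : manifold R[i] m).
Implicit Types (c : chart R[i] n X) (d : chart R[i] m Y) (s : X -> Y) (x : X).

Lemma represents_continuous c d s x h : atlas X c -> atlas Y d -> cdom c x ->
  represents c d s x h -> continuous_at x s.
Proof.
move=> Xc Yd cx [hh sE] V sV; have [ds Ed] := nbhs_singleton sE.
have nV := near_chart_inv (s x) Yd ds sV.
rewrite Ed in nV; have := near_chart Xc cx (near_map hh nV).
apply: filterS2 sE => q [dq <-] [y [dy E _ Vy]].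
by rewrite /preimage /= -(atlas_inj Yd dy dq E).
Qed.

(** One pair of charts is enough: any other is reached by composing with transition maps, which
    represent the identity. *)
Lemma represents_analytic c d s x h : atlas X c -> atlas Y d -> cdom c x ->
  represents c d s x h -> analytic_at_pt s x.
Proof.
move=> Xc Yd cx sh c' d' Xc' Yd' c'x d'x.
have sc := represents_continuous Xc Yd cx sh.
have ds : cdom d (s x) by have [_ /nbhs_singleton[]] := sh.
have [t ht] := analytic_represents Xc' Xc c'x cx (@analytic_id _ X x).
have [t' ht'] := analytic_represents Yd Yd' ds d'x (@analytic_id _ Y (s x)).
have ch : continuous_at x (@id X) by move=> A.
have [h1 h2] := represents_comp Yd sc (represents_comp Xc ch ht sh) ht'.
have := near_chart_inv x Xc' c'x h2 => nz; split=> [|j].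
  by apply: filterS nz => z [q [_ _ -> []]].
apply/analytic_holo/(holo_ext _ (h1 j)).
by apply: filterS nz => z [q [_ <- e [_ E]]]; rewrite /coord_expr e -E.
Qed.

Lemma analytic_exists s x : analytic_at_pt s x -> exists c d h,
  [/\ atlas X c, atlas Y d, cdom c x, cdom d (s x) & represents c d s x h].
Proof.
move=> sx; have [c Xc cx] := atlas_cover x; have [d Yd dx] := atlas_cover (s x).
by have [h hh] := analytic_represents Xc Yd cx dx sx; exists c, d, h.
Qed.

Lemma analytic_continuous s x : analytic_at_pt s x -> continuous_at x s.
Proof.
move=> /analytic_exists[c [d [h [Xc Yd cx dx sh]]]].
exact: represents_continuous sh.
Qed.

Lemma represents_ext c d s s' x h : (\forall q \near x, s q = s' q) ->
  represents c d s x h -> represents c d s' x h.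
Proof. by move=> ss' [hh sE]; split=> //; apply: filterS2 ss' sE => q ->. Qed.

Lemma analytic_ext s s' x : (\forall q \near x, s q = s' q) ->
  analytic_at_pt s x -> analytic_at_pt s' x.
Proof.
move=> ss' /analytic_exists[c [d [h [Xc Yd cx dx sh]]]].
exact: represents_analytic (represents_ext ss' sh).
Qed.

End ChartIndependence.

Section Composition.
Variables (n m k : nat) (X : manifold R[i] n) (Y : manifold R[i] m) (Z : manifold R[i] k).
Variables (s : X -> Y) (t : Y -> Z) (x : X).
Hypotheses (sx : analytic_at_pt s x) (tx : analytic_at_pt t (s x)).

Lemma analytic_comp : analytic_at_pt (t \o s) x.
Proof.
have [c [d [h [Xc Yd cx dx sh]]]] := analytic_exists sx.
have [e Ze ex] := atlas_cover (t (s x)).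
have [g tg] := analytic_represents Yd Ze dx ex tx.
apply: represents_analytic (represents_comp Yd (analytic_continuous sx) sh tg) => //.
Qed.

Lemma jac_comp c d e : atlas X c -> atlas Y d -> atlas Z e ->
  cdom c x -> cdom d (s x) -> cdom e (t (s x)) ->
  jac c e (t \o s) x = jac c d s x *m jac d e t (s x).
Proof.
move=> Xc Yd Ze cx dx ex.
have [h sh] := analytic_represents Xc Yd cx dx sx.
have [g tg] := analytic_represents Yd Ze dx ex tx.
have stc := represents_comp Yd (analytic_continuous sx) sh tg.
rewrite (represents_jac Xc cx stc) (represents_jac Xc cx sh) (represents_jac Yd dx tg).
have [hh sE] := sh; have [_ Ed] := nbhs_singleton sE; have [hg _] := tg.
by rewrite (holo_jacobian_comp hh); rewrite -Ed.
Qed.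

End Composition.

End AnalyticMaps.

(** * Holomorphic extension of a real-analytic map read in charts *)

Section Complexification.
Variable R : realType.
Local Notation C := (Num.NumField.sort (R[i] : numFieldType)).
Variables (k n : nat) (M : manifold R k) (X : manifold R[i] n).

Lemma cvec_realify (v : 'rV[C]_n) :
  cvec (row_mx (map_mx (@complex.Re R) v) (map_mx (@complex.Im R) v)) = v.
Proof.
rewrite /cvec row_mxKl row_mxKr; apply/rowP => j; rewrite !mxE.
by case: (v 0 j).
Qed.

Lemma complexify (phi : M -> X) p c d :
  analytic_map (atlas M) (@real_atlas R n X) phi ->
  atlas M c -> atlas X d -> cdom c p -> cdom d (phi p) ->
  exists2 F : 'rV[C]_k -> 'rV[C]_n, holo_map F (cplx (c p)) &
    \forall q \near p, [/\ cdom d (phi q), d (phi q) = F (cplx (c q)) &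
      complex_jac (jac c (realify d) phi q) = 'J F (cplx (c q))].
Proof.
move=> aphi Mc Xd cp dp.
have [sd ua] := aphi p c (realify d) Mc (ex_intro2 _ _ d Xd erefl) cp dp.
have [F hF FE] := analytic_real_holo_map ua; exists F => //.
have := near_chart Mc cp FE; have := near_chart Mc cp sd.
apply: filterS3 (near_cdom Mc cp) => q cq dq [Fq JFq].
rewrite chart_invK // in dq; split=> //.
  by rewrite Fq /coord_expr chart_invK // cvec_realify.
apply/esym/JFq; have := near_chart_inv q Mc cq (near_cdom Mc cq).
apply: filterS => x [q' [cq' <- e _]]; rewrite /coord_expr e.
by rewrite chart_invK.
Qed.

End Complexification.

(** * Two-forms in dimension 2 and unimodular germs *)

Section UnimodularGerms.
Variable R : realType.
Local Notation C := (Num.NumField.sort (R[i] : numFieldType)).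

(** The entries of the pullback are [A 0 1] times 2 x 2 minors of [J], which all vanish if the two
    columns of [J] are dependent. *)
Lemma pull_antisym n (J : 'M[C]_(n, 2)) (A : 'M[C]_2) : A^T = - A ->
  pull J A != 0 -> row_full J.
Proof.
move=> At; apply: contraR => Jf.
have aE i j : A i j = - A j i by have := congr1 (fun B : 'M[C]_2 => B j i) At; rewrite !mxE.
have a0 i : A i i = 0.
  have /eqP := aE i i; rewrite -addr_eq0 -mulr2n -mulr_natr mulf_eq0.
  by rewrite pnatr_eq0 orbF => /eqP.
have e0 : ord0 = 0 :> 'I_2 by exact: val_inj.
have e1 : lift ord0 ord0 = 1 :> 'I_2 by exact: val_inj.
have [r rJ r0] : exists2 r : 'rV[C]_2, r *m J^T = 0 & r != 0.
  have : kermx J^T != 0.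
    by rewrite kermx_eq0 /row_free mxrank_tr; exact: Jf.
  move=> /rowV0Pn[r rk r0]; exists r => //; exact/sub_kermxP.
have rE l : r 0 0 * J l 0 + r 0 1 * J l 1 = 0.
  have := congr1 (fun v : 'rV_n => v 0 l) rJ; rewrite !mxE !big_ord_recl big_ord0 addr0.
  by rewrite !mxE e0 e1.
apply/eqP/matrixP => i l; rewrite /pull !mxE.
have minor : J i 0 * J l 1 - J i 1 * J l 0 = 0.
  have [r00|r00] := eqVneq (r 0 0) 0.
    have r01 : r 0 1 != 0.
      apply: contra r0 => /eqP r01; apply/eqP/rowP => j; rewrite mxE.
      by case: j => [[|[|//]] jp]; [rewrite -r00 | rewrite -r01]; congr (r _ _); exact: val_inj.
    have z j : J j 1 = 0.
      by have /eqP := rE j; rewrite r00 mul0r add0r mulf_eq0 (negbTE r01) => /eqP.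
    by rewrite !z mulr0 mul0r subrr.
  have z j : J j 0 = - (r 0 1 / r 0 0) * J j 1.
    apply: (mulfI r00); have /eqP := rE j; rewrite addr_eq0 => /eqP ->.
    by rewrite mulrA mulrN mulrCA divff // mulr1 mulNr.
  by rewrite !z; ring.
under eq_bigr do rewrite !mxE.
rewrite !big_ord_recl !big_ord0 !addr0.
rewrite !e0 !e1 !a0 (aE 1 0) !mulr0 add0r addr0.
have -> : J i 1 * - A 0 1 * J l 0 + J i 0 * A 0 1 * J l 1 =
  A 0 1 * (J i 0 * J l 1 - J i 1 * J l 0) by ring.
by rewrite minor mulr0.
Qed.

Lemma antisym_unit (A : 'M[C]_2) : A^T = - A -> A != 0 -> A \in unitmx.
Proof.
move=> At A0.
have aE i j : A i j = - A j i by have := congr1 (fun B : 'M[C]_2 => B j i) At; rewrite !mxE.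
have a0 i : A i i = 0.
  have /eqP := aE i i; rewrite -addr_eq0 -mulr2n -mulr_natr mulf_eq0.
  by rewrite pnatr_eq0 orbF => /eqP.
have e0 : ord0 = 0 :> 'I_2 by exact: val_inj.
have e1 : lift ord0 ord0 = 1 :> 'I_2 by exact: val_inj.
have [a01|a01] := eqVneq (A 0 1) 0; last first.
  rewrite -row_free_unit -kermx_eq0; apply/rowV0P => v /sub_kermxP vA.
  have v0 : v 0 0 = 0.
    have /eqP := congr1 (fun B : 'rV[C]_2 => B 0 1) vA; rewrite !mxE !big_ord_recl big_ord0.
    rewrite !e0 !e1 a0 mulr0 !addr0 mulf_eq0 (negbTE a01) orbF => /eqP //.
  have v1 : v 0 1 = 0.
    have /eqP := congr1 (fun B : 'rV[C]_2 => B 0 0) vA; rewrite !mxE !big_ord_recl big_ord0.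
    rewrite !e0 !e1 a0 mulr0 add0r addr0 (aE 1 0) mulf_eq0 oppr_eq0 (negbTE a01) orbF => /eqP //.
  apply/rowP => j; rewrite mxE.
  by case: j => [[|[|//]] jp]; [rewrite -[RHS]v0 | rewrite -[RHS]v1]; congr (v _ _); exact: val_inj.
case/eqP: A0.
apply/matrixP => i j; rewrite mxE.
case: i => [[|[|//]] ip]; case: j => [[|[|//]] jp].
- by rewrite -(a0 0); congr (A _ _); exact: val_inj.
- by rewrite -a01; congr (A _ _); exact: val_inj.
- by rewrite -oppr0 -a01 -aE; congr (A _ _); exact: val_inj.
- by rewrite -(a0 1); congr (A _ _); exact: val_inj.
Qed.

(** The cocycle computation behind independence of charts: [J1] and [J3] are Jacobians of chart
    changes at the source and at the target, and [map_mx id] comes from [is_2form] with [iota] the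
    identity. *)
Lemma pull_chain n (J J' J1 J2 J3 A A' B B' : 'M[C]_n) :
  J' = J1 *m J2 -> J = J' *m J3 -> A' = pull (map_mx id J1) A ->
  B' = pull (map_mx id J3) B -> pull J2 B' = A -> pull J B = A'.
Proof.
have mid (D : 'M[C]_n) : map_mx id D = D by apply/matrixP => i j; rewrite mxE.
by rewrite !mid => -> -> -> -> <-; rewrite !pull_mul.
Qed.

Definition unimodular_at (X1 X2 : unimodular_surface R) (s : X1 -> X2) x : Prop :=
  forall c d, atlas X1 c -> atlas X2 d -> cdom c x -> cdom d (s x) ->
    pull (jac c d s x) (vol d (s x)) = vol c x.

Lemma unimodular_charts (X1 X2 : unimodular_surface R) (s : X1 -> X2) x c d :
  atlas X1 c -> atlas X2 d -> cdom c x -> cdom d (s x) -> analytic_at_pt s x ->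
  pull (jac c d s x) (vol d (s x)) = vol c x -> unimodular_at s x.
Proof.
move=> Xc Xd cx dx sx E c' d' Xc' Xd' cx' dx'.
have J1 : jac c' d s x = jac c' c id x *m jac c d s x :=
  jac_comp (@analytic_id _ _ X1 x) sx Xc' Xc Xd cx' cx dx.
have J2 : jac c' d' s x = jac c' d s x *m jac d d' id (s x) :=
  jac_comp sx (@analytic_id _ _ X2 (s x)) Xc' Xd Xd' cx' dx dx'.
have V1 := (vol_form X1).2 _ _ _ Xc' Xc cx' cx.
have V2 := (vol_form X2).2 _ _ _ Xd Xd' dx dx'.
exact: pull_chain J1 J2 V1 V2 E.
Qed.

End UnimodularGerms.

(** * Local extensions along phi1(M) and uniqueness of their germs *)

Section Germs.
Variable R : realType.
Local Notation C := (Num.NumField.sort (R[i] : numFieldType)).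
Variables (M : manifold R 3) (Psi : chart R 3 M -> M -> 'M[R[i]]_3).
Hypothesis hPsi : analytic_unimodular_CR Psi.

Lemma CR_neq0 c p : atlas M c -> cdom c p -> Psi c p != 0.
Proof.
move=> Mc cp; have := CR_free hPsi Mc cp; apply: contraL => /eqP ->.
apply/negP => /free_not0 /(_ (mem_head _ _)).
by rewrite (_ : map_mx _ _ = 0) ?eqxx //; apply/matrixP => i j; rewrite !mxE.
Qed.

Section OneSurface.
Variables (X : unimodular_surface R) (phi : M -> X).
Hypothesis aphi : analytic_map (atlas M) (@real_atlas R 2 X) phi.
Hypothesis vphi : pulls_vol_to phi Psi.

Lemma complexify_unimodular p c d : atlas M c -> atlas X d -> cdom c p -> cdom d (phi p) ->
  exists2 F : 'rV[C]_3 -> 'rV[C]_2, holo_map F (cplx (c p)) /\ row_full ('J F (cplx (c p))) &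
    \forall q \near p, [/\ cdom d (phi q), d (phi q) = F (cplx (c q)) &
      pull ('J F (cplx (c q))) (vol d (phi q)) = Psi c q].
Proof.
move=> Mc Xd cp dp; have [F hF FE] := complexify aphi Mc Xd cp dp.
have FE' : \forall q \near p, [/\ cdom d (phi q), d (phi q) = F (cplx (c q)) &
    pull ('J F (cplx (c q))) (vol d (phi q)) = Psi c q].
  apply: filterS2 FE (near_cdom Mc cp) => q [dq Fq Jq] cq.
  by split; [exact: dq | exact: Fq | rewrite -Jq; exact: vphi].
exists F => //; split=> //; have [_ _ E] := nbhs_singleton FE'.
apply: (pull_antisym ((vol_form X).1 d (phi p) Xd dp)); rewrite E; exact: CR_neq0.
Qed.

(** The target is any complex manifold: this compares maps into the other surface, and also a
    composite of two extensions with the identity of [X]. *)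
Lemma germ_unique m (Y : manifold R[i] m) (s s' : X -> Y) p :
  {for p, continuous phi} ->
  analytic_at_pt s (phi p) -> analytic_at_pt s' (phi p) ->
  (\forall q \near p, s (phi q) = s' (phi q)) ->
  \forall x \near phi p, s x = s' x.
Proof.
move=> cphi sa sa' ss'.
have [c Mc cp] := atlas_cover p; have [d Xd dp] := atlas_cover (phi p).
have [e Ye ep] := atlas_cover (s (phi p)).
have ep' : cdom e (s' (phi p)) by rewrite -(nbhs_singleton ss').
have [h [hh sh]] := analytic_represents Xd Ye dp ep sa.
have [h' [hh' sh']] := analytic_represents Xd Ye dp ep' sa'.
have [F [hF JF] FE] := complexify_unimodular Mc Xd cp dp.
have [_ Fp _] := nbhs_singleton FE.
have hq : \forall q \near p, h (F (cplx (c q))) = h' (F (cplx (c q))).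
  have n1 : \forall q \near p, e (s (phi q)) = h (d (phi q)).
    by apply: (cphi (fun x => e (s x) = h (d x))); apply: filterS sh => x [].
  have n2 : \forall q \near p, e (s' (phi q)) = h' (d (phi q)).
    by apply: (cphi (fun x => e (s' x) = h' (d x))); apply: filterS sh' => x [].
  have n3 : \forall q \near p, e (s (phi q)) = e (s' (phi q)).
    by apply: filterS ss' => q ->.
  have n4 : \forall q \near p, d (phi q) = F (cplx (c q)).
    by apply: filterS FE => q [].
  have n5 : \forall q \near p, h (d (phi q)) = h' (d (phi q)).
    by apply: filterS3 n1 n2 n3 => q <- <-.
  by apply: filterS2 n4 n5 => q <-.
have hx : \forall x \near c p, h (F (cplx x)) = h' (F (cplx x)).
  have := near_chart_inv p Mc cp hq.
  by apply: filterS => x [q [_ <- _]].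
have hz : \forall z \near d (phi p), forall j, h z 0 j = h' z 0 j.
  apply: near_forall => j; rewrite Fp.
  apply: (submersion_identity hF JF) => //.
  - by rewrite -Fp; exact: hh.
  - by rewrite -Fp; exact: hh'.
  - by apply: filterS hx => x ->.
have := near_chart Xd dp hz; apply: filterS3 sh sh' => x [ex E1] [ex' E2] E3.
by apply: (atlas_inj Ye ex ex'); rewrite E1 E2; apply/rowP.
Qed.

End OneSurface.

Lemma vol_chart_holo (X : unimodular_surface R) d x : atlas X d -> cdom d x ->
  forall i j, holo (fun z => vol d (chart_inv d x z) i j) (d x).
Proof. by move=> Xd dx i j; apply/analytic_holo; exact: (vol_holomorphic Xd dx i j). Qed.

Lemma local_germ (X1 X2 : unimodular_surface R) (phi1 : M -> X1) (phi2 : M -> X2) p :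
  analytic_map (atlas M) (@real_atlas R 2 X1) phi1 ->
  analytic_map (atlas M) (@real_atlas R 2 X2) phi2 ->
  pulls_vol_to phi1 Psi -> pulls_vol_to phi2 Psi ->
  exists2 s : X1 -> X2, \forall x \near phi1 p, analytic_at_pt s x /\ unimodular_at s x &
    \forall q \near p, s (phi1 q) = phi2 q.
Proof.
move=> a1 a2 v1 v2; have [c Mc cp] := atlas_cover p.
have [d1 X1d d1p] := atlas_cover (phi1 p); have [d2 X2d d2p] := atlas_cover (phi2 p).
have [f [hf Jf] fE] := complexify_unimodular a1 v1 Mc X1d cp d1p.
have [g [hg Jg] gE] := complexify_unimodular a2 v2 Mc X2d cp d2p.
have [_ fp _] := nbhs_singleton fE; have [_ gp _] := nbhs_singleton gE.
pose A1 z := vol d1 (chart_inv d1 (phi1 p) z).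
pose A2 z := vol d2 (chart_inv d2 (phi2 p) z).
have hA1 i j : holo (fun z => A1 z i j) (f (cplx (c p))).
  by rewrite -fp; exact: vol_chart_holo.
have hA2 i j : holo (fun z => A2 z i j) (g (cplx (c p))).
  by rewrite -gp; exact: vol_chart_holo.
pose B1 x := pull ('J f x) (A1 (f x)); pose B2 x := pull ('J g x) (A2 (g x)).
have hB n m (h : 'rV[C]_n -> 'rV[C]_m) (A : 'rV[C]_m -> 'M[C]_m) a i j :
    holo_map h a -> (forall i j, holo (fun z => A z i j) (h a)) ->
    holo (fun x => pull ('J h x) (A (h x)) i j) a.
  move=> hh hA; rewrite (_ : (fun _ => _) =
      (fun x => \sum_k (\sum_l 'J h x i l * A (h x) l k) * 'J h x j k)).
    apply: holo_sum => k; apply: holoM; last exact: holo_jacobian.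
    apply: holo_sum => l; apply: holoM; first exact: holo_jacobian.
    exact: (holo_comp hh (hA l k)).
  by apply/funext => x; rewrite /pull mxE; apply: eq_bigr => k _; rewrite !mxE.
have BQ : \forall q \near p, B1 (cplx (c q)) = B2 (cplx (c q)).
  apply: filterS2 fE gE => q [dq1 fq vq1] [dq2 gq vq2].
  have E1 : A1 (f (cplx (c q))) = vol d1 (phi1 q) by rewrite /A1 -fq chart_invK.
  have E2 : A2 (g (cplx (c q))) = vol d2 (phi2 q) by rewrite /A2 -gq chart_invK.
  exact: etrans (congr1 (pull _) E1)
    (etrans vq1 (etrans (esym vq2) (congr1 (pull _) (esym E2)))).
have BE : \forall x \near cplx (c p), forall i j, B1 x i j = B2 x i j.
  suff H (i j : 'I_3) : \forall x \near cplx (c p), B1 x i j = B2 x i j.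
    exact: near_forall (fun i => near_forall (H i)).
  have hB12 : holo (fun x => B1 x i j - B2 x i j) (cplx (c p)).
    by apply: holoB; exact: hB.
  have B0 : \forall x \near c p, B1 (cplx x) i j - B2 (cplx x) i j = 0.
    by have := near_chart_inv p Mc cp BQ; apply: filterS => x [q [_ <- _ ->]]; rewrite subrr.
  have := holo_identity hB12 B0.
  by apply: filterS => x /eqP; rewrite subr_eq0 => /eqP.
have A2u : \forall z \near g (cplx (c p)), A2 z \in unitmx.
  rewrite -gp; have := near_chart_inv (phi2 p) X2d d2p (near_cdom X2d d2p).
  apply: filterS => z [y [d2y _ e _]]; rewrite /A2 e.
  apply: antisym_unit; first exact: (vol_form X2).1.
  exact: vol_neq0.
have [|Phi [hPhi PhiE PhiV]] := @local_extension R 2 f g A1 A2 (cplx (c p)) hf hg Jf Jg A2u.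
  by apply: filterS BE => x E; apply/matrixP => i j; exact: E.
have PhiE' : \forall q \near p, Phi (f (cplx (c q))) = g (cplx (c q)).
  exact: (near_chart Mc cp (near_cplx PhiE)).
(* A total function, meaningful near [phi1 p] only; elsewhere it may take the default value
   [phi2 p]. *)
pose s x := chart_inv d2 (phi2 p) (Phi (d1 x)).
have Phip : Phi (d1 (phi1 p)) = d2 (phi2 p) by rewrite fp gp; exact: (nbhs_singleton PhiE').
have sE : \forall x \near phi1 p, cdom d2 (s x) /\ d2 (s x) = Phi (d1 x).
  have n2 := near_chart_inv (phi2 p) X2d d2p (near_cdom X2d d2p).
  rewrite -Phip in n2.
  have hPhi' : holo_map Phi (d1 (phi1 p)) by rewrite fp.
  have := near_chart X1d d1p (near_map hPhi' n2).
  by apply: filterS => x [y [dy Ey e _]]; rewrite /s e Ey.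
have sphi : \forall q \near p, s (phi1 q) = phi2 q.
  apply: filterS3 fE gE PhiE' => q [_ fq _] [d2q gq _] E.
  by rewrite /s fq E -gq chart_invK.
exists s => //.
have srep : represents d1 d2 s (phi1 p) Phi by split=> //; rewrite fp.
have srep' := represents_near X1d d1p srep.
have Vn : \forall x \near phi1 p, pull ('J Phi (d1 x)) (A2 (Phi (d1 x))) = A1 (d1 x).
  by rewrite -fp in PhiV; exact: (near_chart X1d d1p PhiV).
have n3 : \forall x \near phi1 p, cdom d1 x /\ cdom d2 (s x) /\ d2 (s x) = Phi (d1 x).
  exact: filterI (near_cdom X1d d1p) sE.
apply: filterS3 n3 srep' Vn => x [d1x [d2x sx]] rx Vx.
have ax := represents_analytic X1d X2d d1x rx; split=> //.
apply: (unimodular_charts X1d X2d d1x d2x ax).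
rewrite (represents_jac X1d d1x rx); move: Vx.
by rewrite /A1 /A2 -sx !chart_invK.
Qed.

End Germs.

(** * Gluing *)

Section Gluing.
Variables (X : topologicalType) (Y : Type) (A : set X) (G : (X -> Y) -> X -> Prop).
Hypothesis X_countable : @second_countable X.
Hypothesis X_regular : forall (x : X) (V : set X), nbhs x V ->
  exists W : set X, [/\ open W, W x & closure W `<=` V].
Hypothesis G_local : forall (s s' : X -> Y) x,
  (\forall y \near x, s y = s' y) -> G s x -> G s' x.
Hypothesis G_germ : forall a, A a -> exists s, \forall x \near a, G s x.
Hypothesis G_unique : forall a (s s' : X -> Y), A a ->
  (\forall x \near a, G s x) -> (\forall x \near a, G s' x) ->
  \forall x \near a, s x = s' x.

Lemma near_bounded (x : X) (P : nat -> X -> Prop) k :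
  (forall i, \forall y \near x, P i y) ->
  \forall y \near x, forall i, (i < k)%N -> P i y.
Proof.
move=> nP; elim: k => [|k IH]; first by apply: filterE.
apply: filterS2 IH (nP k) => y Py Pk i; rewrite ltnS leq_eqVlt => /orP[/eqP ->//|].
exact: Py.
Qed.

(* The sets W' i = W i minus the closures of the B j for j < i still cover A, and B k meets
   none of the W' i with i > k. *)
Lemma glue_germs : A !=set0 ->
  exists (U : set X) (s : X -> Y), [/\ open U, A `<=` U & forall x, U x -> G s x].
Proof.
move=> [a0 Aa0]; have [B0 /countable_injP[f f_inj] [B0_open B0_basis]] := X_countable.
have [s0 _] := G_germ Aa0.
pose Bn n := [set x | exists b, [/\ B0 b, f b = n & b x]].
(* A triple (V, W, s): [s] satisfies [G] on [V], and [W] leaves room on both sides between the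
   closure of the basic set and [V]. *)
pose ok n (t : set X * set X * (X -> Y)) := [/\ open t.1.1, open t.1.2,
  closure (Bn n) `<=` t.1.2, closure t.1.2 `<=` t.1.1 & forall x, t.1.1 x -> G t.2 x].
have /choice[t ht] : forall n, exists t : set X * set X * set X * (X -> Y),
    [/\ open t.1.1.1, open t.1.1.2, open t.1.2, closure t.1.2 `<=` t.1.1.2 &
      closure t.1.1.2 `<=` t.1.1.1] /\
    ((forall x, t.1.1.1 x -> G t.2 x) /\ ((exists u, ok n u) -> t.1.2 = Bn n)).
  move=> n; have [[[[V W] s] [/= oV oW BW WV Gs]]|nok] := pselect (exists u, ok n u).
    exists (V, W, Bn n, s); split=> //; split=> //=.
    rewrite openE => x [b [Bb fb bx]].
    apply: (@filterS _ (nbhs x) _ b) => [y y_b|]; first by exists b.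
    by apply: open_nbhs_nbhs; split=> //; exact: B0_open.
  (* A basic set without such a triple is replaced by the empty set; [s0] is an arbitrary
     function. *)
  exists (set0, set0, set0, s0); split; last by split.
  by split=> //=; rewrite ?closure0 //; exact: open0.
pose V i := (t i).1.1.1; pose W i := (t i).1.1.2; pose B i := (t i).1.2; pose s i := (t i).2.
have BW i : closure (B i) `<=` W i by have [[]] := ht i.
have WV i : closure (W i) `<=` V i by have [[]] := ht i.
have Vo i : open (V i) by have [[]] := ht i.
have Wo i : open (W i) by have [[]] := ht i.
have Bo i : open (B i) by have [[]] := ht i.
have Gs i x : V i x -> G (s i) x by have [_ [H _]] := ht i; exact: H.
have cover a : A a -> exists i, B i a.
  move=> Aa; have [u Gu] := G_germ Aa.
  pose V0 := [set x | G u x]°.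
  have V0a : nbhs a V0 by exact: nbhs_interior Gu.
  have [W0 [oW0 W0a W0V]] := X_regular V0a.
  have [W1 [oW1 W1a W1W]] := X_regular (open_nbhs_nbhs (conj oW0 W0a)).
  have [b [Bb ba] bW] := B0_basis a _ (open_nbhs_nbhs (conj oW1 W1a)).
  exists (f b); have BE : Bn (f b) = b.
    apply/seteqP; split=> x; last by move=> bx; exists b.
    by move=> [b' [Bb' /f_inj e b'x]]; rewrite -e ?inE.
  have [_ [_ Bf]] := ht (f b); rewrite /B Bf ?BE //.
  exists (V0, W0, u); split=> //=; first exact: open_interior.
    by rewrite BE; apply: subset_trans W1W; exact: closureS.
  by move=> x /interior_subset.
pose W' i := [set x | W i x /\ forall j, (j < i)%N -> ~ closure (B j) x].
have not_closure (D : set X) x : ~ closure D x -> \forall y \near x, ~ closure D y.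
  move=> nD; have := open_nbhs_nbhs (conj (closed_openC (@closed_closure _ D)) nD).
  exact.
have W'_near i x : W' i x -> \forall y \near x, W' i y.
  move=> [Wx nB]; have n1 := open_nbhs_nbhs (conj (Wo i) Wx).
  have : \forall y \near x, forall j, (j < i)%N -> (j < i)%N -> ~ closure (B j) y.
    apply: (near_bounded (P := fun j y => (j < i)%N -> ~ closure (B j) y)) => j.
    have [ji|ij] := boolP (j < i)%N; last by apply: filterE.
    by apply: filterS (not_closure _ _ (nB j ji)) => y ny _.
  by apply: filterS2 n1 => y Wy nBy; split=> // j ji; exact: nBy.
(* Where all available sections have the same value, the choice of an index does not matter. This
   set need not be open, hence the interior below. *)
pose U0 := [set x | (exists i, W' i x) /\ forall i j, W' i x -> W' j x -> s i x = s j x].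
have /choice[idx hidx] : forall x, exists i, (exists i, W' i x) -> W' i x.
  move=> x; have [[i Wi]|nW] := pselect (exists i, W' i x); first by exists i.
  by exists 0%N => /nW.
exists (U0°), (fun x => s (idx x) x); split.
- exact: open_interior.
- move=> a Aa; have [k Bka] := cover a Aa.
  have n0 : \forall x \near a, B k x by apply: open_nbhs_nbhs.
  have n1 : \forall x \near a, exists i, W' i x.
    (* For the least [i] with [a] in [W i], the closures of the earlier [B j] lie in [W j] and so
       miss [a]: the sets [W' i] still cover [A]. *)
    have exW : exists i, `[< W i a >].
      by exists k; apply/asboolP/BW/subset_closure.
    have /asboolP Wa := ex_minnP exW; case: ex_minnP Wa => i /asboolP Wi imin _.
    apply: filterS (W'_near i a _) => [x W'x|]; first by exists i.
    split=> // j ji /BW Wj; have := imin j; rewrite leqNgt ji.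
    by move=> /(_ (introT (asboolP _) Wj)).
  have n2 : \forall x \near a, forall i, (i < k.+1)%N -> forall j, (j < k.+1)%N ->
      W' i x -> W' j x -> s i x = s j x.
    apply: (near_bounded (P := fun i x => forall j, (j < k.+1)%N ->
      W' i x -> W' j x -> s i x = s j x)) => i.
    apply: near_bounded => j.
    (* Either [W i] is absent near [a], or [a] lies in [V i], where [s i] satisfies [G]. If the
       latter holds for both indices, uniqueness of germs at [a] applies. *)
    have [ci|nci] := pselect (closure (W i) a); last first.
      apply: filterS (not_closure _ _ nci) => x nx [Wx _].
      by case: nx; exact: subset_closure.
    have [cj|ncj] := pselect (closure (W j) a); last first.
      apply: filterS (not_closure _ _ ncj) => x nx _ [Wx _].
      by case: nx; exact: subset_closure.
    have Gn l : closure (W l) a -> \forall x \near a, G (s l) x.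
      move=> /WV Va; apply: filterS (open_nbhs_nbhs (conj (Vo l) Va)) => x; exact: Gs.
    have := G_unique Aa (Gn i ci) (Gn j cj).
    by apply: filterS => x ->.
  apply: filterS3 n0 n1 n2 => x Bx exW sE; split=> // i j Wi Wj.
  have small l : W' l x -> (l < k.+1)%N.
    move=> [_ nB]; rewrite ltnS leqNgt; apply/negP => /nB; apply.
    exact: subset_closure.
  exact: sE (small i Wi) _ (small j Wj) Wi Wj.
- move=> x Ux; have [exW _] := interior_subset Ux.
  have Wx := hidx x exW; set i := idx x in Wx *.
  have n1 := W'_near i x Wx; apply: (@G_local (s i)).
    apply: filterS2 n1 Ux => y Wy [exWy sE].
    exact: sE Wy (hidx y exWy).
  by apply: Gs; apply: WV; apply: subset_closure; case: Wx.
Qed.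

End Gluing.

(** * Regularity of complex manifolds *)

Section Regular.
Variable R : realType.
Local Notation C := (Num.NumField.sort (R[i] : numFieldType)).
Local Notation abs := (@normc R).

Lemma cvec_dist n (v w : 'rV[R]_(n + n)) i : abs (cvec v 0 i - cvec w 0 i) <=
  `|v 0 (lshift n i) - w 0 (lshift n i)| + `|v 0 (rshift n i) - w 0 (rshift n i)|.
Proof. by rewrite !mxE; exact: abs_ReIm. Qed.

Lemma cvec_continuous n (v : 'rV[R]_(n + n)) (P : 'rV[C]_n -> Prop) :
  (\forall z \near (cvec v : 'rV[C]_n), P z) -> \forall w \near v, P (cvec w).
Proof.
move=> /near_pdisc[r r0 H]; apply/near_real; exists (r / 2) => [|w Pw].
  exact: divr_gt0.
apply: H => i; apply: le_trans (cvec_dist _ _ _) _.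
by have := Pw (lshift n i); have := Pw (rshift n i); lra.
Qed.

(** A closed cube in the 2n real coordinates is compact, hence so is its image by the inverse of the
    chart, which is closed because the manifold is Hausdorff. The interior of this image is the
    required neighbourhood. *)
Lemma manifold_regular n (X : manifold R[i] n) (x : X) (V : set X) : nbhs x V ->
  exists W : set X, [/\ open W, W x & closure W `<=` V].
Proof.
move=> nV; have [c Xc cx] := atlas_cover x.
have /near_pdisc[r r0 H] := near_chart_inv x Xc cx nV.
pose v0 : 'rV[R]_(n + n) := row_mx (map_mx (@complex.Re R) (c x)) (map_mx (@complex.Im R) (c x)).
have v0E : cvec v0 = c x := cvec_realify _.
(* Half the radius, since a modulus is bounded by the sum of the absolute values of the real and
   imaginary parts. *)
pose I i : set R := `[v0 0 i - r / 2, v0 0 i + r / 2]%classic.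
pose Q := [set v : 'rV[R]_(n + n) | forall i, I i (v ord0 i)].
have Qc : compact Q by apply: (@rV_compact R _ I) => i; exact: segment_compact.
have QP v : Q v -> pdisc (c x) r (cvec v).
  move=> Qv i; rewrite -v0E; apply: le_trans (cvec_dist _ _ _) _.
  have := Qv (lshift n i); have := Qv (rshift n i).
  rewrite /I /= !in_itv /= => /andP[h1 h2] /andP[h3 h4].
  rewrite [r]splitr; apply: lerD; rewrite ler_distl; apply/andP; split; lra.
pose K := (fun v => chart_inv c x (cvec v)) @` Q.
have Kc : compact K.
  apply: continuous_compact Qc; apply: continuous_in_subspaceT => v; rewrite inE => Qv.
  have [q [cq Eq Iq _]] := H _ (QP v Qv).
  move=> N; rewrite /= Iq => nN.
  have := near_chart_inv x Xc cq nN; rewrite Eq => n1.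
  by apply: filterS (cvec_continuous n1) => w [y [_ _ <-]].
have Kcl : closed K := compact_closed (@manifold_hausdorff _ _ X) Kc.
exists (K°); split; first exact: open_interior.
- have n1 : \forall z \near c x, exists2 v, Q v & cvec v = z.
    apply/near_pdisc; exists (r / 2) => [|z Pz]; first exact: divr_gt0.
    exists (row_mx (map_mx (@complex.Re R) z) (map_mx (@complex.Im R) z)); last exact: cvec_realify.
    move=> i; rewrite /I /= in_itv /= -ler_distl /v0; rewrite -(splitK i).
    case: (fintype.split i) => j /=; [rewrite !row_mxEl | rewrite !row_mxEr]; rewrite !mxE -raddfB.
      exact: le_trans (abs_Re _) (Pz j).
    exact: le_trans (abs_Im _) (Pz j).
  apply: filterS2 (near_chart Xc cx n1) (near_cdom Xc cx) => q [v Qv E] cq.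
  by exists v => //; rewrite E chart_invK.
- move=> y /(closureS (@interior_subset _ K)); rewrite -(iffLR (closure_id _) Kcl).
  by move=> [v Qv <-]; have [q [_ _ -> ]] := H _ (QP v Qv).
Qed.

End Regular.

(** * Maps between subsets and total functions inducing them *)

Section Restriction.
Variable R : realType.
Local Notation C := (Num.NumField.sort (R[i] : numFieldType)).
Variables (n m : nat) (X : manifold R[i] n) (Y : manifold R[i] m).
Variables (U : set X) (V : set Y) (Phi : U -> V) (s : X -> Y).
Implicit Types (c : chart R[i] n X) (d : chart R[i] m Y).
Hypotheses (oU : open U) (sPhi : forall u : U, set_val (Phi u) = s (set_val u)).

(** Near the coordinates of a point of the open set [U], the inverse of the restricted chart returns
    the same point as that of the chart, so both expressions have the same germ. *)
Lemma coord_expr_restrict c d (u : U) : atlas X c -> cdom c (set_val u) ->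
  \forall z \near c (set_val u),
    coord_expr (restrict_chart U c) (restrict_chart V d) Phi u z =
      coord_expr c d s (set_val u) z /\
    (cdom (restrict_chart V d) (Phi (chart_inv (restrict_chart U c) u z)) <->
     cdom d (s (chart_inv c (set_val u) z))).
Proof.
move=> Xc cu; have Uu : nbhs (set_val u) U.
  by apply: open_nbhs_nbhs; split=> //; exact/set_mem/(valP u).
have := near_chart_inv (set_val u) Xc cu Uu; apply: filterS => z [q [cq Eq Iq Uq]].
have Ir : set_val (chart_inv (restrict_chart U c) u z) = q.
  rewrite /chart_inv; case: xgetP => [w _ [cw Ew]|/(_ (SigSub (mem_set Uq)))[]].
    by apply: (atlas_inj Xc cw cq); rewrite Eq -Ew.
  by split.
by rewrite /coord_expr /= sPhi Ir Iq.
Qed.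

Lemma analytic_map_restrict :
  analytic_map (sub_atlas X U) (sub_atlas Y V) Phi <->
  forall x, U x -> analytic_at_pt s x.
Proof.
split=> [aPhi x Ux c d Xc Yd cx dx|as_ u _ _ [c Xc <-] [d Yd <-] cu du].
  pose u : U := SigSub (mem_set Ux).
  have du : cdom (restrict_chart V d) (Phi u) by rewrite /= sPhi.
  have [n1 n2] := aPhi u _ _ (ex_intro2 _ _ c Xc erefl) (ex_intro2 _ _ d Yd erefl) cx du.
  have n3 := @coord_expr_restrict c d u Xc cx; split=> [|j].
    by apply: filterS2 n1 n3 => z cd [_ [H _]]; exact: H.
  apply/analytic_holo; have /analytic_holo := n2 j; apply: holo_ext.
  by apply: filterS n3 => z [-> _].
have Uu : U (set_val u) by exact/set_mem/(valP u).
have du' : cdom d (s (set_val u)) by rewrite -sPhi.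
have [n1 n2] := as_ _ Uu c d Xc Yd cu du'.
have n3 := @coord_expr_restrict c d u Xc cu; split=> [|j].
  by apply: filterS2 n1 n3 => z cd [_ [_ H]]; exact: H.
apply/analytic_holo; have /analytic_holo := n2 j; apply: holo_ext.
by apply: filterS n3 => z [<- _].
Qed.

Lemma jac_restrict c d (u : U) : atlas X c -> atlas Y d -> cdom c (set_val u) ->
  cdom d (s (set_val u)) -> analytic_at_pt s (set_val u) ->
  jac (restrict_chart U c) (restrict_chart V d) Phi u = jac c d s (set_val u).
Proof.
move=> Xc Yd cu du su; apply/esym; apply: eq_jacobian.
  by move=> j; apply/analytic_holo; have [_] := su c d Xc Yd cu du.
by apply: filterS (@coord_expr_restrict c d u Xc cu) => z [E _]; exact: esym E.
Qed.

End Restriction.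

(** * Existence and uniqueness of the unimodular extension *)

Section Extension.
Variable R : realType.
Local Notation C := (Num.NumField.sort (R[i] : numFieldType)).

Lemma unimodular_ext (X1 X2 : unimodular_surface R) (s s' : X1 -> X2) x :
  (\forall y \near x, s y = s' y) -> analytic_at_pt s x ->
  unimodular_at s x -> unimodular_at s' x.
Proof.
move=> ss' sx us; have [c [d [h [Xc Yd cx dx sh]]]] := analytic_exists sx.
have sx' := nbhs_singleton ss'; have dx' : cdom d (s' x) by rewrite -sx'.
apply: (unimodular_charts Xc Yd cx dx' (analytic_ext ss' sx)).
rewrite (represents_jac Xc cx (represents_ext ss' sh)) -(represents_jac Xc cx sh) -sx'.
exact: us.
Qed.

Variables (M : manifold R 3) (Psi : chart R 3 M -> M -> 'M[R[i]]_3).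
Hypothesis hPsi : analytic_unimodular_CR Psi.

(** The pointwise property that is glued. Its last clause only constrains the points of phi1(M): it
    is what makes two germs with this property agree, and it survives the gluing. *)
Definition extends_at (X1 X2 : unimodular_surface R) (phi1 : M -> X1) (phi2 : M -> X2)
    (s : X1 -> X2) x : Prop :=
  [/\ analytic_at_pt s x, unimodular_at s x & forall q, phi1 q = x -> s x = phi2 q].

Lemma global_extension (X1 X2 : unimodular_surface R) (phi1 : M -> X1) (phi2 : M -> X2)
    (p0 : M) :
  analytic_embedding phi1 -> analytic_embedding phi2 ->
  pulls_vol_to phi1 Psi -> pulls_vol_to phi2 Psi ->
  exists (U : set X1) (s : X1 -> X2),
    [/\ open U, range phi1 `<=` U & forall x, U x -> extends_at phi1 phi2 s x].
Proof.
move=> [[inj1 cont1 emb1] an1 _] [_ an2 _] v1 v2.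
apply: (@glue_germs X1 X2 (range phi1) (extends_at phi1 phi2)).
- exact: manifold_countable.
- exact: manifold_regular.
- move=> s s' x ss' [sa su sE]; split.
  + exact: analytic_ext ss' sa.
  + exact: unimodular_ext ss' sa su.
  + by rewrite -(nbhs_singleton ss').
- move=> _ [p _ <-]; have [s sg sphi] := local_germ hPsi p an1 an2 v1 v2.
  (* The local extension has the right value at phi1(q) for [q] in [O] only. The embedding provides
     an open [W] meeting phi1(M) exactly in phi1(O), and injectivity identifies the two preimages of
     a point there. *)
  exists s; pose O := [set q | s (phi1 q) = phi2 q]°.
  have [W oW WE] := emb1 O (@open_interior _ _).
  have Wp : W (phi1 p).
    have : (phi1 @` O) (phi1 p) by exists p.
    by rewrite WE => -[].
  have nW : \forall x \near phi1 p, W x by apply: open_nbhs_nbhs.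
  apply: filterS2 sg nW => x [sa su] Wx; split; [exact: sa | exact: su | move=> q qx].
  have : (W `&` range phi1) x by split=> //; exists q.
  rewrite -WE => -[q' /interior_subset /= sq' q'x].
  by rewrite -qx; have <- : q' = q by apply: inj1; rewrite q'x qx.
- move=> _ s s' [p _ <-] sG s'G.
  have [sa _ _] := nbhs_singleton sG; have [sa' _ _] := nbhs_singleton s'G.
  apply: (germ_unique hPsi an1 v1 (cont1 p) sa sa').
  have n1 : \forall q \near p, extends_at phi1 phi2 s (phi1 q) := cont1 p _ sG.
  have n2 : \forall q \near p, extends_at phi1 phi2 s' (phi1 q) := cont1 p _ s'G.
  apply: filterS2 n1 n2 => q [_ _ E1] [_ _ E2].
  by rewrite (E1 q erefl) (E2 q erefl).
- by exists (phi1 p0), p0.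
Qed.

Lemma extension_exists (X1 X2 : unimodular_surface R) (phi1 : M -> X1) (phi2 : M -> X2) :
  analytic_embedding phi1 -> analytic_embedding phi2 ->
  pulls_vol_to phi1 Psi -> pulls_vol_to phi2 Psi ->
  exists (U1 : set X1) (U2 : set X2) (Phi : U1 -> U2), unimodular_extension phi1 phi2 Phi.
Proof.
(* If [M] is empty, the empty map between empty sets will do; gluing requires a point, to have some
   total function from one surface to the other. *)
move=> emb1 emb2 v1 v2; have [[p0 _]|noM] := pselect (exists p : M, True); last first.
  have Phi : (set0 : set X1) -> (set0 : set X2) by move=> [x]; rewrite in_set0.
  have no (x : (set0 : set X1)) : False by case: x => x; rewrite in_set0.
  have no' (x : (set0 : set X2)) : False by case: x => x; rewrite in_set0.
  exists set0, set0, Phi; split.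
  - by split; exact: open0.
  - by split=> x [p _ _]; case: noM; exists p.
  - split; last by move=> x; exfalso; exact: (no x).
    split; first by move=> x; exfalso; exact: (no x).
    exists (fun x => False_rect _ (no' x)); split.
    + by move=> x; exfalso; exact: (no x).
    + by move=> x; exfalso; exact: (no' x).
    + by move=> x; exfalso; exact: (no' x).
  - by move=> p; case: noM; exists p.
have [T1 [s [oT1 T1r Es]]] := global_extension p0 emb1 emb2 v1 v2.
have [T2 [t [oT2 T2r Et]]] := global_extension p0 emb2 emb1 v2 v1.
(* The open sets on which one composite of the two extensions [s] and [t] is the identity. *)
pose W1 := [set x | [/\ T1 x, T2 (s x) & t (s x) = x]]°.
pose W2 := [set y | [/\ T2 y, T1 (t y) & s (t y) = y]]°.
have W1E x : W1 x -> [/\ T1 x, T2 (s x) & t (s x) = x] by exact: interior_subset.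
have W2E y : W2 y -> [/\ T2 y, T1 (t y) & s (t y) = y] by exact: interior_subset.
have inW (Y Z : unimodular_surface R) (f : M -> Y) (g : M -> Z) (S : set Y) (S' : set Z)
    (u : Y -> Z) (u' : Z -> Y) p :
    analytic_embedding f -> pulls_vol_to f Psi -> open S -> open S' ->
    range f `<=` S -> range g `<=` S' ->
    (forall x, S x -> extends_at f g u x) -> (forall x, S' x -> extends_at g f u' x) ->
    nbhs (f p) [set x | [/\ S x, S' (u x) & u' (u x) = x]].
  move=> [[_ cf _] af _] vf oS oS' fS gS Eu Eu'.
  have uf q : u (f q) = g q by have [_ _ E] := Eu (f q) (fS _ (imageT f q)); exact: E.
  have u'g q : u' (g q) = f q by have [_ _ E] := Eu' (g q) (gS _ (imageT g q)); exact: E.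
  have [ua _ _] := Eu (f p) (fS _ (imageT f p)).
  have [u'a _ _] := Eu' (g p) (gS _ (imageT g p)).
  have n1 : \forall x \near f p, S x by apply: open_nbhs_nbhs; split=> //; exact/fS/imageT.
  have n2 : \forall x \near f p, S' (u x).
    by apply: (analytic_continuous ua); apply: open_nbhs_nbhs; split=> //; rewrite uf; exact/gS/imageT.
  (* The composite and the identity agree on the image of [M], so uniqueness of germs applies with
     the surface itself as target. *)
  have n3 : \forall x \near f p, (u' \o u) x = x.
    apply: (germ_unique hPsi af vf (s := u' \o u) (s' := id) (cf p)).
    - by apply: analytic_comp => //; rewrite uf.
    - exact: analytic_id.
    - by apply: filterE => q /=; rewrite uf u'g.
  by apply: filterS3 n1 n2 n3 => x h1 h2 h3; split.
have rW1 p : W1 (phi1 p) by apply: (inW _ _ phi1 phi2).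
have rW2 p : W2 (phi2 p) by apply: (inW _ _ phi2 phi1).
have sphi p : s (phi1 p) = phi2 p by have [_ _ E] := Es _ (T1r _ (imageT phi1 p)); exact: E.
have tphi p : t (phi2 p) = phi1 p by have [_ _ E] := Et _ (T2r _ (imageT phi2 p)); exact: E.
(* With [W1] and [W2] alone, [s] need not map into [W2]. After this cut, [s] maps [U1] into [U2]:
   for [x] in [U1], [s x] is in [W2] and [t (s x) = x] is in [W1]. *)
pose U1 := [set x | W1 x /\ W2 (s x)]; pose U2 := [set y | W2 y /\ W1 (t y)].
have oU1 : open U1.
  rewrite openE => x [W1x W2x]; have [T1x _ _] := W1E x W1x; have [sa _ _] := Es x T1x.
  have n1 := open_nbhs_nbhs (conj (@open_interior _ _) W1x).
  have n2 := analytic_continuous sa (open_nbhs_nbhs (conj (@open_interior _ _) W2x)).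
  exact: filterI n1 n2.
have oU2 : open U2.
  rewrite openE => y [W2y W1y]; have [T2y _ _] := W2E y W2y; have [ta _ _] := Et y T2y.
  have n1 := open_nbhs_nbhs (conj (@open_interior _ _) W2y).
  have n2 := analytic_continuous ta (open_nbhs_nbhs (conj (@open_interior _ _) W1y)).
  exact: filterI n1 n2.
have sU (x : U1) : U2 (s (set_val x)).
  have [W1x W2x] := set_mem (valP x); split=> //.
  by have [_ _ ->] := W1E _ W1x.
have tU (y : U2) : U1 (t (set_val y)).
  have [W2y W1y] := set_mem (valP y); split=> //.
  by have [_ _ ->] := W2E _ W2y.
pose Phi (x : U1) : U2 := SigSub (mem_set (sU x)).
pose Phi' (y : U2) : U1 := SigSub (mem_set (tU y)).
have U1T x : U1 x -> T1 x by move=> [/W1E[]].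
have U2T y : U2 y -> T2 y by move=> [/W2E[]].
exists U1, U2, Phi; split.
- by split.
- split=> _ [p _ <-]; first by split; [exact: rW1 | rewrite sphi; exact: rW2].
  by split; [exact: rW2 | rewrite tphi; exact: rW1].
- split; first split.
  + apply/(analytic_map_restrict (s := s) oU1) => // x /U1T T1x.
    by have [sa _ _] := Es x T1x.
  + exists Phi'; split.
    * move=> x; apply: val_inj => /=; have [W1x _] := set_mem (valP x).
      by have [_ _ ->] := W1E _ W1x.
    * move=> y; apply: val_inj => /=; have [W2y _] := set_mem (valP y).
      by have [_ _ ->] := W2E _ W2y.
    * apply/(analytic_map_restrict (s := t) oU2) => // y /U2T T2y.
      by have [ta _ _] := Et y T2y.
  + move=> u c d Xc Xd cu du; have [sa su _] := Es _ (U1T _ (set_mem (valP u))).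
    rewrite (jac_restrict (s := s) oU1) //; exact: su.
- by move=> p u Eu; exact: etrans (esym (sphi p)) (congr1 s (esym Eu)).
Qed.

Lemma extension_unique (X1 X2 : unimodular_surface R) (phi1 : M -> X1) (phi2 : M -> X2)
    (U1 : set X1) (U2 : set X2) (Phi : U1 -> U2)
    (U1' : set X1) (U2' : set X2) (Phi' : U1' -> U2') :
  analytic_embedding phi1 -> pulls_vol_to phi1 Psi ->
  unimodular_extension phi1 phi2 Phi -> unimodular_extension phi1 phi2 Phi' ->
  exists V1 : set X1,
    [/\ open V1, V1 `<=` U1 `&` U1', range phi1 `<=` V1 &
      forall (p : U1) (p' : U1'), set_val p = set_val p' -> V1 (set_val p) ->
        set_val (Phi' p') = set_val (Phi p)].
Proof.
move=> [[_ cont1 _] an1 _] v1 ext ext'.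
(* Turns a map between subsets into a total function, with the value [phi2 p0] outside of the
   domain, so that uniqueness of germs can be applied. *)
have total (W1 : set X1) (W2 : set X2) (F : W1 -> W2) :
    unimodular_extension phi1 phi2 F -> M ->
    exists s : X1 -> X2, [/\ forall x : W1, set_val (F x) = s (set_val x),
      forall x, W1 x -> analytic_at_pt s x & forall p, s (phi1 p) = phi2 p].
  move=> [[oW1 oW2] [r1 _] [[aF _] _] FE] p0.
  have /choice[s sE] : forall x, exists y, forall u : W1, set_val u = x -> set_val (F u) = y.
    move=> x; have [Wx|nWx] := pselect (W1 x).
      exists (set_val (F (SigSub (mem_set Wx)))) => u ux; congr (set_val (F _)).
      exact: val_inj.
    exists (phi2 p0) => u ux; case: nWx; rewrite -ux; exact/set_mem/(valP u).
  have sF (u : W1) : set_val (F u) = s (set_val u) by exact: sE.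
  exists s; split=> //; first exact/(analytic_map_restrict (s := s) oW1 sF).
  move=> p; pose u : W1 := SigSub (mem_set (r1 _ (imageT phi1 p))).
  by rewrite (FE p u erefl) sF.
have [[p0 _]|noM] := pselect (exists p : M, True); last first.
  exists set0; split=> //; first exact: open0.
  by move=> x [p _ _]; case: noM; exists p.
have [s [sF sa sphi]] := total _ _ _ ext p0.
have [s' [sF' sa' sphi']] := total _ _ _ ext' p0.
have [[oU1 _] [r1 _] _ _] := ext; have [[oU1' _] [r1' _] _ _] := ext'.
exists ([set x | [/\ U1 x, U1' x & s x = s' x]]°); split.
- exact: open_interior.
- by move=> x /interior_subset[].
- move=> _ [p _ <-].
  have U1p := r1 _ (imageT phi1 p); have U1p' := r1' _ (imageT phi1 p).
  have n3 : \forall x \near phi1 p, s x = s' x.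
    apply: (germ_unique hPsi an1 v1 (cont1 p) (sa _ U1p) (sa' _ U1p')).
    by apply: filterE => q; rewrite sphi sphi'.
  have n1 := open_nbhs_nbhs (conj oU1 U1p); have n2 := open_nbhs_nbhs (conj oU1' U1p').
  by apply: filterS3 n1 n2 n3 => x h1 h2 h3; split.
- move=> p p' pp' /interior_subset[_ _ E].
  by rewrite sF sF' -pp' E.
Qed.

End Extension.

Theorem proposition3 (R : realType) (M : manifold R 3)
    (Psi : chart R 3 M -> M -> 'M[R[i]]_3)
    (hPsi : analytic_unimodular_CR Psi)
    (X1 X2 : unimodular_surface R) (phi1 : M -> X1) (phi2 : M -> X2)
    (emb1 : analytic_embedding phi1) (emb2 : analytic_embedding phi2)
    (pull1 : pulls_vol_to phi1 Psi) (pull2 : pulls_vol_to phi2 Psi) :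
  (exists (U1 : set X1) (U2 : set X2) (Phi : U1 -> U2),
     unimodular_extension phi1 phi2 Phi) /\
  (forall (U1 : set X1) (U2 : set X2) (Phi : U1 -> U2)
          (U1' : set X1) (U2' : set X2) (Phi' : U1' -> U2'),
     unimodular_extension phi1 phi2 Phi ->
     unimodular_extension phi1 phi2 Phi' ->
     exists V1 : set X1,
       [/\ open V1, V1 `<=` U1 `&` U1', range phi1 `<=` V1 &
           forall (p : U1) (p' : U1'), set_val p = set_val p' -> V1 (set_val p) ->
             set_val (Phi' p') = set_val (Phi p)]).
Proof.
split=> [|U1 U2 Phi U1' U2' Phi']; first exact: (extension_exists hPsi).
exact: (extension_unique hPsi).
Qed.
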